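(* Let $a\ge 2$ be an integer and let $G'$ be a graph (with labeled vertices and a fixed total order on its edges) such that $\mathrm{FT}(G')$ has a first-preserving involution. Let $G=C_a+G'$. Then $\mathrm{FT}(G)$ also has a first-preserving involution, and the chromatic symmetric function of $G$ is $$X_G(\boldsymbol{x})=\sum_{k=1}^{|G'|}X^{(k)}_{G'}(\boldsymbol{x})\cdot B_{a,k}(\boldsymbol{x}).$$ Moreover, for every positive integer $i$, $$X_G^{(i)}(\boldsymbol{x})=\sum_{k=1}^{|G'|}X^{(k)}_{G'}(\boldsymbol{x})\cdot B_{a,k}^{(i)}(\boldsymbol{x}).$$
   Context: **Graphs.** All graphs are finite, undirected and loopless, have vertices labeled $1,\dots,n$, and come with a fixed total order on their edges; $|G|$ is the number of vertices of $G$. The chromatic symmetric function is $X_G(\boldsymbol{x})=\sum_{\kappa}\prod_{v=1}^n x_{\kappa(v)}$, summed over proper colorings $\kappa:V(G)\to\mathbb{N}$ (in the variables $\boldsymbol{x}=(x_i)_{i\in\mathbb N}$). $e_k$ (also written $e_{(k)}$) is the $k$-th elementary symmetric function, $e_0=1$, and $e_\lambda=\prod_i e_{\lambda_i}$. **Cycles and sums.** $C_a$ is the graph on $\{1,\dots,a\}$ with edges ordered $(1,2)<(2,3)<\cdots<(a-1,a)<(a,1)$ (for $a=2$ this is a single edge). If $G_1,G_2$ have $k_1,k_2$ vertices, $G_1+G_2$ is the graph on $\{1,\dots,k_1+k_2-1\}$ with edge set $E(G_1)\cup\{(i+k_1-1,j+k_1-1):(i,j)\in E(G_2)\}$ (the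 last vertex of $G_1$ is glued to the first vertex of $G_2$); the edge orders of $G_1$ and $G_2$ are kept, and all edges of $G_1$ are smaller than all edges of $G_2$. **Compositions.** $\alpha\models n$ means that $\alpha=(\alpha_1,\dots,\alpha_l)$ is a tuple of positive integers with sum $n$; $\mathrm{len}(\alpha)=l$, and $\alpha_l$ always denotes the last part. $\mathrm{sort}$ rearranges a tuple in weakly decreasing order, $\cdot$ is concatenation, and $\alpha\setminus\alpha_1$ is $\alpha$ with its first part deleted. A part equal to $0$ contributes $e_0=1$. Empty products equal $1$. **Forest triples.** A broken circuit of $G$ is a cycle of $G$ with its largest edge removed. A non-broken circuit is a spanning subgraph $F$ of $G$ containing no broken circuit (hence $F$ is a forest). A forest triple of $G$ is a set $\mathcal F=\{(T_1,\alpha^{(1)},r_1),\dots,(T_m,\alpha^{(m)},r_m)\}$ where $T_1,\dots,T_m$ are the connected components (isolated vertices included) of some non-broken circuit of $G$, $\alpha^{(j)}\models |T_j|$, and $1\le r_j\le\alpha^{(j)}_1$ is an integer. $\mathrm{FT}(G)$ is the set of all forest triples of $G$. $\mathrm{type}(\mathcal F)=\mathrm{sort}(\alpha^{(1)}\cdots\alpha^{(m)})$ and $\mathrm{sign}(\mathcal F)=(-1)^{\sum_j(\mathrm{len}(\alpha^{(j)})-1)}$. $\mathcal F$ is unit if every $\mathrm{len}(\alpha^{(j)})=1$. The triple $(T_{\min},\alpha^{(\min)},r_{\min})\in\mathcal F$ is the one whose tree contains the smallest vertex of $G$. $\mathrm{type}'(\mathcal F)$ is obtained from $\mathrm{type}(\mathcal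 F)$ by removing one part equal to $\alpha^{(\min)}_1$, i.e. it is the sorted concatenation of $\alpha^{(\min)}\setminus\alpha^{(\min)}_1$ and all the other compositions. **First-preserving involution.** For a set $S$ of forest triples of $G$, a first-preserving involution on $S$ is a map $\varphi:S\to S$ with $\varphi\circ\varphi=\mathrm{id}$; $\mathrm{type}(\varphi(\mathcal F))=\mathrm{type}(\mathcal F)$; $\mathrm{sign}(\varphi(\mathcal F))\ne\mathrm{sign}(\mathcal F)$ whenever $\varphi(\mathcal F)\neq\mathcal F$; every fixed point is unit (hence has sign $1$); and $\alpha^{(\min)}_1$ and $r_{\min}$ are the same for $\mathcal F$ and $\varphi(\mathcal F)$. **Pieces.** $\mathrm{FT}^{(i)}(G)$ is the set of $\mathcal F\in\mathrm{FT}(G)$ with $\alpha_1^{(\min)}=i$ and $r_{\min}=1$, and $X_G^{(i)}(\boldsymbol{x})=\sum_{\mathcal F\in\mathrm{FT}^{(i)}(G)}\mathrm{sign}(\mathcal F)\,e_{\mathrm{type}'(\mathcal F)}$. **The functions $B$.** Let $U_k$ be a tree with $k$ vertices. $\mathrm{FT}'(C_a+U_k)$ is the set of $\mathcal F\in\mathrm{FT}(C_a+U_k)$ such that the tree triple $(T,\alpha,r)\in\mathcal F$ with $a\in V(T)$ satisfies $E(U_k)\subseteq E(T)$ and $\alpha_l\ge k$. $\mathrm{FT}'^{(i)}(C_a+U_k)$ is the subset where $\alpha^{(\min)}_1=i$ and $r_{\min}=1$. Put $$B_{a,k}(\boldsymbol{x})=\sum_{\mathcal F\in\mathrm{FT}'(C_a+U_k)}\mathrm{sign}(\mathcal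 F)e_{\mathrm{type}(\mathcal F)},\qquad B^{(i)}_{a,k}(\boldsymbol{x})=\sum_{\mathcal F\in\mathrm{FT}'^{(i)}(C_a+U_k)}\mathrm{sign}(\mathcal F)e_{\mathrm{type}'(\mathcal F)}.$$ These do not depend on the choice of the tree $U_k$. Explicitly, $$B_{a,k}=\sum_{\substack{\alpha\models a+k,\ \mathrm{len}(\alpha)\ge2\\ \alpha_1\le k,\ \alpha_2\ge k}}(\alpha_2-\alpha_1+1)(\alpha_1+\alpha_2-k-1)(\alpha_3-1)\cdots(\alpha_l-1)\,e_{\mathrm{sort}(\alpha_1-1,\alpha_2,\dots,\alpha_l)}.$$ Also, $B^{(i)}_{a,k}=\sum_{\alpha\models a+k-i-1,\ \alpha_1\ge k}(k-i)(\alpha_2-1)\cdots(\alpha_l-1)e_{\mathrm{sort}(\alpha)}$ if $1\le i\le k-1$; $B^{(i)}_{a,k}=\sum_{\alpha\models a+k-i,\ \alpha_1\le k}(i-k)(\alpha_2-1)\cdots(\alpha_l-1)e_{\mathrm{sort}(\alpha_1-1,\alpha_2,\dots,\alpha_l)}$ if $k\le i\le a+k-1$; and $B^{(i)}_{a,k}=0$ if $i\ge a+k$. *)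

(* Defs.v *)
From HB Require Import structures.
From mathcomp Require Import all_boot all_order all_algebra finmap multiset.
From mathcomp Require Import boolp classical_sets functions cardinality fsbigop.

Set Implicit Arguments.
Unset Strict Implicit.
Unset Printing Implicit Defensive.

Import Order.TTheory GRing.Theory Num.Theory.

Local Open Scope ring_scope.

(* Formal power series over Z in the variables x_0, x_1, x_2, ...
   A monomial x_{i_1} ... x_{i_d} is the multiset {i_1, ..., i_d}, so that
   msetD is the product of monomials; a power series is its coefficient
   function, with the Cauchy product. *)

Definition pseries := {mset nat}%mset -> int.

HB.instance Definition _ := gen_eqMixin pseries.
HB.instance Definition _ := gen_choiceMixin pseries.

Section PowerSeries.

Local Open Scope mset_scope.
Implicit Types (m d : {mset nat}) (f g h : pseries).

Definition ps_zero : pseries := fun=> 0.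
Definition ps_opp f : pseries := fun m => - f m.
Definition ps_add f g : pseries := fun m => f m + g m.
Definition ps_one : pseries := fun m => (m == mset0)%:R.
Definition ps_mul f g : pseries := fun m =>
  \sum_(p \in [set p : {mset nat} * {mset nat} | (p.1 `+` p.2)%mset = m]%classic)
    f p.1 * g p.2.

Lemma ps_addA : associative ps_add.
Proof. by move=> f g h; apply/funext => m; exact: addrA. Qed.
Lemma ps_addC : commutative ps_add.
Proof. by move=> f g; apply/funext => m; exact: addrC. Qed.
Lemma ps_add0 : left_id ps_zero ps_add.
Proof. by move=> f; apply/funext => m; exact: add0r. Qed.
Lemma ps_addN : left_inverse ps_zero ps_opp ps_add.
Proof. by move=> f; apply/funext => m; exact: addNr. Qed.

Definition divs m : seq {mset nat} :=
  undup [seq seq_mset (mask t (m : seq nat))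
        | t : (size (m : seq nat)).-tuple bool].

Lemma uniq_divs m : uniq (divs m). Proof. exact: undup_uniq. Qed.
Hint Resolve uniq_divs : core.

Lemma mem_divs m d : (d \in divs m) = (d `<=` m).
Proof.
rewrite mem_undup; apply/fintype.imageP/msubsetP => [[t _ ->] x|le_dm].
  by rewrite mset_seqE -(count_mem_mset x m) leq_count_subseq ?mask_subseq.
have /count_subseqP[s /subseqP[t st ->] dst] :
  forall x, (count_mem x (d : seq nat) <= count_mem x (m : seq nat))%N.
  by move=> x; rewrite !count_mem_mset.
exists (Tuple (introT eqP st)) => //=.
by rewrite -[LHS]seq_mset_id; apply/eq_seq_msetP.
Qed.

Lemma msetDBK m d : d `<=` m -> d `+` (m `\` d) = m.
Proof. by move=> /msubsetP le; apply/msetP => x; rewrite !msetE2 subnKC. Qed.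

Lemma ps_mulE f g m : ps_mul f g m = \sum_(d <- divs m) f d * g (m `\` d).
Proof.
rewrite [RHS]fsbig_seq // /ps_mul.
rewrite (@reindex_fsbig _ 0 +%R _ _ (fun d => (d, m `\` d)) [set` divs m]%classic) //.
split=> [d|d e _ _ [] //|[d e] /= <-].
  by rewrite /= mem_divs; exact: msetDBK.
exists d; last by rewrite msetDKB.
by rewrite /= mem_divs; apply/msubsetP => x; rewrite msetE2 leq_addr.
Qed.

Lemma msubsetB m d : m `\` d `<=` m.
Proof. by apply/msubsetP => x; rewrite msetE2 leq_subr. Qed.

Lemma msetBK m d : d `<=` m -> m `\` (m `\` d) = d.
Proof. by move=> /msubsetP le; apply/msetP => x; rewrite !msetE2 subKn. Qed.

Lemma ps_mulC : commutative ps_mul.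
Proof.
move=> f g; apply/funext => m; rewrite !ps_mulE.
have perm_divs : perm_eq (divs m) [seq m `\` d | d <- divs m].
  apply: uniq_perm => // [|d].
    rewrite map_inj_in_uniq // => d e; rewrite !mem_divs => dm em eq_de.
    by rewrite -(msetBK dm) eq_de msetBK.
  rewrite mem_divs; apply/idP/mapP => [dm|[e _ ->]]; last exact: msubsetB.
  by exists (m `\` d); rewrite ?mem_divs ?msubsetB ?msetBK.
rewrite (perm_big _ perm_divs) big_map big_seq [RHS]big_seq.
apply: eq_bigr => d.
by rewrite mem_divs => dm; rewrite msetBK // mulrC.
Qed.

Lemma ps_mulA : associative ps_mul.
Proof.
move=> f g h; apply/funext => m; rewrite !ps_mulE.
transitivity (\sum_(c <- divs m) \sum_(d <- divs m | c `<=` d)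
                f c * (g (d `\` c) * h (m `\` d))); last first.
  rewrite (exchange_big_dep xpredT) //= big_seq [RHS]big_seq.
  apply: eq_bigr => d; rewrite mem_divs => dm; rewrite ps_mulE big_distrl /=.
  under [RHS]eq_bigr do rewrite -mulrA.
  rewrite -big_filter; apply: perm_big; apply: uniq_perm; rewrite ?filter_uniq //.
  move=> c; rewrite mem_filter !mem_divs andb_idr // => cd.
  exact: msubset_trans cd dm.
rewrite big_seq [RHS]big_seq; apply: eq_bigr => c; rewrite mem_divs => cm.
rewrite ps_mulE big_distrr /= -[RHS]big_filter.
have perm_divs : perm_eq [seq d <- divs m | c `<=` d]
                         [seq c `+` b | b <- divs (m `\` c)].
  apply: uniq_perm; rewrite ?filter_uniq //.
    by rewrite map_inj_uniq //; apply: can_inj (msetDKB c).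
  move=> d; rewrite mem_filter mem_divs; apply/andP/mapP => [[cd dm]|[b]].
    exists (d `\` c); last by rewrite msetDBK.
    rewrite mem_divs; apply/msubsetP => x; rewrite !msetE2 leq_sub2r //.
    exact: (msubsetP dm).
  rewrite mem_divs => /msubsetP bm ->; split; apply/msubsetP => x.
    by rewrite msetE2 leq_addr.
  have := bm x; rewrite !msetE2 => le_b.
  by rewrite -(subnKC (msubsetP cm x)) leq_add2l.
rewrite (perm_big _ perm_divs) big_map; apply: eq_bigr => b _.
by rewrite msetDKB msetBDA.
Qed.

Lemma ps_mul1 : left_id ps_one ps_mul.
Proof.
move=> f; apply/funext => m; rewrite ps_mulE.
have m0 : mset0 \in divs m by rewrite mem_divs; apply/msubsetP => x; rewrite mset0E.
rewrite (bigD1_seq mset0) //= big1 => [|d /negPf d0].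
  rewrite /ps_one eqxx mul1r addr0; congr f.
  by apply/msetP => x; rewrite msetE2 mset0E subn0.
by rewrite /ps_one d0 mul0r.
Qed.

Lemma ps_mulDl : left_distributive ps_mul ps_add.
Proof.
move=> f g h; apply/funext => m; rewrite /ps_add !ps_mulE -big_split /=.
by apply: eq_bigr => d _; rewrite mulrDl.
Qed.

Lemma ps_one_neq0 : ps_one != ps_zero.
Proof.
apply/eqP => /(congr1 (fun f : pseries => f mset0)).
by rewrite /ps_one /ps_zero eqxx.
Qed.

End PowerSeries.

HB.instance Definition _ :=
  GRing.isZmodule.Build pseries ps_addA ps_addC ps_add0 ps_addN.
HB.instance Definition _ :=
  GRing.Zmodule_isComNzRing.Build pseries
    ps_mulA ps_mulC ps_mul1 ps_mulDl ps_one_neq0.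

(* e_k is the sum of the products of k distinct variables. *)
Definition elem_sym (k : nat) : pseries := fun m =>
  ((size (m : seq nat) == k) && uniq (m : seq nat))%:R.

Definition elem_sym_seq (s : seq nat) : pseries := \prod_(k <- s) elem_sym k.

(* Vertices are labelled 0, ..., nv - 1.  The edges are listed in increasing
   order, so an edge is identified with its position in the list and the order
   on edges is the order on positions.  Parallel edges are not excluded; simple
   graphs are those without them. *)
Record graph := Graph { nv : nat; edges : seq (nat * nat) }.

Definition wf_graph (G : graph) : bool :=
  (0 < nv G)%N &&
  all (fun e => [&& e.1 < nv G, e.2 < nv G & e.1 != e.2]%N) (edges G).

Notation vertex G := ('I_(nv G)).
Notation edge G := ('I_(size (edges G))).

Definition cycle_graph (a : nat) : graph :=
  Graph a ([seq (i, i.+1) | i <- iota 0 a.-1]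
           ++ (if (2 < a)%N then [:: (a.-1, 0%N)] else [::])).

Definition gsum (G1 G2 : graph) : graph :=
  Graph (nv G1 + nv G2).-1
    (edges G1 ++ [seq (e.1 + (nv G1).-1, e.2 + (nv G1).-1)%N | e <- edges G2]).

Section Graphs.

Variable G : graph.
Implicit Types (u v : vertex G) (e : edge G) (F C : {set edge G}).

Definition joins e u v : bool :=
  let p := tnth (in_tuple (edges G)) e in
  (p == (val u, val v)) || (p == (val v, val u)).

Definition proper_coloring (k : {ffun vertex G -> nat}) : Prop :=
  forall e u v, joins e u v -> k u <> k v.

(* The coefficient of a monomial m is the number of proper colorings k whose
   monomial \prod_v x_(k v) is m. *)
Definition chromatic_sym : pseries := fun m =>
  \sum_(k \in [set k : {ffun vertex G -> nat} |
                proper_coloring k /\ seq_mset (codom k) = m]%classic) (1 : int).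

Definition is_cycle C : bool :=
  [exists k : 'I_(nv G).+1, exists vs : k.-tuple (vertex G),
   exists es : k.-tuple (edge G),
   [&& (1 < k)%N, uniq vs, uniq es, C == [set e in es] &
    [forall i : 'I_k, joins (tnth es i) (tnth vs i) (tnth vs (ordS i))]]].

Definition broken_circuit F : bool :=
  [exists C : {set edge G}, is_cycle C &&
   [exists e in C, [forall f in C, (f <= e)%N] && (F == C :\ e)]].

Definition nbc F : bool :=
  ~~ [exists B : {set edge G}, broken_circuit B && (B \subset F)].

Definition adj F : rel (vertex G) := fun u v => [exists e in F, joins e u v].

(* A subgraph is given by its vertex set and its edge set. *)
Notation subgraph := ({set vertex G} * {set edge G})%type.

Definition component F u : subgraph :=
  let V := [set v | connect (adj F) u v] in
  (V, [set e in F | [exists x in V, exists y, joins e x y]]).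

Definition components F : {set subgraph} :=
  [set component F u | u : vertex G].

Definition is_tree : bool :=
  [&& wf_graph G, [forall u, forall v, connect (adj [set: edge G]) u v] &
      ~~ [exists C : {set edge G}, is_cycle C]].

(* A tree triple (T, alpha, r).  A composition of |T| <= nv G has at most nv G
   parts, each at most nv G, and r <= alpha_1 <= nv G, so the bounds below only
   serve to make the type finite. *)
Definition triple : finType :=
  (subgraph * {bseq nv G of 'I_(nv G).+1} * 'I_(nv G).+1)%type.

Definition ttree (t : triple) : subgraph := t.1.1.
Definition tvert (t : triple) : {set vertex G} := (ttree t).1.
Definition tedge (t : triple) : {set edge G} := (ttree t).2.
Definition tcomp (t : triple) : seq nat := [seq val i | i <- t.1.2].
Definition troot (t : triple) : nat := t.2.

Definition is_composition (alpha : seq nat) (n : nat) : bool :=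
  (0%N \notin alpha) && (sumn alpha == n).

Definition wf_triple (t : triple) : bool :=
  is_composition (tcomp t) #|tvert t| && (1 <= troot t <= head 0 (tcomp t))%N.

Implicit Type Fs : {set triple}.

Definition FT : {set {set triple}} :=
  [set Fs : {set triple} |
    [exists F : {set edge G},
     [&& nbc F, [set ttree t | t in Fs] == components F,
         dinjectiveb ttree (mem Fs) & [forall t in Fs, wf_triple t]]]].

Definition ft_type Fs : seq nat :=
  sort geq (flatten [seq tcomp t | t <- enum Fs]).

Definition ft_sign Fs : int := (-1) ^+ (\sum_(t in Fs) (size (tcomp t)).-1)%N.

Definition ft_unit Fs : bool := [forall t in Fs, size (tcomp t) == 1%N].

(* For Fs in FT, the unique triple whose tree contains the vertex labelled x;
   the vertex labelled 0 is the smallest one. *)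
Definition triple_at (x : nat) Fs : option triple :=
  [pick t in Fs | [exists v in tvert t, val v == x]].

Definition alpha_min1 Fs : nat :=
  if triple_at 0%N Fs is Some t then head 0%N (tcomp t) else 0%N.

Definition r_min Fs : nat :=
  if triple_at 0%N Fs is Some t then troot t else 0%N.

Definition ft_type' Fs : seq nat := rem (alpha_min1 Fs) (ft_type Fs).

Definition first_preserving_involution (S : {set {set triple}})
    (phi : {set triple} -> {set triple}) : Prop :=
  {in S, forall Fs,
    phi Fs \in S /\
    phi (phi Fs) = Fs /\
    ft_type (phi Fs) = ft_type Fs /\
    (phi Fs <> Fs -> ft_sign (phi Fs) <> ft_sign Fs) /\
    (phi Fs = Fs -> ft_unit Fs) /\
    alpha_min1 (phi Fs) = alpha_min1 Fs /\
    r_min (phi Fs) = r_min Fs}.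

Definition has_first_preserving_involution (S : {set {set triple}}) : Prop :=
  exists phi, first_preserving_involution S phi.

Definition chromatic_piece (i : nat) : pseries :=
  \sum_(Fs in FT | (alpha_min1 Fs == i) && (r_min Fs == 1%N))
    (ft_sign Fs)%:~R * elem_sym_seq (ft_type' Fs).

End Graphs.

Section BFunctions.

(* U is meant to be a tree; k is its number of vertices.  The edges of U are
   the edges of C_a + U coming after those of C_a, and the gluing vertex,
   labelled a in {1, ..., a + k - 1}, is here labelled a - 1. *)
Variables (a : nat) (U : graph).
Let G := gsum (cycle_graph a) U.

Definition FT' : {set {set triple G}} :=
  [set Fs in FT G |
    if triple_at a.-1 Fs is Some t then
      [forall e : edge G,
        (size (edges (cycle_graph a)) <= e)%N ==> (e \in tedge t)]
      && (nv U <= last 0 (tcomp t))%N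
    else false].

Definition Bfun : pseries :=
  \sum_(Fs in FT') (ft_sign Fs)%:~R * elem_sym_seq (ft_type Fs).

Definition Bpiece (i : nat) : pseries :=
  \sum_(Fs in FT' | (alpha_min1 Fs == i) && (r_min Fs == 1%N))
    (ft_sign Fs)%:~R * elem_sym_seq (ft_type' Fs).

End BFunctions.

(* Main.v *)
Require Import Defs.
From HB Require Import structures.
From mathcomp Require Import all_boot all_order all_algebra finmap multiset.
From mathcomp Require Import boolp classical_sets fsbigop.
From mathcomp Require Import zify ring.

(* A subgraph of C_a + G' contains no broken circuit if and only if its parts in
   C_a and in G' do not.  Let T be its tree through the gluing vertex, t the
   number of vertices of T in G', and alpha the composition of T.  Cut alpha
   inside the part where the sum of the parts from the end reaches t: the
   second half, whose first part k is cut off so that its sum is t, is a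
   composition for the tree of G', and the first half, of last part at least k,
   is a composition for the tree of C_a + U_k.  Signs multiply and types
   concatenate, so this bijection between FT(C_a + G') and the union over k of
   FT'(C_a + U_k) x FT^(k)(G') gives both expansions, given the forest triple
   expansion of X_G (Whitney's broken circuit theorem and Newton's identities).

   A first-preserving involution exists if and only if, for every type, alpha_1
   and r, the signed number of forest triples lies between 0 and the number of
   unit ones.  As the bijection matches unit forest triples with pairs of unit
   ones, it suffices that B^(i)_{a,k} and its difference with its unit part have
   nonnegative coefficients.  With h_j for e_j, as power series in a variable z
   that marks a, set K = sum_{j >= k} h_j z^(j-k+1)
   and V = 1 / (1 - sum_j (j - 1) h_j z^j); then B^(i)_{a,k} is the coefficient
   of z^a in (k - i) z^i K V if i < k, and in
   (i - k) z^(i-k+1) (1 + sum_{j < k} h_j z^j) V if i >= k. *)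

Set Implicit Arguments.
Unset Strict Implicit.
Unset Printing Implicit Defensive.

Import Order.TTheory GRing.Theory Num.Theory.

Local Open Scope ring_scope.

(** The cutting bijection is never built on forest triples. Give a triple the weight [A] at its
    first part and root if its tree contains the smallest vertex, [B] otherwise, and the weight [c]
    at every later part. The sum over forest triples of the product of these weights collapses to a
    sum over non-broken circuits in which a tree enters only through its size, as an index into one
    of two power series. Cutting a composition then becomes an identity between power series, and
    one gluing formula serves every use: [c = - h] produces the signs, [c = 0] keeps only the unit
    forest triples, a delta function [A] isolates a first part and a root, and [h] lists either the
    e_j or independent variables recording the parts. The j possible roots of a first part j turn
    h_j into j h_j, the coefficients of z h'(z); this is how logarithmic derivatives, and with them
    Newton's identities, enter. The same derivative appears when a cycle is closed, because a tree
    with n vertices can be cut by the closing edge in n - 1 ways. *)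

(** * Formal power series in one variable z *)

Definition fps (R : comNzRingType) := nat -> R.

HB.instance Definition _ (R : comNzRingType) := gen_eqMixin (fps R).
HB.instance Definition _ (R : comNzRingType) := gen_choiceMixin (fps R).

Section FormalPowerSeries.

Variable R : comNzRingType.
Implicit Types f g h : fps R.

Definition fps_zero : fps R := fun=> 0.
Definition fps_opp f : fps R := fun n => - f n.
Definition fps_add f g : fps R := fun n => f n + g n.
Definition fps_one : fps R := fun n => (n == 0%N)%:R.
Definition fps_mul f g : fps R := fun n => \sum_(i < n.+1) f i * g (n - i)%N.

Lemma fps_addA : associative fps_add.
Proof. by move=> f g h; apply/funext => n; exact: addrA. Qed.
Lemma fps_addC : commutative fps_add.
Proof. by move=> f g; apply/funext => n; exact: addrC. Qed.
Lemma fps_add0 : left_id fps_zero fps_add.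
Proof. by move=> f; apply/funext => n; exact: add0r. Qed.
Lemma fps_addN : left_inverse fps_zero fps_opp fps_add.
Proof. by move=> f; apply/funext => n; exact: addNr. Qed.

(** The coefficients of a product below degree [m] depend only on the truncations, so the ring laws
    are inherited from polynomials. *)
Let trunc m f := \poly_(i < m) f i.

Let fps_mul_trunc m f g n : (n < m)%N -> fps_mul f g n = (trunc m f * trunc m g)`_n.
Proof.
move=> nm; rewrite coefM; apply: eq_bigr => i _; rewrite !coef_poly.
by rewrite (leq_trans (ltn_ord i) nm) (leq_ltn_trans (leq_subr _ _) nm).
Qed.

Lemma fps_mulC : commutative fps_mul.
Proof.
by move=> f g; apply/funext => n; rewrite !(@fps_mul_trunc n.+1) // mulrC.
Qed.

Let trunc_mul m f g n : (n < m)%N ->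
  (trunc m (fps_mul f g))`_n = (trunc m f * trunc m g)`_n.
Proof. by move=> nm; rewrite coef_poly nm (fps_mul_trunc _ _ nm). Qed.

Lemma fps_mulA : associative fps_mul.
Proof.
move=> f g h; apply/funext => n; rewrite !(@fps_mul_trunc n.+1) //.
transitivity (trunc n.+1 f * (trunc n.+1 g * trunc n.+1 h))`_n.
  by rewrite !coefM; apply: eq_bigr => i _; rewrite trunc_mul // ltnS leq_subr.
by rewrite mulrA [LHS]coefM coefM; apply: eq_bigr => i _; rewrite trunc_mul.
Qed.

Lemma fps_mul1 : left_id fps_one fps_mul.
Proof.
move=> f; apply/funext => n; rewrite /fps_mul big_ord_recl /= mul1r subn0.
by rewrite big1 ?addr0 // => i _; rewrite mul0r.
Qed.

Lemma fps_mulDl : left_distributive fps_mul fps_add.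
Proof.
move=> f g h; apply/funext => n; rewrite /fps_add /fps_mul -big_split /=.
by apply: eq_bigr => i _; rewrite mulrDl.
Qed.

Lemma fps_one_neq0 : fps_one != fps_zero.
Proof.
apply/eqP => /(congr1 (fun f : fps R => f 0%N)) /eqP.
by rewrite /fps_one /fps_zero eqxx oner_eq0.
Qed.

End FormalPowerSeries.

HB.instance Definition _ (R : comNzRingType) :=
  GRing.isZmodule.Build (fps R) (@fps_addA R) (@fps_addC R) (@fps_add0 R) (@fps_addN R).
HB.instance Definition _ (R : comNzRingType) :=
  GRing.Zmodule_isComNzRing.Build (fps R)
    (@fps_mulA R) (@fps_mulC R) (@fps_mul1 R) (@fps_mulDl R) (@fps_one_neq0 R).

Section FormalPowerSeriesTheory.

Variable R : comNzRingType.
Implicit Types f g h : fps R.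

Lemma coef_fpsD f g n : (f + g) n = f n + g n. Proof. by []. Qed.
Lemma coef_fpsN f n : (- f) n = - f n. Proof. by []. Qed.
Lemma coef_fps0 n : (0 : fps R) n = 0. Proof. by []. Qed.
Lemma coef_fps1 n : (1 : fps R) n = (n == 0%N)%:R. Proof. by []. Qed.
Lemma coef_fpsMn f m n : (f *+ m) n = f n *+ m.
Proof. by elim: m => // m IH; rewrite !mulrSr coef_fpsD IH. Qed.

Lemma coef_fpsM f g n : (f * g) n = \sum_(0 <= i < n.+1) f i * g (n - i)%N.
Proof. by rewrite big_mkord. Qed.

Definition fpsE := (coef_fpsD, coef_fpsN, coef_fps0, coef_fps1, coef_fpsMn).

Lemma coef_fpsM0 f g : (f * g) 0%N = f 0%N * g 0%N.
Proof. by rewrite coef_fpsM big_nat1. Qed.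

Lemma coef_fpsM1 f g n : f 0%N = 0 ->
  (f * g) n = \sum_(1 <= i < n.+1) f i * g (n - i)%N.
Proof. by move=> f0; rewrite coef_fpsM big_nat_recl // f0 mul0r add0r big_add1. Qed.

Definition zpow m : fps R := fun n => (n == m)%:R.

Lemma coef_zpowM m f n : (zpow m * f) n = if (m <= n)%N then f (n - m)%N else 0.
Proof.
rewrite coef_fpsM; case: leqP => mn.
  rewrite (bigD1_seq m) ?iota_uniq ?mem_index_iota //= /zpow eqxx mul1r.
  by rewrite big1 ?addr0 // => i /negPf->; rewrite mul0r.
rewrite big_nat big1 // => i /andP[_ im].
by rewrite /zpow ltn_eqF ?mul0r // (leq_trans im).
Qed.

Lemma zpowD m n : zpow (m + n) = zpow m * zpow n.
Proof.
apply/funext => i; rewrite coef_zpowM /zpow.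
by case: leqP => mi; [congr (_%:R); lia | rewrite (_ : (i == _) = false) //; lia].
Qed.

(* The geometric series [1 / (1 - f)] for [f] without constant term; the fuel
   is the degree. *)
Fixpoint geom_rec f k n : R :=
  if k is k'.+1 then
    if n is n'.+1 then \sum_(1 <= i < n.+1) f i * geom_rec f k' (n - i)%N else 1
  else 0.
Definition geom f : fps R := fun n => geom_rec f n.+1 n.

Lemma geom_recS f k n : geom_rec f k.+1 n.+1 =
  \sum_(1 <= i < n.+2) f i * geom_rec f k (n.+1 - i)%N.
Proof. by []. Qed.

Lemma geom_recE f k n : (n < k)%N -> geom_rec f k n = geom f n.
Proof.
rewrite /geom; elim/ltn_ind: n k => -[|n] IH [|k] // nk; rewrite !geom_recS.
rewrite big_nat [RHS]big_nat; apply: eq_bigr => i i1; congr (_ * _).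
by transitivity (geom_rec f (n.+1 - i).+1 (n.+1 - i)); [|symmetry]; apply: IH; lia.
Qed.

Lemma geomS f n : (0 < n)%N -> geom f n = \sum_(1 <= i < n.+1) f i * geom f (n - i)%N.
Proof.
case: n => // n _; rewrite /geom geom_recS big_nat [RHS]big_nat; apply: eq_bigr => i i1.
by rewrite geom_recE //; lia.
Qed.

Lemma geomE f : f 0%N = 0 -> (1 - f) * geom f = 1.
Proof.
move=> f0; rewrite mulrBl mul1r; apply/funext => -[|n].
  by rewrite !fpsE coef_fpsM0 f0 mul0r subr0.
by rewrite !fpsE coef_fpsM1 // -geomS // subrr.
Qed.

(** The derivation z d/dz, which unlike d/dz preserves degrees. *)
Definition zderiv f : fps R := fun n => f n *+ n.

Lemma zderivD f g : zderiv (f + g) = zderiv f + zderiv g.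
Proof. by apply/funext => n; rewrite /zderiv !fpsE mulrnDl. Qed.

Lemma zderivN f : zderiv (- f) = - zderiv f.
Proof. by apply/funext => n; rewrite /zderiv !fpsE mulNrn. Qed.

Lemma zderiv1 : zderiv 1 = 0.
Proof. by apply/funext => -[|n]; rewrite /zderiv !fpsE ?mulr0n ?mul0rn. Qed.

Lemma zderivM f g : zderiv (f * g) = zderiv f * g + f * zderiv g.
Proof.
apply/funext => n; rewrite /zderiv !fpsE !coef_fpsM -sumrMnl -big_split /=.
rewrite big_nat [RHS]big_nat; apply: eq_bigr => i /= i1.
by rewrite mulrnAl mulrnAr -mulrnDr subnKC.
Qed.

End FormalPowerSeriesTheory.

(** * Compositions *)

(** The fuel [k] has to exceed [n]; it lasts because every part removed is positive. *)
Fixpoint comps_rec (k n : nat) : seq (seq nat) :=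
  if k is k'.+1 then
    if n is 0%N then [:: [::]]
    else [seq j :: s | j <- iota 1 n, s <- comps_rec k' (n - j)]
  else [::].

Lemma comps_recS k n :
  comps_rec k.+1 n.+1 = [seq j :: s | j <- iota 1 n.+1, s <- comps_rec k (n.+1 - j)].
Proof. by []. Qed.

Definition comps n := comps_rec n.+1 n.

Lemma mem_comps_rec k n s : (n < k)%N -> (s \in comps_rec k n) = is_composition s n.
Proof.
elim: k n s => // k IH [|n] s nk.
  by rewrite inE; case: s => [|[|j] s]; rewrite /is_composition ?inE //= andbF.
rewrite comps_recS; apply/allpairsPdep/idP => [[j [t [jn tc ->]]]|].
  move: jn tc; rewrite mem_iota => /andP[j0 jn]; rewrite IH; last lia.
  rewrite /is_composition => /andP[t0 /eqP tn].
  by rewrite inE negb_or t0 /= tn; apply/andP; split; [|apply/eqP]; lia.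
case: s => [|j s]; first by rewrite /is_composition.
rewrite /is_composition inE negb_or [sumn _]/= => /andP[/andP[j0 s0] /eqP jsn].
exists j, s; split=> //; first by rewrite mem_iota; lia.
by rewrite IH; [rewrite /is_composition s0; apply/eqP|]; lia.
Qed.

Lemma mem_comps n s : (s \in comps n) = is_composition s n.
Proof. exact: mem_comps_rec. Qed.

Lemma uniq_comps n : uniq (comps n).
Proof.
rewrite /comps; move: n.+1 => k; elim: k n => // k IH [|n] //.
rewrite comps_recS; apply: allpairs_uniq_dep => //; first exact: iota_uniq.
by move=> [j s] [j' s'] _ _ /= [-> ->].
Qed.

Section CompositionSums.

Variable R : nmodType.
Implicit Types F : seq nat -> R.

Lemma big_comps_head F n :
  \sum_(s <- comps n.+1) F s =
  \sum_(1 <= j < n.+2) \sum_(s <- comps (n.+1 - j)) F (j :: s).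
Proof.
rewrite -(big_allpairs_dep (h := cons) (r2 := fun j => comps (n.+1 - j))).
apply: perm_big; apply: uniq_perm; first exact: uniq_comps.
  apply: allpairs_uniq_dep => [|j _|]; [exact: iota_uniq|exact: uniq_comps|].
  by move=> [j s] [j' s'] _ _ /= [-> ->].
move=> s; rewrite mem_comps; apply/idP/allpairsPdep => [|[j [t [jn tc ->]]]].
  case: s => [|j s]; first by rewrite /is_composition.
  rewrite /is_composition inE negb_or [sumn _]/= => /andP[/andP[j0 s0] /eqP jsn].
  exists j, s; rewrite mem_index_iota mem_comps; split=> //; first lia.
  by rewrite /is_composition s0; apply/eqP; lia.
move: jn tc; rewrite mem_index_iota mem_comps => /andP[j0 jn].
rewrite /is_composition => /andP[t0 /eqP tn].
by rewrite inE negb_or t0 /= tn; apply/andP; split; [|apply/eqP]; lia.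
Qed.

Lemma big_comps_rev F n : \sum_(s <- comps n) F (rev s) = \sum_(s <- comps n) F s.
Proof.
rewrite -(big_map rev xpredT F); apply: perm_big; apply: uniq_perm.
- by rewrite map_inj_uniq ?uniq_comps //; exact: inv_inj revK.
- exact: uniq_comps.
move=> s; rewrite -{1}[s]revK mem_map; last exact: inv_inj revK.
by rewrite !mem_comps /is_composition mem_rev sumn_rev.
Qed.

Lemma big_comps_last F n :
  \sum_(s <- comps n.+1) F s =
  \sum_(1 <= j < n.+2) \sum_(s <- comps (n.+1 - j)) F (rcons s j).
Proof.
rewrite -big_comps_rev big_comps_head; apply: eq_bigr => j _.
by rewrite -[RHS]big_comps_rev; apply: eq_bigr => s _; rewrite rev_cons.
Qed.

Lemma big_comps0 F : \sum_(s <- comps 0) F s = F [::].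
Proof. by rewrite big_seq1. Qed.

(** A composition of [n] has at most [n] parts, none larger than [n], so the bounds that make the
    type of triples finite lose nothing. *)
Lemma big_bseq_comps N n F : (n <= N)%N ->
  \sum_(s : {bseq N of 'I_N.+1} | is_composition [seq val i | i <- s] n)
    F [seq val i | i <- s] = \sum_(s <- comps n) F s.
Proof.
move=> nN; pose f (s : {bseq N of 'I_N.+1}) := [seq val i | i <- s].
have f_inj : injective f by move=> s t /(inj_map val_inj) /val_inj.
rewrite big_mkcond /= -(big_map f xpredT
  (fun s => if is_composition s n then F s else 0)) -big_mkcond -big_filter.
apply: perm_big; apply: uniq_perm; last move=> s; rewrite ?uniq_comps //.
  by rewrite filter_uniq // map_inj_uniq ?index_enum_uniq.
rewrite mem_filter mem_comps; apply: andb_idr => /andP[s0 /eqP sn].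
have le_sumn (t : seq nat) : 0%N \notin t -> (size t <= sumn t)%N.
  elim: t => //= j t IH; rewrite inE negb_or => /andP[j0 /IH]; lia.
have mem_le (t : seq nat) j : j \in t -> (j <= sumn t)%N.
  by elim: t => //= i t IH; rewrite inE => /orP[/eqP->|/IH]; lia.
have ssz : (size [seq inord i : 'I_N.+1 | i <- s] <= N)%N.
  by rewrite size_map (leq_trans (le_sumn _ s0)) // sn.
apply/mapP; exists (Bseq ssz); first exact: mem_index_enum.
rewrite /f /= -map_comp -[LHS]map_id; apply/eq_in_map => j /mem_le.
by rewrite sn /= => jn; rewrite inordK // ltnS (leq_trans jn).
Qed.

End CompositionSums.

Section CompositionSeries.

Variable R : comNzRingType.
Implicit Types a c : fps R.

Lemma comps_geom c n : \sum_(s <- comps n) \prod_(j <- s) c j = geom c n.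
Proof.
elim/ltn_ind: n => -[|n] IH; first by rewrite big_comps0 big_nil.
rewrite big_comps_head geomS // big_nat [RHS]big_nat.
apply: eq_bigr => j j1; rewrite -IH; last lia.
by rewrite big_distrr; apply: eq_bigr => s _; rewrite big_cons.
Qed.

(* Sums over compositions whose first part [j] is weighted by [a j] and whose
   other parts [j] are weighted by [c j]. *)
Definition pser a c : fps R := a * geom c.

Lemma pser0 a c : a 0%N = 0 -> pser a c 0%N = 0.
Proof. by move=> a0; rewrite /pser coef_fpsM0 a0 mul0r. Qed.

Lemma comps_pser a c n : a 0%N = 0 -> (0 < n)%N ->
  \sum_(s <- comps n) a (head 0%N s) * \prod_(j <- behead s) c j = pser a c n.
Proof.
case: n => // n a0 _; rewrite big_comps_head /pser coef_fpsM1 //.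
apply: eq_bigr => j _; rewrite -comps_geom big_distrr.
by apply: eq_bigr => s _.
Qed.

(** Cutting off the last part: the series P satisfies P = a + P c. *)
Lemma pserE a c n : a 0%N = 0 -> c 0%N = 0 -> (0 < n)%N ->
  pser a c n = a n + \sum_(1 <= i < n) pser a c i * c (n - i)%N.
Proof.
move=> a0 c0 n0; have pE : pser a c = a + pser a c * c.
  by rewrite /pser -[X in X + _]mulr1 -(geomE c0); ring.
rewrite {1}pE coef_fpsD coef_fpsM1 ?pser0 //.
by rewrite big_nat_recr //= subnn c0 mulr0 addr0.
Qed.

(** For positive [k], the tail of [a] from degree [k] on, divided by z^(k-1). The exponent is k - 1
    because trees with n and k vertices glued at a vertex have n + k - 1 vertices together. *)
Definition shift k a : fps R := fun n => if n is n'.+1 then a (n' + k)%N else 0.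

(* The same sums restricted to compositions of [n + k - 1] whose last part is
   at least [k]. *)
Definition qser a c k : fps R := shift k a + pser a c * shift k c.

Lemma qser0 a c k : qser a c k 0%N = 0.
Proof. by rewrite /qser coef_fpsD coef_fpsM0 mulr0 addr0. Qed.

Lemma qserE a c k n : a 0%N = 0 ->
  qser a c k n.+1 = a (n + k)%N + \sum_(1 <= i < n.+1) pser a c i * c (n - i + k)%N.
Proof.
move=> a0; rewrite /qser coef_fpsD coef_fpsM1 ?pser0 //; congr (_ + _).
rewrite big_nat_recr //= subnn mulr0 addr0 big_nat [RHS]big_nat.
by apply: eq_bigr => i i1; rewrite subSn //; lia.
Qed.

Lemma comps_qser a c k n : a 0%N = 0 -> (0 < k)%N ->
  \sum_(s <- comps (n + k) | (k <= last 0%N s)%N)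
     a (head 0%N s) * \prod_(j <- behead s) c j = qser a c k n.+1.
Proof.
case: k => // k a0 _; rewrite addnS qserE // addnS.
(* The largest value of the last part gives the one-part composition, whose only part is also the
   first and carries the weight [a]. *)
rewrite big_mkcond big_comps_last big_nat_recr //= subnn big_comps0 /= big_nil mulr1.
rewrite ifT; last lia.
rewrite addrC.
congr (_ + _); rewrite (@big_cat_nat _ _ _ k.+1) //=; last by lia.
rewrite big1_seq ?add0r => [|j]; last first.
  rewrite mem_index_iota => /andP[_ /andP[j0 jk]]; apply: big1_seq => s _.
  by rewrite last_rcons leqNgt jk.
rewrite -[X in \sum_(X <= _ < _) _]add0n big_addn big_nat_rev /=.
rewrite (_ : ((n + k).+1 - k.+1)%N = n); last lia.
rewrite big_add1 big_nat [RHS]big_nat /=; apply: eq_bigr => i i1.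
rewrite (_ : 0 + n - i.+1 + _ = (n - i.+1 + k.+1))%N; last lia.
rewrite (_ : (n + k).+1 - _ = i.+1)%N; last lia.
rewrite -comps_pser // big_distrl big_seq [RHS]big_seq /=; apply: eq_bigr => s.
rewrite mem_comps => /andP[s0 /eqP sn].
rewrite last_rcons leq_addl /=.
by case: s s0 sn => // j s _ _; rewrite -cats1 /= big_cat big_seq1 mulrA.
Qed.

(* A composition of [n + m] is cut inside the part where the sum of the parts
   after it reaches [m]. *)
Lemma pser_split a c n m : a 0%N = 0 -> c 0%N = 0 -> (0 < m)%N ->
  pser a c (n + m)%N =
  \sum_(1 <= k < m.+1) qser a c k n.+1 * geom c (m - k)%N.
Proof.
move=> a0 c0 m0.
(* With [n] fixed and [m] as the degree, the claim reads [T = Q * geom c]. It is proved as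
   [Q = T * (1 - c)], which only needs one last part to be cut off: multiplying by [1 - c] cancels
   the terms of [pserE] with index above [n]. *)
pose T : fps R := fun k => if k is k'.+1 then pser a c (n + k)%N else 0.
pose Q : fps R := fun k => if k is k'.+1 then qser a c k n.+1 else 0.
have QT : Q = T * (1 - c).
  apply/funext => -[|k]; first by rewrite coef_fpsM0 mul0r.
  rewrite mulrBr mulr1 coef_fpsD coef_fpsN coef_fpsM1 //.
  rewrite [X in _ = X - _]/T pserE //; last by rewrite addnS.
  rewrite big_nat_recr //= subnn c0 mulr0 addr0 qserE // -addrA; congr (_ + _).
  rewrite [in RHS](@big_cat_nat _ _ _ n.+1) /=; [|lia|lia].
  rewrite -addrA -[LHS]addr0; congr (_ + _).
    rewrite big_nat [RHS]big_nat.
    by apply: eq_bigr => i i1; congr (_ * c _); lia.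
  rewrite -(add1n n) big_addn addKn; apply/esym/eqP; rewrite subr_eq0; apply/eqP.
  rewrite big_nat [RHS]big_nat; apply: eq_bigr => -[|i] // i1.
  by rewrite /T addnC; congr (_ * c _); lia.
transitivity (T m); first by rewrite /T; case: m m0.
rewrite -[T]mulr1 -(geomE c0) mulrA -QT coef_fpsM1 //.
by rewrite big_nat [RHS]big_nat; apply: eq_bigr => -[].
Qed.

End CompositionSeries.

Lemma big_nat_addl (T : Type) (idx : T) (op : T -> T -> T) d n (P : pred nat) F :
  \big[op/idx]_(d <= i < d + n | P i) F i
  = \big[op/idx]_(0 <= i < n | P (i + d)%N) F (i + d)%N.
Proof. by rewrite -{1}(add0n d) big_addn addKn. Qed.

(** * Connectivity of edge lists *)

(* [lab M] is a union-find labelling of the vertices by the connected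
   components of the edge list [M]. *)
Definition lab : seq (nat * nat) -> nat -> nat :=
  foldl (fun f e x => if f x == f e.1 then f e.2 else f x) id.

Definition conn M x y : bool := lab M x == lab M y.

Definition eshift d (M : seq (nat * nat)) := [seq (e.1 + d, e.2 + d)%N | e <- M].

Definition csize n M x : nat := \sum_(0 <= y < n) conn M x y.

(* Components are represented by their smallest vertex. *)
Definition isroot M x : bool := ~~ has (conn M x) (iota 0 x).

Section Connectivity.

Implicit Types (M : seq (nat * nat)) (x y z u v n d : nat).

Lemma conn_refl M x : conn M x x. Proof. exact: eqxx. Qed.
Lemma conn_sym M x y : conn M x y = conn M y x. Proof. exact: eq_sym. Qed.
Lemma conn_trans M y x z : conn M x y -> conn M y z -> conn M x z.
Proof. by move=> /eqP xy /eqP yz; rewrite /conn xy yz. Qed.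
Lemma conn_eql M x y : conn M x y -> conn M x =1 conn M y.
Proof. by rewrite /conn => /eqP xy z; rewrite xy. Qed.
Lemma conn_eqr M x y z : conn M x y -> conn M z x = conn M z y.
Proof. by rewrite /conn => /eqP ->. Qed.

Lemma conn_nil x y : conn [::] x y = (x == y). Proof. by []. Qed.

Lemma conn_rcons M e x y : conn (rcons M e) x y =
  [|| conn M x y, conn M x e.1 && conn M e.2 y | conn M x e.2 && conn M e.1 y].
Proof.
rewrite /conn /lab foldl_rcons -/(lab M).
move: (lab M x) (lab M y) (lab M e.1) (lab M e.2) => a b u v; rewrite [u == b]eq_sym.
case: (eqVneq a u) => [->|au]; case: (eqVneq b u) => [->|bu] /=;
  rewrite ?eqxx ?andbT ?andbF ?orbF //.
by rewrite (negPf au).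
Qed.

Lemma conn_fun (T : Type) (f : nat -> T) M :
  {in M, forall e, f e.1 = f e.2} -> forall x y, conn M x y -> f x = f y.
Proof.
elim/last_ind: M => [_ x y|M e IH fM x y]; first by rewrite conn_nil => /eqP->.
have fe : f e.1 = f e.2 by apply: fM; rewrite mem_rcons mem_head.
have {IH} fM' x' y' : conn M x' y' -> f x' = f y'.
  by apply: IH => e' e'M; apply: fM; rewrite mem_rcons inE e'M orbT.
rewrite conn_rcons => /or3P[/fM'//|/andP[/fM'-> /fM'<-]//|/andP[/fM'-> /fM'<-]//].
Qed.

Lemma conn_mem M e : e \in M -> conn M e.1 e.2.
Proof.
elim/last_ind: M => // M e' IH; rewrite mem_rcons inE conn_rcons.
by case/predU1P=> [->|/IH->] //; rewrite !conn_refl orbT.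
Qed.

Lemma conn_le M M' : {in M, forall e, conn M' e.1 e.2} ->
  forall x y, conn M x y -> conn M' x y.
Proof.
by move=> MM' x y xy; apply/eqP; apply: conn_fun xy => e /MM'/eqP.
Qed.

Lemma isrootP M x : reflect (forall u, (u < x)%N -> ~~ conn M x u) (isroot M x).
Proof.
apply: (iffP hasPn) => [xM u ux|xM u]; last by rewrite mem_iota; exact: xM.
by apply: xM; rewrite mem_iota.
Qed.

Lemma isroot0 M : isroot M 0. Proof. by []. Qed.

Lemma root_exists M x : exists r, [/\ (r <= x)%N, isroot M r & conn M x r].
Proof.
have ex : exists r, conn M x r by exists x; exact: conn_refl.
exists (ex_minn ex); case: ex_minnP => r xr r_min; split=> //.
  by apply: r_min; exact: conn_refl.
apply/isrootP => u ur; apply/negP => ru.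
by have := r_min u (conn_trans xr ru); rewrite leqNgt ur.
Qed.

Lemma root_uniq M x y : isroot M x -> isroot M y -> conn M x y -> x = y.
Proof.
move=> /isrootP xM /isrootP yM xy; case: (ltngtP x y) => // [/yM|/xM].
  by rewrite conn_sym xy.
by rewrite xy.
Qed.

Lemma csize_conn n M x y : conn M x y -> csize n M x = csize n M y.
Proof. by move=> xy; apply: eq_bigr => z _; rewrite (conn_eql xy). Qed.

Lemma csize_gt0 n M x : (x < n)%N -> (0 < csize n M x)%N.
Proof.
move=> xn; rewrite /csize (bigD1_seq x) ?iota_uniq ?mem_index_iota //=.
by rewrite conn_refl.
Qed.

Lemma csize_le n M x : (csize n M x <= n)%N.
Proof.
rewrite -[leqRHS]subn0 -[leqRHS]muln1 -sum_nat_const_nat.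
by apply: leq_sum => y _; case: conn.
Qed.

End Connectivity.

Section GluedConnectivity.

Variables (d : nat) (M1 M2 : seq (nat * nat)).
Hypothesis M1_le : {in M1, forall e, (e.1 <= d)%N && (e.2 <= d)%N}.
Let M := M1 ++ eshift d M2.

(** The maps x -> min(x, d) and x -> x - d (truncated) retract the glued graph onto its two halves,
    each collapsing the other half to the gluing vertex, so the pair of labels of the two images is
    constant along edges. *)
Lemma conn_gsum x y :
  conn M x y = conn M1 (minn x d) (minn y d) && conn M2 (x - d) (y - d).
Proof.
have c1 x' y' : conn M1 x' y' -> conn M x' y'.
  by apply: conn_le => e eM; apply: conn_mem; rewrite mem_cat eM.
have c2 x' y' : conn M2 x' y' -> conn M (x' + d) (y' + d).
  move=> xy; apply/eqP; apply: (conn_fun (f := fun z => lab M (z + d)) _ xy) => e eM.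
  apply/eqP.
  apply: (@conn_mem M (e.1 + d, e.2 + d)%N).
  by rewrite mem_cat (map_f (fun e => (e.1 + d, e.2 + d)%N)) ?orbT.
apply/idP/andP => [xy|[]].
  have [] : (lab M1 (minn x d), lab M2 (x - d)) = (lab M1 (minn y d), lab M2 (y - d)).
    apply: (conn_fun (f := fun z => (lab M1 (minn z d), lab M2 (z - d))) _ xy) => e.
    rewrite mem_cat => /orP[eM|/mapP[e' eM ->]] /=.
      have /andP[e1 e2] := M1_le eM; move/eqP: (conn_mem eM) => eq_e.
      by rewrite !(minn_idPl _) // (eqP e1) (eqP e2) eq_e.
    by rewrite !addnK !(minn_idPr _) ?leq_addl // (eqP (conn_mem eM)).
  by rewrite /conn => -> ->.
wlog le_xy : x y / (x <= y)%N => [hw|].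
  case: (leqP x y) => [/hw//|/ltnW/hw h c c'].
  by rewrite conn_sym; apply: h; rewrite conn_sym.
case: (leqP y d) => yd.
  by rewrite (minn_idPl (leq_trans le_xy yd)) => /c1.
case: (leqP x d) => xd.
  rewrite (eqP xd) => /c1 xdM /c2.
  by rewrite add0n subnK 1?ltnW //; exact: conn_trans.
by move=> _ /c2; rewrite !subnK // ltnW.
Qed.

(** The gluing vertex [d] is counted in both sizes, hence the predecessor. *)
Lemma csize_gsum1 n x : (x <= d)%N ->
  csize (d + n.+1) M x =
  if conn M1 x d then (csize d.+1 M1 x + csize n.+1 M2 0).-1 else csize d.+1 M1 x.
Proof.
move=> xd; rewrite {1}/csize (@big_cat_nat _ _ _ d) ?leq_addr //=.
rewrite (eq_big_nat _ _ (F2 := fun y => conn M1 x y : nat)) => [|y /= yd]; last first.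
  rewrite conn_gsum (eqP xd) !(minn_idPl _) // ?(ltnW yd) //.
  by rewrite (eqP (ltnW yd)) conn_refl andbT.
rewrite big_nat_addl.
rewrite [X in (_ + X)%N](eq_bigr (fun y => (conn M1 x d && conn M2 0 y) : nat))
  => [|y _]; last first.
  by rewrite conn_gsum (minn_idPl xd) (minn_idPr _) ?leq_addl // addnK (eqP xd).
have s1 : csize d.+1 M1 x = (\sum_(0 <= y < d) conn M1 x y + conn M1 x d)%N.
  by rewrite /csize big_nat_recr.
case: (conn M1 x d) s1 => s1 /=; last by rewrite big1_eq addn0 s1 addn0.
by rewrite s1 /csize addn1 addSn.
Qed.

Lemma csize_gsum2 n z : ~~ conn M2 0 z -> csize (d + n) M (d + z) = csize n M2 z.
Proof.
move=> z0; rewrite {1}/csize (@big_cat_nat _ _ _ d) ?leq_addr //=.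
rewrite big_nat big1 => [|y /= yd]; last first.
  by rewrite conn_gsum addKn (eqP (ltnW yd)) [conn M2 z 0]conn_sym (negPf z0) andbF.
rewrite add0n big_nat_addl.
apply: eq_bigr => y _.
by rewrite conn_gsum addKn addnK !(minn_idPr _) ?leq_addl ?leq_addr // conn_refl.
Qed.

Lemma isroot_gsum1 x : (x <= d)%N -> isroot M x = isroot M1 x.
Proof.
move=> xd; congr (~~ _); apply: eq_in_has => u; rewrite mem_iota => /andP[_ ux].
have ud : (u <= d)%N by rewrite (leq_trans _ xd) // ltnW.
by rewrite conn_gsum (eqP xd) (eqP ud) !(minn_idPl _) // conn_refl andbT.
Qed.

Lemma isroot_gsum2 z : (0 < z)%N -> isroot M (d + z) = isroot M2 z.
Proof.
move=> z0; apply/isrootP/isrootP => rz u uz.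
  have := rz (d + u)%N; rewrite ltn_add2l conn_gsum !addKn => /(_ uz).
  by rewrite !(minn_idPr _) ?leq_addr // conn_refl.
rewrite conn_gsum addKn negb_and; apply/orP; right.
by apply: rz; lia.
Qed.

End GluedConnectivity.

(** * Sums over non-broken circuits *)

Section RootProducts.

Variables (R : comNzRingType) (P : nat -> R).
Implicit Types (F : nat -> R) (M : seq (nat * nat)).

(* The component of [0], and in [mid] also that of [d], is left out. *)
Definition rest n M : R := \prod_(1 <= x < n | isroot M x) P (csize n M x).

Definition mid n d M : R :=
  \prod_(1 <= x < n | isroot M x && ~~ conn M x d) P (csize n M x).

Lemma root_prod_conn0 F n d M : conn M 0 d ->
  \prod_(1 <= x < n | isroot M x) F x =
  \prod_(1 <= x < n | isroot M x && ~~ conn M x d) F x.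
Proof.
move=> d0; rewrite big_nat_cond [RHS]big_nat_cond; apply: eq_bigl => x.
case: (boolP (1 <= x < n)%N) => //= /andP[x1 _]; case: isrootP => //= xM.
by rewrite -(conn_eqr _ d0) xM.
Qed.

Lemma root_prod_split F n d M : ~~ conn M 0 d -> (d < n)%N ->
  (forall x y, conn M x y -> F x = F y) ->
  \prod_(1 <= x < n | isroot M x) F x =
  F d * \prod_(1 <= x < n | isroot M x && ~~ conn M x d) F x.
Proof.
move=> d0 dn FM; rewrite (bigID (fun x => conn M x d)) /=; congr (_ * _).
have [r [rd rM dr]] := root_exists M d.
rewrite -big_filter (_ : filter _ _ = [:: r]) ?big_seq1 ?(FM _ _ dr) //.
apply: perm_small_eq => //; apply: uniq_perm; rewrite ?filter_uniq ?iota_uniq //.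
move=> x; rewrite mem_filter mem_index_iota inE.
apply/andP/eqP => [[/andP[xM xd] _]|->].
  by apply: root_uniq xM rM _; exact: conn_trans xd dr.
rewrite rM conn_sym dr; split=> //; rewrite (leq_ltn_trans rd dn) andbT lt0n.
by apply: contraNneq d0 => <-; rewrite conn_sym.
Qed.

(** A nonzero root of [M2] is not connected to 0, so its component stays away from the gluing vertex
    and keeps its size. The component of [d] contributes a factor of its own only when it is not the
    component of 0. *)
Lemma rest_gsum d n M1 M2 :
  {in M1, forall e, (e.1 <= d)%N && (e.2 <= d)%N} ->
  rest (d + n.+1) (M1 ++ eshift d M2) =
  (if conn M1 0 d then 1 else P (csize d.+1 M1 d + csize n.+1 M2 0).-1)
  * mid d.+1 d M1 * rest n.+1 M2.
Proof.
move=> M1d; rewrite {1}/rest (@big_cat_nat _ _ _ d.+1) //= ?addnS ?ltnS ?leq_addr //.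
rewrite -addnS; congr (_ * _).
  pose F x := P (if conn M1 x d then (csize d.+1 M1 x + csize n.+1 M2 0).-1
                 else csize d.+1 M1 x).
  transitivity (\prod_(1 <= x < d.+1 | isroot M1 x) F x).
    rewrite big_nat_cond [RHS]big_nat_cond; apply: eq_big => x.
      by case: (boolP (1 <= x < d.+1)%N) => //= /andP[_ xd]; rewrite isroot_gsum1.
    by case/andP=> /andP[_ xd] _; rewrite csize_gsum1.
  have midF : mid d.+1 d M1 = \prod_(1 <= x < d.+1 | isroot M1 x && ~~ conn M1 x d) F x.
    by apply: eq_bigr => x /andP[_ /negPf xd]; rewrite /F xd.
  case: ifPn => d0; first by rewrite mul1r midF; exact: root_prod_conn0.
  rewrite midF (@root_prod_split F _ d) //; first by rewrite /F conn_refl.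
  by move=> x y xy; rewrite /F (conn_eql xy) (csize_conn _ xy).
rewrite -(add1n d) big_addn addKn /rest big_nat_cond [RHS]big_nat_cond.
apply: eq_big => z.
  by case: (boolP (1 <= z < n.+1)%N) => //= /andP[z1 _]; rewrite addnC isroot_gsum2.
case/andP=> /andP[z1 _]; rewrite addnC isroot_gsum2 // => /isrootP zM.
by rewrite csize_gsum2 // conn_sym zM.
Qed.

End RootProducts.

Section BrokenCircuits.

Implicit Types (L : seq (nat * nat)) (b : bitseq).

(* The edges of [L] selected by [b] contain a broken circuit if and only if some
   edge of [L] joins two vertices that are connected by smaller selected edges. *)
Definition nbcb L b : bool :=
  all (fun i => ~~ conn (mask (take i b) (take i L)) (nth (0, 0) L i).1 (nth (0, 0) L i).2)%N
      (iota 0 (size L)).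

Fixpoint allbits n : seq bitseq :=
  if n is m.+1 then [seq rcons b c | b <- allbits m, c <- [:: false; true]]
  else [:: [::]].

Lemma mem_allbits n b : (b \in allbits n) = (size b == n).
Proof.
elim: n b => [|n IH] b; first by rewrite inE size_eq0.
apply/allpairsP/eqP => [[[b' c] [/= b'n _ ->]]|].
  by move: b'n; rewrite IH size_rcons => /eqP->.
case/lastP: b => // b c; rewrite size_rcons => -[bn]; exists (b, c).
by split=> //=; [rewrite IH bn | case: c].
Qed.

Lemma uniq_allbits n : uniq (allbits n).
Proof.
elim: n => // n IH; apply: allpairs_uniq => // -[b c] [b' c'] _ _ /=.
by move=> /rcons_inj[-> ->].
Qed.

(** The condition on the largest edge does not mention [c]: whether or not [e] is selected, its ends
    must not be joined by smaller selected edges. Non-broken circuits therefore come in pairs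
    differing in [e]. *)
Lemma nbcb_rcons L b e c : size b = size L ->
  nbcb (rcons L e) (rcons b c) = nbcb L b && ~~ conn (mask b L) e.1 e.2.
Proof.
move=> bL; rewrite /nbcb size_rcons -addn1 iotaD all_cat /= andbT add0n.
rewrite nth_rcons ltnn eqxx -!cats1 !take_size_cat ?bL //; congr (_ && _).
apply: eq_in_all => i; rewrite mem_iota => /andP[_ iL].
by rewrite !takel_cat ?bL ?(ltnW iL) // nth_cat iL.
Qed.

(** Edges of one block never create connections inside the other ([conn_gsum]), so the test for each
    edge only sees its own block. *)
Lemma nbcb_gsum d L1 L2 b1 b2 :
  {in L1, forall e, (e.1 <= d)%N && (e.2 <= d)%N} -> size b1 = size L1 ->
  nbcb (L1 ++ eshift d L2) (b1 ++ b2) = nbcb L1 b1 && nbcb L2 b2.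
Proof.
move=> L1d b1L; rewrite /nbcb size_cat size_map iotaD all_cat add0n; congr (_ && _).
  apply: eq_in_all => i; rewrite mem_iota => /andP[_ iL].
  by rewrite !takel_cat ?b1L ?(ltnW iL) // nth_cat iL.
rewrite -[X in iota X]addn0 iotaDl all_map; apply: eq_in_all => i.
rewrite mem_iota => /andP[_ iL] /=.
rewrite !take_cat b1L ltnNge leq_addr /= addKn mask_cat //.
rewrite /eshift -map_take -map_mask nth_cat ltnNge leq_addr /= addKn.
rewrite (nth_map (0, 0)%N) //= conn_gsum; last first.
  by move=> e /mem_mask; exact: L1d.
by rewrite !addnK !(minn_idPr _) ?leq_addl // conn_refl.
Qed.

Variable R : nmodType.
Implicit Types F : bitseq -> R.

Lemma big_allbitsS F n :
  \sum_(b <- allbits n.+1) F b =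
  \sum_(b <- allbits n) (F (rcons b false) + F (rcons b true)).
Proof.
by rewrite big_allpairs_dep; apply: eq_bigr => b _; rewrite big_cons big_seq1.
Qed.

Lemma big_allbitsD F n m :
  \sum_(b <- allbits (n + m)) F b =
  \sum_(b1 <- allbits n) \sum_(b2 <- allbits m) F (b1 ++ b2).
Proof.
elim: m F => [|m IH] F.
  by rewrite addn0; apply: eq_bigr => b _; rewrite big_seq1 cats0.
rewrite addnS big_allbitsS IH; apply: eq_bigr => b1 _; rewrite big_allbitsS.
by apply: eq_bigr => b2 _; rewrite !rcons_cat.
Qed.

Lemma big_nbcb_gsum d L1 L2 F :
  {in L1, forall e, (e.1 <= d)%N && (e.2 <= d)%N} ->
  \sum_(b <- allbits (size (L1 ++ eshift d L2)) | nbcb (L1 ++ eshift d L2) b) F b =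
  \sum_(b1 <- allbits (size L1) | nbcb L1 b1)
    \sum_(b2 <- allbits (size L2) | nbcb L2 b2) F (b1 ++ b2).
Proof.
move=> L1d; rewrite size_cat size_map big_mkcond big_allbitsD [RHS]big_mkcond.
rewrite big_seq [RHS]big_seq; apply: eq_bigr => b1.
rewrite mem_allbits => /eqP b1L; case: ifPn => nb1; last first.
  by rewrite big1 // => b2 _; rewrite nbcb_gsum // (negPf nb1).
by rewrite [RHS]big_mkcond; apply: eq_bigr => b2 _; rewrite nbcb_gsum // nb1.
Qed.

End BrokenCircuits.

Section GluedSums.

Variable R : comNzRingType.
Implicit Types (p q u v : nat -> R) (L : seq (nat * nat)) (a b c : fps R).

Definition nbc_sum p q n L : R :=
  \sum_(t <- allbits (size L) | nbcb L t)
    p (csize n (mask t L) 0) * rest q n (mask t L).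

(** The vertex [d] is where another graph will be glued: [u] and [v] are the weights of a tree that
    continues beyond [d], with and without the vertex 0. *)
Definition nbc_sum_last u p v q d L : R :=
  \sum_(t <- allbits (size L) | nbcb L t)
    (if conn (mask t L) 0 d then u (csize d.+1 (mask t L) 0)
     else p (csize d.+1 (mask t L) 0) * v (csize d.+1 (mask t L) d))
    * mid q d.+1 d (mask t L).

(** [pser (zpow R k) c m] sums over compositions of [m] with first part exactly [k] and vanishes for
    [k > m]; this makes the range of [k] independent of the tree. *)
Lemma pser_split_le a c n m N : a 0%N = 0 -> c 0%N = 0 -> (0 < n)%N -> (0 < m <= N)%N ->
  pser a c (n + m).-1 = \sum_(1 <= k < N.+1) qser a c k n * pser (zpow R k) c m.
Proof.
case: n => // n a0 c0 _ /andP[m0 mN]; rewrite addSn pser_split //.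
rewrite [RHS](@big_cat_nat _ _ _ m.+1) //= ?ltnS // [X in _ = _ + X]big_nat.
rewrite [X in _ = _ + X]big1 ?addr0 => [|k /andP[mk _]]; last first.
  by rewrite /pser coef_zpowM leqNgt mk mulr0.
rewrite big_nat [RHS]big_nat; apply: eq_bigr => k /andP[_ km].
by rewrite /pser coef_zpowM -ltnS km.
Qed.

(** Only the tree through the gluing vertex meets both blocks, and [pser_split_le] cuts its weight.
    Its first part is weighted by [a] or by [b] according to whether it contains vertex 0; in both
    cases the second half begins with the cut part [k], so the second block contributes the same
    sum. *)
Theorem nbc_sum_gsum a b c d n L1 L2 :
  a 0%N = 0 -> b 0%N = 0 -> c 0%N = 0 ->
  {in L1, forall e, (e.1 <= d)%N && (e.2 <= d)%N} ->
  nbc_sum (pser a c) (pser b c) (d + n.+1) (L1 ++ eshift d L2) =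
  \sum_(1 <= k < n.+2)
    nbc_sum (pser (zpow R k) c) (pser b c) n.+1 L2
    * nbc_sum_last (qser a c k) (pser a c) (qser b c k) (pser b c) d L1.
Proof.
move=> a0 b0 c0 L1d; rewrite /nbc_sum /nbc_sum_last big_nbcb_gsum //.
under [RHS]eq_bigr do rewrite mulrC big_distrl /=.
rewrite [RHS]exchange_big big_seq_cond [RHS]big_seq_cond; apply: eq_bigr => t1 /=.
rewrite mem_allbits => /andP[/eqP t1L _].
under [RHS]eq_bigr do rewrite big_distrr /=.
rewrite [RHS]exchange_big; apply: eq_bigr => t2 _ /=.
rewrite mask_cat // /eshift -map_mask -/(eshift _ _).
set M1 := mask t1 L1; set M2 := mask t2 L2.
have M1d : {in M1, forall e, (e.1 <= d)%N && (e.2 <= d)%N} by move=> e /mem_mask/L1d.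
rewrite rest_gsum // csize_gsum1 //.
have c2 : (0 < csize n.+1 M2 0 <= n.+1)%N by rewrite csize_gt0 // csize_le.
case: ifP => d0.
  rewrite (pser_split_le a0 c0 (csize_gt0 M1 (ltn0Sn d)) c2) mul1r mulrA !big_distrl /=.
  by apply: eq_bigr => k _; ring.
rewrite (pser_split_le b0 c0 (csize_gt0 M1 (ltnSn d)) c2).
move: (pser a c _) => x.
by rewrite -!mulrA big_distrl big_distrr /=; apply: eq_bigr => k _; ring.
Qed.

End GluedSums.

(** * Spanning subgraphs as lists of selected edges *)

Lemma mask_nth (T : Type) (x0 : T) (b : bitseq) (s : seq T) : size b = size s ->
  mask b s = [seq nth x0 s j | j <- iota 0 (size s) & nth false b j].
Proof.
move=> bs; rewrite -[s in LHS](mkseq_nth x0) /mkseq -map_mask filter_mask.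
by rewrite -{1}bs -{1}[b](mkseq_nth false) /mkseq bs.
Qed.

Section SubgraphLists.

Variable G : graph.
Hypothesis wfG : wf_graph G.
Implicit Types (u v w : vertex G) (e f : edge G) (F C : {set edge G}).

Definition bits F : bitseq := [seq e \in F | e <- enum 'I_(size (edges G))].

Lemma size_bits F : size (bits F) = size (edges G).
Proof. by rewrite size_map size_enum_ord. Qed.

Lemma nth_bits F e : nth false (bits F) e = (e \in F).
Proof. by rewrite (nth_map e) ?size_enum_ord // nth_ord_enum. Qed.

Lemma bits_inj : injective bits.
Proof. by move=> F F' FF'; apply/setP => e; rewrite -!nth_bits FF'. Qed.

Lemma big_bits (R : nmodType) (phi : bitseq -> R) (P : pred bitseq) :
  \sum_(F : {set edge G} | P (bits F)) phi (bits F) =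
  \sum_(b <- allbits (size (edges G)) | P b) phi b.
Proof.
rewrite -(big_map bits); apply: perm_big; apply: uniq_perm.
- by rewrite map_inj_uniq ?index_enum_uniq //; exact: bits_inj.
- exact: uniq_allbits.
move=> b; rewrite mem_allbits; apply/mapP/eqP => [[F _ ->]|bG]; first exact: size_bits.
exists [set e | nth false b (val e)]; first exact: mem_index_enum.
apply: (@eq_from_nth _ false) => [|i]; rewrite ?size_bits bG // => iG.
by rewrite (nth_bits _ (Ordinal iG)) inE.
Qed.

Definition sublist F := mask (bits F) (edges G).

Lemma nth_edges e : nth (0, 0)%N (edges G) e = tnth (in_tuple (edges G)) e.
Proof. by rewrite (tnth_nth (0, 0)%N). Qed.

Definition below F i : {set edge G} := [set e in F | (e < i)%N].

Lemma mem_sublist_take F i p : (i <= size (edges G))%N ->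
  reflect (exists2 e, e \in below F i & tnth (in_tuple (edges G)) e = p)
          (p \in mask (take i (bits F)) (take i (edges G))).
Proof.
move=> iG; rewrite (mask_nth (0, 0)%N); last by rewrite !size_takel ?size_bits.
rewrite size_takel //; apply: (iffP mapP) => [[j]|[e]].
  rewrite mem_filter mem_iota => /andP[bj /andP[_ ji]] ->.
  have jG : (j < size (edges G))%N by rewrite (leq_trans ji).
  exists (Ordinal jG); last by rewrite -nth_edges nth_take.
  by rewrite inE -nth_bits /= -(nth_take _ ji) bj.
rewrite inE => /andP[eF ei] <-; exists (val e); last by rewrite nth_take // nth_edges.
by rewrite mem_filter mem_iota nth_take // nth_bits eF.
Qed.

Lemma mem_sublist F p :
  reflect (exists2 e, e \in F & tnth (in_tuple (edges G)) e = p) (p \in sublist F).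
Proof.
rewrite /sublist -[bits F]take_size -[X in mask _ X]take_size size_bits.
apply: (iffP (mem_sublist_take _ _ (leqnn _))) => -[e eF <-]; exists e => //.
  by move: eF; rewrite inE => /andP[].
by rewrite inE eF ltn_ord.
Qed.

Lemma joins_sym e u v : joins e u v = joins e v u.
Proof. by rewrite /joins orbC. Qed.

Lemma edgeP e : exists2 uv : vertex G * vertex G,
  tnth (in_tuple (edges G)) e = (val uv.1, val uv.2) & uv.1 != uv.2.
Proof.
have /andP[_ /allP/(_ _ (mem_tnth e (in_tuple _)))] := wfG.
case: (tnth _ e) => x y /= /and3P[xG yG xy].
by exists (Ordinal xG, Ordinal yG).
Qed.

Lemma joins_neq e u v : joins e u v -> u != v.
Proof.
have [[x y] /= exy xy] := edgeP e; rewrite /joins exy !xpair_eqE.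
by case/orP=> /andP[/eqP/val_inj<- /eqP/val_inj<-] //; rewrite eq_sym.
Qed.

Lemma joins_eq e u v u' v' : joins e u v -> joins e u' v' ->
  (u = u' /\ v = v') \/ (u = v' /\ v = u').
Proof.
rewrite /joins => /orP[/eqP->|/eqP->]; rewrite !xpair_eqE;
  by case/orP=> /andP[/eqP/val_inj-> /eqP/val_inj->]; (by left) || by right.
Qed.

Lemma adj_sym F : symmetric (adj F).
Proof. by move=> u v; apply: eq_existsb => e; rewrite joins_sym. Qed.

Lemma adj_connect_sym F : connect_sym (adj F).
Proof. exact/sym_connect_sym/adj_sym. Qed.

Lemma conn_connect F M :
  (forall p, reflect (exists2 e, e \in F & tnth (in_tuple (edges G)) e = p) (p \in M)) ->
  forall u v, connect (adj F) u v = conn M u v.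
Proof.
move=> MF u v; apply/idP/idP => [/connectP[p pu ->]|uv].
  elim: p u pu => [|w p IH] u /= => [_|/andP[uw /IH]]; first exact: conn_refl.
  apply: conn_trans; case/existsP: uw => e /andP[eF].
  have eM : tnth (in_tuple (edges G)) e \in M by apply/MF; exists e.
  by case/orP=> /eqP eq_e; move/conn_mem: eM; rewrite eq_e //= conn_sym.
apply/(fingraph.rootP (adj_connect_sym F)).
(* Canonical representatives for [connect], extended by [None] to labels outside the graph, are
   constant along the edges of [M]. *)
pose f (x : nat) := omap (fingraph.root (adj F)) (insub x : option (vertex G)).
suff: f u = f v by rewrite /f !valK => -[].
apply: conn_fun uv => _ /MF[e eF <-].
have [[x y] /= exy _] := edgeP e; rewrite exy /f !valK /=; congr Some.
apply/(fingraph.rootP (adj_connect_sym F)); apply: connect1; apply/existsP; exists e.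
by rewrite eF /joins exy eqxx.
Qed.

Lemma broken_circuit_connect F :
  [exists B, broken_circuit B && (B \subset F)] ->
  exists e u v, joins e u v && connect (adj (below F e)) u v.
Proof.
case/existsP=> B /andP[/existsP[C /andP[cC /existsP[e /and3P[eC /forallP maxe /eqP->]]]] CF].
case/existsP: cC => k /existsP[vs /existsP[es /and5P[k1 uvs ues /eqP CE /forallP jn]]].
have [i0 ei0] : exists i0, e = tnth es i0 by apply/tnthP; rewrite CE inE in eC.
have step j : j != i0 -> connect (adj (below F e)) (tnth vs j) (tnth vs (ordS j)).
  move=> ji; apply: connect1; apply/existsP; exists (tnth es j); rewrite jn andbT inE.
  have jC : tnth es j \in C by rewrite CE inE mem_tnth.
  have je : tnth es j != e by rewrite ei0 (inj_eq (tuple_uniqP _ ues)).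
  rewrite (fintype.subsetP CF) ?inE ?je ?jC //=.
  by rewrite ltn_neqAle (implyP (maxe _) jC) andbT.
have k0 : (0 < k)%N by case: (k : nat) i0 {ei0 step} => // -[].
(* The walk leaves the far end of [e] and returns to position [i0] after [k - 1] steps, never using
   the edge at [i0], which is [e]. *)
pose w m := iter m (@ordS k) (ordS i0).
have wE m : val (w m) = ((i0 + m.+1) %% k)%N.
  elim: m => [|m IH]; first by rewrite addn1.
  by rewrite [val _]/= -/(w m) IH -addn1 modnDml addn1 -addnS.
have wk : w k.-1 = i0 by apply: val_inj; rewrite wE prednK // modnDr modn_small.
have wN m : (m < k.-1)%N -> w m != i0.
  move=> mk; apply/eqP => /(congr1 val); rewrite wE; have := ltn_ord i0.
  case: (ltnP (i0 + m.+1) k) => h ik; first by rewrite modn_small //=; lia.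
  by rewrite -(subnK h) modnDr modn_small /=; lia.
have walk m : (m <= k.-1)%N ->
    connect (adj (below F e)) (tnth vs (ordS i0)) (tnth vs (w m)).
  elim: m => [|m IH] mk; first exact: connect0.
  by apply: connect_trans (IH (ltnW mk)) _; exact: step (wN _ mk).
exists e, (tnth vs (ordS i0)), (tnth vs i0); rewrite joins_sym {1}ei0 jn /=.
by rewrite -[X in connect _ _ (tnth vs X)]wk walk.
Qed.

(** A path without repeated vertices through edges smaller than [e], closed by [e], is a cycle with
    largest edge [e]. *)
Lemma connect_broken_circuit F e u v :
  joins e u v -> connect (adj (below F e)) u v ->
  [exists B, broken_circuit B && (B \subset F)].
Proof.
move=> euv /connectP[p0 /shortenP[p pu up _] lp] {p0}.
pose g x y := odflt e [pick f in below F e | joins f x y].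
have gP i : (i < size p)%N ->
    (g (nth u (u :: p) i) (nth u p i) \in below F e) &&
    joins (g (nth u (u :: p) i) (nth u p i)) (nth u (u :: p) i) (nth u p i).
  move=> ip; have /existsP[f fF] := pathP u pu i ip.
  by rewrite /g; case: pickP => [f' //|/(_ f)]; rewrite fF.
pose es := rcons (pairmap g u p) e.
have szes : size es = (size p).+1 by rewrite size_rcons size_pairmap.
have nth_es i : (i < size p)%N -> nth e es i = g (nth u (u :: p) i) (nth u p i).
  by move=> ip; rewrite nth_rcons size_pairmap ip (nth_pairmap u).
have nth_es_last : nth e es (size p) = e.
  by rewrite nth_rcons size_pairmap ltnn eqxx.
have es_joins i : (i < (size p).+1)%N ->
    joins (nth e es i) (nth u (u :: p) i) (nth u (u :: p) (i.+1 %% (size p).+1)).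
  rewrite ltnS leq_eqVlt => /predU1P[->|ip].
    rewrite modnn nth_es_last joins_sym /=.
    by rewrite -[nth u (u :: p) _]/(nth u (u :: p) (size (u :: p)).-1) nth_last /= -lp.
  by rewrite modn_small // nth_es // (andP (gP _ ip)).2.
(* All path edges are smaller than [e], hence different from it. Two equal path edges would have the
   same ends; as no vertex repeats, either the positions agree or the edge is traversed backwards,
   forcing both i = j + 1 and j = i + 1. *)
have es_uniq : uniq es.
  have es_neq i : (i < size p)%N -> nth e es i != e.
    move=> ip; apply/eqP => ie; have /andP[+ _] := gP _ ip.
    by rewrite -nth_es // ie inE ltnn andbF.
  apply/(uniqP e) => i j; rewrite !inE !szes !ltnS => ip jp ij.
  move: ip jp; rewrite leq_eqVlt => /predU1P[ip|ip]; rewrite leq_eqVlt => /predU1P[jp|jp].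
  - by rewrite ip jp.
  - by have := es_neq _ jp; rewrite -ij ip nth_es_last eqxx.
  - by have := es_neq _ ip; rewrite ij jp nth_es_last eqxx.
  have := es_joins _ (leqW ip); have := es_joins _ (leqW jp).
  rewrite -ij !modn_small // => /joins_eq + /[dup] => /[apply].
  have nthI k l : (k <= size p)%N -> (l <= size p)%N ->
      nth u (u :: p) k = nth u (u :: p) l -> k = l.
    by move=> kp lp' /eqP; rewrite nth_uniq // => /eqP.
  case=> [[h _] _|[h1 h2] _]; first by apply/esym/nthI; rewrite // ltnW.
  have := nthI _ _ (ltnW jp) ip h1; have := nthI _ _ jp (ltnW ip) h2; lia.
apply/existsP; exists ([set f in es] :\ e); apply/andP; split; last first.
  apply/fintype.subsetP => f; rewrite !inE => /andP[fe] /(nthP e)[i].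
  rewrite szes ltnS leq_eqVlt => /predU1P[->|ip].
    by rewrite nth_es_last => ef; rewrite ef eqxx in fe.
  by rewrite nth_es // => <-; have /andP[] := gP _ ip; rewrite inE => /andP[].
apply/existsP; exists [set f in es]; apply/andP; split; last first.
  apply/existsP; exists e; rewrite inE mem_rcons mem_head eqxx andbT /=.
  apply/forallP => f; apply/implyP; rewrite inE => /(nthP e)[i].
  rewrite szes ltnS leq_eqVlt => /predU1P[->|ip]; first by rewrite nth_es_last => ->.
  by rewrite nth_es // => <-; have /andP[] := gP _ ip; rewrite inE => /andP[_ /ltnW].
have pn : ((size p).+1 < (nv G).+1)%N.
  by have := max_card (mem (u :: p)); rewrite (card_uniqP up) card_ord.
apply/existsP; exists (Ordinal pn); apply/existsP.
have szvs : size (u :: p) == Ordinal pn by [].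
have szes' : size es == Ordinal pn by rewrite szes.
exists (Tuple szvs); apply/existsP; exists (Tuple szes').
apply/and5P; split=> //=.
  rewrite ltnS lt0n size_eq0; apply/eqP => p0; move: lp; rewrite p0 /= => vu.
  by have := joins_neq euv; rewrite vu eqxx.
apply/forallP => i; rewrite (tnth_nth e) !(tnth_nth u) /=.
exact: es_joins (ltn_ord i).
Qed.

Lemma nbc_nbcb F : nbc F = nbcb (edges G) (bits F).
Proof.
rewrite /nbc /nbcb; apply/idP/allP => [nF i|nF]; last first.
  apply/negP => /broken_circuit_connect[e [u [v /andP[euv uv]]]].
  have := nF e; rewrite mem_iota ltn_ord => /(_ isT) /negP; apply.
  rewrite nth_edges; have /= uv' := conn_connect (fun p => mem_sublist_take F p (ltnW (ltn_ord e))).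
  by move: euv uv; rewrite uv' /joins => /orP[/eqP->|/eqP->] //=; rewrite conn_sym.
rewrite mem_iota => /andP[_ iG]; have [[u v] /= euv _] := edgeP (Ordinal iG).
rewrite (nth_edges (Ordinal iG)) euv /=; apply: contra nF => uv.
apply: (@connect_broken_circuit F (Ordinal iG) u v); first by rewrite /joins euv eqxx.
by rewrite (conn_connect (fun p => mem_sublist_take F p (ltnW iG))).
Qed.

Lemma connect_sublist F u v : connect (adj F) u v = conn (sublist F) u v.
Proof. exact: conn_connect (mem_sublist F) u v. Qed.

Lemma card_component F u : #|(component F u).1| = csize (nv G) (sublist F) u.
Proof.
rewrite /csize big_mkord -sum1dep_card big_mkcond /=.
by apply: eq_bigr => v _; rewrite connect_sublist; case: conn.
Qed.

Lemma big_components (R : Type) (idx : R) (op : Monoid.com_law idx)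
    F (f : {set vertex G} * {set edge G} -> R) :
  \big[op/idx]_(T in components F) f T =
  \big[op/idx]_(u : vertex G | isroot (sublist F) u) f (component F u).
Proof.
have -> : components F = component F @: [set u : vertex G | isroot (sublist F) u].
  apply/setP => T; apply/imsetP/imsetP => -[u _ ->]; last by exists u.
  have [r [ru rF ur]] := root_exists (sublist F) u.
  exists (Ordinal (leq_ltn_trans ru (ltn_ord u))); first by rewrite inE.
  have eq_ur : connect (adj F) u =1 connect (adj F) (Ordinal (leq_ltn_trans ru (ltn_ord u))).
    by apply: same_connect; [exact: adj_connect_sym|rewrite connect_sublist].
  have eqV : [set v | connect (adj F) u v] =
             [set v | connect (adj F) (Ordinal (leq_ltn_trans ru (ltn_ord u))) v].
    by apply/setP => v; rewrite !inE eq_ur.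
  by rewrite /component eqV.
rewrite big_imset /=; first by apply: eq_bigl => u; rewrite inE.
move=> u v; rewrite !inE => uF vF [/setP/(_ v)]; rewrite !inE connect0 => uv _.
by apply: val_inj; apply: root_uniq uF vF _; rewrite -connect_sublist.
Qed.

End SubgraphLists.

(** * Sums over forest triples *)

(** A set mapped bijectively onto [A] by [f] is a choice of one preimage for each element of [A], so
    this is distributivity. The value [x0] outside [A] makes the choice function unique. *)
Lemma sum_prod_sections (R : comNzRingType) (X Y : finType) (x0 : X) (f : X -> Y)
    (A : {set Y}) (Q : pred X) (g : X -> R) :
  \sum_(S : {set X} | [&& f @: S == A, dinjectiveb f (mem S) & [forall x in S, Q x]])
     \prod_(x in S) g x
  = \prod_(y in A) \sum_(x | (f x == y) && Q x) g x.
Proof.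
rewrite (big_distr_big_dep x0) /=.
pose h (s : {ffun Y -> X}) := [set s y | y in A].
pose h' (S : {set X}) : {ffun Y -> X} :=
  [ffun y => if y \in A then odflt x0 [pick x in S | f x == y] else x0].
have hS (S : {set X}) x : f @: S = A -> {in S &, injective f} -> x \in S -> h' S (f x) = x.
  move=> fS fI xS; rewrite ffunE -fS imset_f //.
  case: pickP => [x' /andP[x'S /eqP/fI->]//|/(_ x)].
  by rewrite xS eqxx.
rewrite (reindex_onto h h') => [|S /and3P[/eqP fS /dinjectiveP fI _]]; last first.
  apply/setP => x; apply/imsetP/idP => [[y]|xS].
    by rewrite -fS => /imsetP[x' x'S ->] ->; rewrite (hS _ _ fS fI x'S).
  by exists (f x); rewrite ?hS // -fS imset_f.
have hfam s : s \in pfamily x0 (mem A) (fun y x => (f x == y) && Q x) ->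
    [/\ forall y, y \in A -> f (s y) = y, forall y, y \in A -> Q (s y) &
        forall y, y \notin A -> s y = x0].
  move=> /pfamilyP[/supportP s0 sA]; split=> y yA.
  - by have /andP[/eqP] := sA y yA.
  - by have /andP[] := sA y yA.
  - exact: s0.
apply: eq_big => [s|s].
  apply/andP/idP => [[/and3P[/eqP fS /dinjectiveP fI Q_S] /eqP hs]|/[dup] sF /hfam[fs Qs s0]].
    apply/pfamilyP; split; first by apply/supportP => y /negPf yA; rewrite -hs ffunE yA.
    move=> y yA; move: (yA); rewrite -fS => /imsetP[x xS yx].
    rewrite -hs yx hS // unfold_in /= eqxx /=.
    exact: (implyP (forallP Q_S x) xS).
  have fI : {in h s &, injective f}.
    by move=> _ _ /imsetP[y yA ->] /imsetP[z zA ->]; rewrite !fs // => ->.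
  have fS : f @: h s = A.
    apply/setP => y; apply/imsetP/idP => [[_ /imsetP[z zA ->] ->]|yA].
      by rewrite fs.
    by exists (s y); rewrite ?fs // imset_f.
  split; first apply/and3P; first split.
  - by rewrite fS.
  - exact/dinjectiveP.
  - by apply/forallP => x; apply/implyP => /imsetP[y yA ->]; exact: Qs.
  apply/eqP/ffunP => y; case: (boolP (y \in A)) => yA.
    by rewrite -{1}(fs y yA) hS // imset_f.
  by rewrite ffunE (negPf yA) s0.
case/andP=> /and3P[/eqP fS /dinjectiveP fI _] /eqP hs.
rewrite big_imset //= => y z yA zA; rewrite -hs.
move: yA zA; rewrite -fS => /imsetP[x xS ->] /imsetP[x' xS' ->].
by rewrite !hS // => ->.
Qed.

Section ForestTripleSums.

Variables (G : graph) (R : comNzRingType).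
Hypothesis wfG : wf_graph G.
Implicit Types (F : {set edge G}) (Fs : {set triple G}) (t : triple G)
  (T : {set vertex G} * {set edge G}).

(** Every edge lies in the component of one of its ends. Hence a forest triple determines its
    non-broken circuit, and sums over forest triples can be grouped by it. *)
Lemma components_inj : injective (@components G).
Proof.
have sub F F' : components F = components F' -> F \subset F'.
  move=> FF'; apply/fintype.subsetP => e eF; have [[x y] /= exy _] := edgeP wfG e.
  have /imsetP[w _ [_ eqE]] : component F x \in components F'.
    by rewrite -FF' imset_f.
  have : e \in (component F x).2.
    rewrite inE eF; apply/existsP; exists x; rewrite inE connect0 /=.
    by apply/existsP; exists y; rewrite /joins exy eqxx.
  by rewrite [(component F x).2]eqE inE => /andP[].
by move=> F F' FF'; apply/eqP; rewrite finset.eqEsubset !sub.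
Qed.

Definition triple0 : triple G := (finset.set0, finset.set0, [bseq], ord0).

Lemma sum_FT (g : triple G -> R) :
  \sum_(Fs in FT G) \prod_(t in Fs) g t =
  \sum_(F : {set edge G} | nbc F)
    \prod_(T in components F) \sum_(t | (ttree t == T) && wf_triple t) g t.
Proof.
under [RHS]eq_bigr do rewrite -(sum_prod_sections triple0).
rewrite (exchange_big_dep (fun Fs => Fs \in FT G)) /=; last first.
  by move=> F Fs nF FFs; rewrite inE; apply/existsP; exists F; rewrite nF.
apply: eq_bigr => Fs; rewrite inE => /existsP[F FFs].
rewrite (big_pred1 F) // => F'; apply/idP/eqP => [|->]; last by [].
case/andP=> _ /and3P[/eqP compF' _ _].
by case/and4P: FFs => _ /eqP compF _ _; apply: components_inj; rewrite -compF -compF'.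
Qed.

Lemma sum_triples T (phi : seq nat -> nat -> R) :
  \sum_(t | (ttree t == T) && wf_triple t) phi (tcomp t) (troot t) =
  \sum_(s <- comps #|T.1|) \sum_(1 <= r < (head 0%N s).+1) phi s r.
Proof.
have TG : (#|T.1| <= nv G)%N by rewrite -[leqRHS]card_ord max_card.
rewrite -(big_bseq_comps _ TG) big_mkcond /=.
pose psi (b : {bseq nv G of 'I_(nv G).+1}) (r : 'I_(nv G).+1) :=
  if is_composition [seq val i | i <- b] #|T.1| &&
     (1 <= r <= head 0%N [seq val i | i <- b])%N
  then phi [seq val i | i <- b] r else 0.
transitivity (\sum_(x : {set vertex G} * {set edge G} * {bseq nv G of 'I_(nv G).+1})
   \sum_(r < (nv G).+1) if x.1 == T then psi x.2 r else 0).
  rewrite pair_bigA /=; apply: eq_bigr => -[[T' b] r] _ /=.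
  by rewrite /ttree /wf_triple /tvert /tcomp /troot /ttree /=; case: eqP => //= ->.
transitivity (\sum_(T' : {set vertex G} * {set edge G})
   \sum_(b : {bseq nv G of 'I_(nv G).+1})
   \sum_(r < (nv G).+1) if T' == T then psi b r else 0).
  by rewrite [RHS]pair_bigA.
rewrite (bigD1 T) //= [X in _ + X]big1 ?addr0 => [|T' /negPf->]; last first.
  by rewrite big1 // => b _; rewrite big1.
rewrite eqxx [RHS]big_mkcond; apply: eq_bigr => b _; rewrite /psi.
case: ifP => bT /=; last by rewrite big1.
set s := [seq val i | i <- b].
have hs : (head 0%N s <= nv G)%N.
  move/andP: bT => [_ /eqP bT]; apply: leq_trans TG; rewrite -bT -/s.
  by case: s => //= *; exact: leq_addr.
rewrite -big_mkcond /= -(big_mkord (fun r => 1 <= r <= head 0 s)%N (phi s)).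
rewrite [RHS](@big_nat_widen _ _ _ _ _ (nv G).+1) ?ltnS // [in RHS]big_mkcond.
rewrite [RHS](@big_nat_widenl _ _ _ _ 0%N) // -[RHS]big_mkcondr /=.
by apply: eq_bigl => r; rewrite ltnS.
Qed.

End ForestTripleSums.

Section TripleAt.

Variable G : graph.
Implicit Types (Fs : {set triple G}) (t : triple G).

Definition has_vertex x t : bool := [exists v in tvert t, val v == x].

Lemma triple_atP Fs x : Fs \in FT G -> (x < nv G)%N ->
  exists t, [/\ triple_at x Fs = Some t, t \in Fs, has_vertex x t &
                forall t', t' \in Fs -> has_vertex x t' -> t' = t].
Proof.
rewrite inE => /existsP[F /and4P[_ /eqP FsF /dinjectiveP inj _]] xG.
have uniq_t t t' : t \in Fs -> t' \in Fs -> has_vertex x t -> has_vertex x t' -> t = t'.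
  move=> tF t'F /existsP[v /andP[vt /eqP vx]] /existsP[v' /andP[v't /eqP v'x]].
  have vv' : v' = v by apply: val_inj; rewrite /= vx v'x.
  rewrite {}vv' {v'x v'} in v't; apply: inj => //.
  have /imsetP[u _ tu] : ttree t \in components F by rewrite -FsF imset_f.
  have /imsetP[u' _ tu'] : ttree t' \in components F by rewrite -FsF imset_f.
  move: vt v't; rewrite /tvert tu tu' !inE => uv u'v.
  have uu' : connect (adj F) u =1 connect (adj F) u'.
    apply: same_connect; first exact: adj_connect_sym.
    by apply: connect_trans uv _; rewrite adj_connect_sym.
  rewrite /component.
  suff -> : [set v | connect (adj F) u v] = [set v | connect (adj F) u' v] by [].
  by apply/setP => w; rewrite !inE uu'.
have [t tF tx] : exists2 t, t \in Fs & has_vertex x t.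
  have : component F (Ordinal xG) \in components F by rewrite imset_f.
  rewrite -FsF => /imsetP[t tF tE]; exists t => //; apply/existsP.
  by exists (Ordinal xG); rewrite /tvert -tE inE connect0 eqxx.
have [t' t'E] : exists t', triple_at x Fs = Some t'.
  rewrite /triple_at; case: pickP => [t'|/(_ t)]; first by exists t'.
  by rewrite tF; move: tx; rewrite /has_vertex => ->.
have [t'F t'x] : t' \in Fs /\ has_vertex x t'.
  by move: t'E; rewrite /triple_at; case: pickP => // t'' /andP[? ?] [<-].
by exists t'; split=> // t'' t''F t''x; exact: uniq_t.
Qed.

Lemma prod_triple_at (R : comNzRingType) (f g : triple G -> R) Fs x t :
  Fs \in FT G -> (x < nv G)%N -> triple_at x Fs = Some t ->
  \prod_(t' in Fs) (if has_vertex x t' then f t' else g t') =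
  f t * \prod_(t' in Fs | t' != t) g t'.
Proof.
move=> FsG xG; have [t0 [-> tF tx t_uniq]] := triple_atP FsG xG => -[<-].
rewrite (bigD1 t0) //= tx; congr (_ * _); apply: eq_bigr => t' /andP[t'F t't].
by case: ifPn => // t'x; rewrite (t_uniq t') ?eqxx in t't.
Qed.

Lemma prod_triple_at1 (R : comNzRingType) (f : triple G -> R) Fs x t :
  Fs \in FT G -> (x < nv G)%N -> triple_at x Fs = Some t ->
  \prod_(t' in Fs) (if has_vertex x t' then f t' else 1) = f t.
Proof.
by move=> FsG xG tE; rewrite (prod_triple_at _ (fun=> 1) FsG xG tE) big1 ?mulr1.
Qed.

End TripleAt.

Section Weights.

Variable R : comNzRingType.
Implicit Types (A B : nat -> nat -> R) (c : fps R).

Definition triple_weight A B c (G : graph) (t : triple G) : R :=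
  (if has_vertex 0 t then A else B) (head 0%N (tcomp t)) (troot t)
  * \prod_(j <- behead (tcomp t)) c j.

Definition ft_weight A B c (G : graph) (Fs : {set triple G}) : R :=
  \prod_(t in Fs) triple_weight A B c t.

(** For a weight that does not depend on the root this multiplies the j-th weight by j, as [zderiv]
    does. *)
Definition head_series A : fps R := fun j => \sum_(1 <= r < j.+1) A j r.

Lemma head_series0 A : head_series A 0%N = 0.
Proof. by rewrite /head_series big_geq. Qed.

Lemma has_vertex_component (G : graph) (wfG : wf_graph G) (F : {set edge G})
    (u : vertex G) t x : (x < nv G)%N ->
  ttree t = component F u -> has_vertex x t = conn (sublist F) u x.
Proof.
move=> xG tu; apply/existsP/idP => [[v]|ux].
  by rewrite /tvert tu inE connect_sublist // => /andP[uv /eqP<-].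
by exists (Ordinal xG); rewrite /tvert tu inE connect_sublist // ux /=.
Qed.

Lemma root_conn0 M u : isroot M u -> conn M u 0 = (u == 0%N).
Proof.
case: u => [|u] uM; first by rewrite conn_refl.
by apply/negbTE; have /isrootP := uM; apply.
Qed.

(** For a fixed non-broken circuit the trees choose compositions and roots independently, and the
    sum over the choices of one tree depends only on its size. *)
Theorem sum_ft_weight A B c (G : graph) : wf_graph G ->
  \sum_(Fs in FT G) ft_weight A B c Fs =
  nbc_sum (pser (head_series A) c) (pser (head_series B) c) (nv G) (edges G).
Proof.
move=> wfG; have G0 : (0 < nv G)%N by have /andP[] := wfG.
rewrite sum_FT // /nbc_sum -big_bits // (eq_bigl _ _ (nbc_nbcb wfG)).
apply: eq_bigr => F _; rewrite big_components // -/(sublist F); set M := sublist F.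
pose f x := pser (head_series (if x == 0%N then A else B)) c (csize (nv G) M x).
transitivity (\prod_(u : vertex G | isroot M u) f u).
  apply: eq_bigr => u uM; rewrite /f.
  pose phi s r := (if val u == 0%N then A else B) (head 0%N s) r * \prod_(j <- behead s) c j.
  rewrite (eq_bigr (fun t => phi (tcomp t) (troot t))) => [|t /andP[/eqP tu _]]; last first.
    by rewrite /triple_weight (has_vertex_component wfG G0 tu) root_conn0.
  rewrite (sum_triples _ phi) card_component // -comps_pser ?head_series0 ?csize_gt0 //.
  by apply: eq_bigr => s _; rewrite -big_distrl.
rewrite -(big_mkord (isroot M) f) big_ltn_cond // isroot0 /f eqxx; congr (_ * _).
by rewrite /rest big_nat_cond [RHS]big_nat_cond; apply: eq_bigr => -[|x].
Qed.

End Weights.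

(** * Gluing a graph to a cycle *)

Lemma cycle_edges_le a : {in edges (cycle_graph a), forall e,
  (e.1 <= a.-1)%N && (e.2 <= a.-1)%N}.
Proof.
move=> e; rewrite mem_cat => /orP[/mapP[i]|].
  by rewrite mem_iota => /andP[_ ia] -> /=; rewrite ltnW.
by case: ifP => // _; rewrite inE => /eqP->; rewrite leqnn.
Qed.

Lemma wf_cycle a : (2 <= a)%N -> wf_graph (cycle_graph a).
Proof.
move=> a2; apply/andP; split; first by rewrite /=; lia.
rewrite all_cat; apply/andP; split.
  by apply/allP => e /mapP[i]; rewrite mem_iota => ia -> /=; lia.
by case: ifP => //= a3; rewrite andbT; lia.
Qed.

Lemma wf_gsum G1 G2 : wf_graph G1 -> wf_graph G2 -> wf_graph (gsum G1 G2).
Proof.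
move=> /andP[n1 /allP w1] /andP[n2 /allP w2]; apply/andP; split; first by rewrite /=; lia.
rewrite all_cat all_map; apply/andP; split; apply/allP => e.
  by move=> /w1 /and3P[e1 e2 ->]; rewrite /= andbT; lia.
by move=> /w2 /and3P[e1 e2 e12] /=; rewrite eqn_add2r e12 andbT; lia.
Qed.

Section CycleTree.

Variables (R : comNzRingType) (A B : nat -> nat -> R) (c : fps R).
Variables (a : nat) (U : graph).
Hypotheses (a_ge2 : (2 <= a)%N) (treeU : is_tree U).

Let d := a.-1.
Let k := nv U.
Let G := gsum (cycle_graph a) U.
Let L1 := edges (cycle_graph a).

Let wfU : wf_graph U. Proof. by have /and3P[] := treeU. Qed.
Let wfG : wf_graph G. Proof. by apply: wf_gsum; first exact: wf_cycle. Qed.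
Let k_gt0 : (0 < k)%N. Proof. by have /andP[] := wfU. Qed.
Let da : a = d.+1. Proof. by rewrite prednK // ltnW. Qed.
Let nvG : nv G = (d + k)%N. Proof. by rewrite /= [in LHS]da. Qed.
Let dG : (d < nv G)%N. Proof. by rewrite nvG; lia. Qed.
Let G_gt0 : (0 < nv G)%N. Proof. by rewrite nvG; lia. Qed.
Let edgesG : edges G = L1 ++ eshift d (edges U). Proof. by []. Qed.

Let size_edgesG : size (edges G) = (size L1 + size (edges U))%N.
Proof. by rewrite size_cat size_map. Qed.

Let nth_edgesG i : (size L1 <= i)%N -> (i - size L1 < size (edges U))%N ->
  nth (0, 0)%N (edges G) i = ((nth (0, 0)%N (edges U) (i - size L1)).1 + d,
                              (nth (0, 0)%N (edges U) (i - size L1)).2 + d)%N.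
Proof.
move=> Li iU; rewrite edgesG nth_cat ltnNge Li [~~ true]/=.
by rewrite (nth_map (0, 0)%N).
Qed.

Lemma bits_setT (H : graph) : bits [set: edge H] = nseq (size (edges H)) true.
Proof.
apply: (@eq_from_nth _ false) => [|i]; rewrite size_bits ?size_nseq // => iH.
by rewrite (nth_bits _ (Ordinal iH)) inE nth_nseq iH.
Qed.

Lemma tree_conn x y : (x < k)%N -> (y < k)%N -> conn (edges U) x y.
Proof.
move=> xk yk; have /and3P[_ /forallP/(_ (Ordinal xk))/forallP/(_ (Ordinal yk)) + _] := treeU.
by rewrite connect_sublist // /sublist bits_setT mask_true.
Qed.

Lemma tree_nbcb : nbcb (edges U) (nseq (size (edges U)) true).
Proof.
rewrite -bits_setT -nbc_nbcb //; apply/existsP => -[C /andP[/existsP[D /andP[cD _]] _]].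
by have /and3P[_ _ /existsP[]] := treeU; exists D.
Qed.

Lemma csize_tree : csize k (edges U) 0 = k.
Proof.
rewrite /csize big_nat (eq_bigr (fun=> 1%N)) => [|y /andP[_ yk]].
  by rewrite -big_nat sum_nat_const_nat muln1 subn0.
by rewrite tree_conn.
Qed.

Let good (t : triple G) : bool :=
  [forall e : edge G, (size L1 <= e)%N ==> (e \in tedge t)]
  && (k <= last 0 (tcomp t))%N.

(** The condition defining [FT'] concerns a single triple, so its indicator is absorbed into the
    factor of that triple and the sum still runs over all of [FT]. *)
Let weight' t := triple_weight A B c t * (if has_vertex d t then (good t)%:R else 1).

Lemma sum_FT'_weight' :
  \sum_(Fs in FT' a U) ft_weight A B c Fs = \sum_(Fs in FT G) \prod_(t in Fs) weight' t.
Proof.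
rewrite [RHS](bigID (fun Fs => Fs \in FT' a U)) /= [X in _ = _ + X]big1 ?addr0.
  rewrite (eq_bigl (fun Fs => (Fs \in FT G) && (Fs \in FT' a U))) => [|Fs]; last first.
    by rewrite inE andbA andbb.
  apply: eq_bigr => Fs /andP[FsG]; rewrite inE => /andP[_].
  have [t [tE _ _ _]] := triple_atP FsG dG.
  rewrite /weight' big_split (prod_triple_at1 _ FsG dG tE) tE.
  by rewrite -/(good t) => ->; apply/esym/mulr1.
move=> Fs /andP[FsG]; rewrite inE FsG /=.
have [t [tE _ _ _]] := triple_atP FsG dG.
rewrite /weight' big_split (prod_triple_at1 _ FsG dG tE) tE.
by rewrite -/(good t) => /negPf->; exact: mulr0.
Qed.

(** Since [U] is connected, its edges, once all selected, belong to the tree through [d]. *)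
Lemma good_component (F : {set edge G}) (u : vertex G) : conn (sublist F) u d ->
  [forall e : edge G, (size L1 <= e)%N ==> (e \in (component F u).2)] =
  all id (drop (size L1) (bits F)).
Proof.
move=> ud; apply/forallP/allP => [Fall b /(nthP false)[i]|Fall e].
  rewrite size_drop size_bits nth_drop => iG <-.
  have eG : (size L1 + i < size (edges G))%N by lia.
  have := implyP (Fall (Ordinal eG)) (leq_addr _ _); rewrite inE => /andP[].
  by rewrite -nth_bits.
apply/implyP => Le; have eF : e \in F.
  rewrite -nth_bits -(subnKC Le) -nth_drop; apply: Fall; apply: mem_nth.
  by rewrite size_drop size_bits; have := ltn_ord e; lia.
have eU : (e - size L1 < size (edges U))%N.
  by have := ltn_ord e; rewrite [X in (_ < X)%N]size_edgesG; lia.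
have [[x y] /= exy _] := edgeP wfG e.
have := nth_edges e; rewrite exy nth_edgesG //.
set e' := nth _ _ _ => -[xE _].
have e'U : (e'.1 < k)%N.
  by have /andP[_ /allP/(_ e' (mem_nth _ eU))/and3P[]] := wfU.
rewrite inE eF; apply/existsP; exists x; rewrite inE (connect_sublist wfG F u x).
apply/andP; split; last by apply/existsP; exists y; rewrite /joins exy eqxx.
apply: conn_trans ud _; rewrite -xE.
have bitsE : bits F = take (size L1) (bits F) ++ nseq (size (edges U)) true.
  rewrite -[LHS](cat_take_drop (size L1)); congr (_ ++ _).
  have sz : size (drop (size L1) (bits F)) = size (edges U).
    by rewrite size_drop size_bits size_edgesG addKn.
  by rewrite -sz; apply/all_pred1P/allP => b bF; rewrite /= (Fall b bF).
rewrite /sublist bitsE edgesG mask_cat; last first.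
  by rewrite size_takel // size_bits size_edgesG leq_addr.
rewrite mask_true ?size_map //.
rewrite conn_gsum; last by move=> e2 /mem_mask; exact: cycle_edges_le.
by rewrite minnn (minn_idPr (leq_addl _ _)) conn_refl subnn addnK tree_conn.
Qed.

Lemma comps_qser' A' m : (0 < m)%N ->
  \sum_(s <- comps (m + k).-1) \sum_(1 <= r < (head 0%N s).+1)
     A' (head 0%N s) r * (\prod_(j <- behead s) c j) * (k <= last 0%N s)%:R
  = qser (head_series A') c k m.
Proof.
case: m => // m _; rewrite addSn -comps_qser ?head_series0 // [RHS]big_mkcond.
apply: eq_bigr => s _; rewrite -!big_distrl /= -/(head_series _ _).
by case: leqP; rewrite ?mulr1 ?mulr0.
Qed.

(** With all of [U] selected, the tree through [d] gains [k - 1] vertices and the other trees stay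
    inside the cycle; the bound on the last part turns its [pser] into [qser]. Thus [U] enters only
    through [k]. *)
Theorem sum_FT'_weight :
  \sum_(Fs in FT' a U) ft_weight A B c Fs =
  nbc_sum_last (qser (head_series A) c k) (pser (head_series A) c)
               (qser (head_series B) c k) (pser (head_series B) c) d L1.
Proof.
rewrite sum_FT'_weight' sum_FT // (eq_bigl _ _ (nbc_nbcb wfG)).
pose pA := pser (head_series A) c; pose pB := pser (head_series B) c.
pose qS A' m := \sum_(s <- comps m) \sum_(1 <= r < (head 0%N s).+1)
     A' (head 0%N s) r * (\prod_(j <- behead s) c j) * (k <= last 0%N s)%:R : R.
pose term t := let M := mask t (edges G) in
  (if conn M 0 d then qS A (csize (nv G) M 0)
   else pA (csize (nv G) M 0) * qS B (csize (nv G) M d)) * mid pB (nv G) d M.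
transitivity (\sum_(F : {set edge G} | nbcb (edges G) (bits F))
   ((all id (drop (size L1) (bits F)))%:R * term (bits F))).
  apply: eq_bigr => F _; rewrite big_components // /term -/(sublist F).
  set M := sublist F; set ok := all _ _.
  pose A_ x := if x == 0%N then A else B.
  pose f x := if conn M x d then ok%:R * qS (A_ x) (csize (nv G) M x)
              else pser (head_series (A_ x)) c (csize (nv G) M x).
  transitivity (\prod_(u : vertex G | isroot M u) f u).
    apply: eq_bigr => u uM; rewrite /f.
    pose phi s r := A_ u (head 0%N s) r * (\prod_(j <- behead s) c j)
       * if conn M u d then (ok && (k <= last 0%N s)%N)%:R else 1.
    rewrite (eq_bigr (fun t => phi (tcomp t) (troot t))) => [|t /andP[/eqP tu _]]; last first.
      rewrite /weight' /triple_weight !(has_vertex_component wfG _ tu) // root_conn0 //.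
      rewrite /phi /A_; congr (_ * _).
      case: ifP => // ud; rewrite /good /tedge tu good_component //.
    rewrite (sum_triples _ phi) card_component // /phi; case: ifP => ud.
      rewrite /qS big_distrr; apply: eq_bigr => s _; rewrite big_distrr /=.
      by apply: eq_bigr => r _; rewrite -mulnb natrM mulrCA.
    rewrite -comps_pser ?head_series0 ?csize_gt0 //.
    by apply: eq_bigr => s _; rewrite -!big_distrl /= mulr1.
  rewrite -(big_mkord (isroot M) f) big_ltn_cond // isroot0.
  have midE : mid pB (nv G) d M =
      \prod_(1 <= x < nv G | isroot M x && ~~ conn M x d) f x.
    rewrite /mid big_nat_cond [RHS]big_nat_cond; apply: eq_bigr => -[|x] //.
    by rewrite /f => /andP[_ /andP[_ /negPf->]].
  rewrite midE; case: ifPn => d0.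
    by rewrite (root_prod_conn0 _ _ d0) {1}/f d0 mulrA.
  pose f' x := if conn M x d then ok%:R * qS B (csize (nv G) M x)
               else pB (csize (nv G) M x).
  have ff' P : \prod_(1 <= x < nv G | P x) f x = \prod_(1 <= x < nv G | P x) f' x.
    by rewrite big_nat_cond [RHS]big_nat_cond; apply: eq_bigr => -[|x].
  rewrite !ff' (@root_prod_split _ f' _ d) //; last first.
    by move=> x y xy; rewrite /f' (conn_eql xy) (csize_conn _ xy).
  by rewrite {1}/f {1}/f' conn_refl (negPf d0) /pA /A_ /=; ring.
rewrite -/(edges G) (@big_bits G _ (fun t => (all id (drop (size L1) t))%:R * term t)).
rewrite edgesG big_nbcb_gsum /nbc_sum_last; last exact: cycle_edges_le.
rewrite big_seq_cond [RHS]big_seq_cond; apply: eq_bigr => t1.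
rewrite mem_allbits => /andP[/eqP t1L _].
have drop_t1 t2 : drop (size L1) (t1 ++ t2) = t2 by rewrite -t1L drop_size_cat.
(* The only surviving selection in [U] is the full one, which is admissible because a tree has no
   cycle. *)
rewrite big_mkcond (bigD1_seq (nseq (size (edges U)) true)) ?uniq_allbits //=;
  last by rewrite mem_allbits size_nseq.
rewrite tree_nbcb drop_t1 all_nseq orbT mul1r big_seq_cond big1 ?addr0; last first.
  move=> t2; rewrite mem_allbits => /andP[/eqP t2U t2N]; case: ifP => // _.
  rewrite drop_t1; case: allP => [t2T|_]; last by rewrite mul0r.
  case/eqP: t2N; rewrite -t2U; apply/all_pred1P/allP => b bt2.
  by rewrite /= (t2T b bt2).
rewrite /term edgesG mask_cat // mask_true ?size_map //.
set M1 := mask t1 L1.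
have M1d : {in M1, forall e, (e.1 <= d)%N && (e.2 <= d)%N}.
  by move=> e /mem_mask; exact: cycle_edges_le.
have kE : k = k.-1.+1 by rewrite prednK.
have cs x : (x <= d)%N -> csize (nv G) (M1 ++ eshift d (edges U)) x =
    if conn M1 x d then (csize d.+1 M1 x + k).-1 else csize d.+1 M1 x.
  by move=> xd; rewrite nvG kE csize_gsum1 // -kE csize_tree.
have cd x : conn (M1 ++ eshift d (edges U)) x d = conn M1 (minn x d) d && conn (edges U) (x - d) 0.
  by rewrite conn_gsum // minnn subnn.
have -> : mid pB (nv G) d (M1 ++ eshift d (edges U)) = mid pB d.+1 d M1.
  rewrite {1}/mid nvG (@big_cat_nat _ _ _ d.+1) /=; [|lia|lia].
  rewrite [X in _ * X]big_nat_cond [X in _ * X]big_pred0 ?mulr1 => [|x]; last first.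
    apply/negbTE; apply/negP => /andP[/andP[dx xk] /andP[_]].
    by rewrite cd (minn_idPr (ltnW dx)) conn_refl tree_conn //; lia.
  rewrite big_nat_cond [RHS]big_nat_cond; apply: eq_big => x.
    case: (boolP (1 <= x < d.+1)%N) => //= /andP[_]; rewrite ltnS => xd; rewrite isroot_gsum1 // cd.
    by rewrite (minn_idPl xd) (eqP xd) conn_refl andbT.
  move=> /andP[/andP[_ +] /andP[_]]; rewrite ltnS => xd.
  rewrite cd (minn_idPl xd) (eqP xd) conn_refl andbT.
  by rewrite -nvG cs // => /negPf->.
rewrite cd min0n sub0n conn_refl andbT !cs //; congr (_ * _).
case: (conn M1 0 d); first exact/comps_qser'/csize_gt0.
by rewrite conn_refl; congr (_ * _); exact/comps_qser'/csize_gt0.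
Qed.

End CycleTree.

(** * Sums over spanning subgraphs of a path and of a cycle *)

Section Paths.

Variable R : comNzRingType.
Implicit Types (Psi F : nat -> nat -> R) (u p v : nat -> R) (q : fps R).

Definition tri_sum N F : R :=
  \sum_(1 <= x < N) \sum_(1 <= y < N | (x + y <= N)%N) F x y.

Lemma eq_tri_sum N F F' :
  (forall x y, (0 < x)%N -> (0 < y)%N -> (x + y <= N)%N -> F x y = F' x y) ->
  tri_sum N F = tri_sum N F'.
Proof.
move=> FF'; rewrite /tri_sum big_nat [RHS]big_nat; apply: eq_bigr => x /andP[x0 _].
rewrite big_nat_cond [RHS]big_nat_cond; apply: eq_bigr => y /andP[/andP[y0 _] xy].
exact: FF'.
Qed.

Lemma tri_sum_recl N F : (0 < N)%N ->
  tri_sum N.+1 F = \sum_(1 <= y < N.+1) F 1%N y + tri_sum N (fun x y => F x.+1 y).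
Proof.
move=> N0; rewrite /tri_sum big_ltn //; congr (_ + _).
  rewrite big_nat_cond [RHS]big_nat_cond; apply: eq_bigl => y.
  by case: (boolP (1 <= y < N.+1)%N) => //= /andP[_]; lia.
rewrite big_add1 /= big_nat [RHS]big_nat; apply: eq_bigr => x /andP[x0 xN].
rewrite big_mkcond big_nat_recr //= -big_mkcond /= ifF ?addr0; last by lia.
by apply: eq_bigl => y; rewrite addSn.
Qed.

Lemma tri_sumC N F : tri_sum N F = tri_sum N (fun x y => F y x).
Proof.
rewrite /tri_sum (exchange_big_dep xpredT) //=.
by apply: eq_bigr => y _; apply: eq_bigl => x; rewrite addnC.
Qed.

Definition path_edges n : seq (nat * nat) := [seq (i, i.+1) | i <- iota 0 n.-1].

Lemma path_edgesS n : path_edges n.+2 = [:: (0, 1)%N] ++ eshift 1 (path_edges n.+1).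
Proof.
rewrite /path_edges /= (iotaDl 1 0) /eshift -!map_comp; congr (_ :: _).
by apply: eq_map => i /=; rewrite !add1n !addn1.
Qed.

(** The edges before (i, i + 1) preserve the property [x <= i], which separates its two ends. *)
Lemma path_nbcb n t : size t = size (path_edges n) -> nbcb (path_edges n) t.
Proof.
move=> tn; apply/allP => i; rewrite mem_iota => /andP[_]; rewrite size_map size_iota => iN.
rewrite (nth_map 0%N) ?size_iota // nth_iota //=; apply/negP => ii.
suff : (i <= i)%N = (i.+1 <= i)%N by rewrite leqnn ltnn.
apply: (conn_fun (f := fun x => (x <= i)%N) _ ii) => e /mem_mask.
rewrite -map_take take_iota => /mapP[j]; rewrite mem_iota => ji -> /=; lia.
Qed.

(** [Psi] is a general function of the two end sizes because closing the cycle needs a term in their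
    sum, which is not a product. *)
Definition path_term u Psi q n M : R :=
  (if conn M 0 n then u (csize n.+1 M 0)
   else Psi (csize n.+1 M 0) (csize n.+1 M n)) * mid q n.+1 n M.

Lemma path_mid q n M1 M2 : {in M1, forall e, (e.1 <= 1)%N && (e.2 <= 1)%N} ->
  mid q n.+2 n.+1 (M1 ++ eshift 1 M2) =
  (if conn M1 0 1 || conn M2 0 n then 1 else q (csize 2 M1 1 + csize n.+1 M2 0).-1)
  * mid q n.+1 n M2.
Proof.
move=> M1d; rewrite {1}/mid big_mkcond big_ltn //= -big_mkcond /=; congr (_ * _).
  rewrite isroot_gsum1 // conn_gsum // conn_refl subnn subn1 /=.
  rewrite /isroot /= orbF [conn M1 1 0]conn_sym; case: (conn M1 0 1) => //=.
  by case: (conn M2 0 n) => //=; rewrite -[n.+2]add1n csize_gsum1 // conn_refl.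
rewrite big_add1 /mid big_nat_cond [RHS]big_nat_cond; apply: eq_big => x.
  case: (boolP (1 <= x < n.+1)%N) => //= /andP[x0 _].
  rewrite -[x.+1]add1n isroot_gsum2 // conn_gsum // !addKn -[n.+1]add1n !addKn.
  by rewrite !(minn_idPr _) // conn_refl.
move=> /andP[/andP[x0 xn] /andP[]]; rewrite -[x.+1]add1n isroot_gsum2 // => /isrootP xM _.
by rewrite -[n.+2]add1n csize_gsum2 // conn_sym xM.
Qed.

(** Without the first edge, vertex 0 is alone, and the first component of the shorter path becomes a
    middle one, unless it reaches the far end. *)
Lemma path_term_skip u Psi q n M :
  path_term u Psi q n.+1 (eshift 1 M) =
  path_term (Psi 1%N) (fun x y => q x * Psi 1%N y) q n M.
Proof.
rewrite /path_term -[eshift 1 M]/([::] ++ eshift 1 M) conn_gsum //.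
rewrite (_ : conn [::] _ _ = false) // path_mid // -[n.+2]add1n csize_gsum1 //.
have c1 : csize (1 + n.+1) ([::] ++ eshift 1 M) 1 = csize n.+1 M 0.
  by rewrite csize_gsum1 // /csize !big_nat_recl // big_nil.
rewrite (_ : csize (1 + n.+1) _ n.+1 = csize n.+1 M n); last first.
  case: (boolP (conn M 0 n)) => d0; last by rewrite -[n.+1 in LHS]add1n csize_gsum2.
  rewrite -(csize_conn _ d0) -c1; apply: csize_conn; rewrite conn_sym conn_gsum //.
  by rewrite subnn subn1 d0.
rewrite (_ : csize 2 [::] 0 = 1%N) /=; last by rewrite /csize !big_nat_recl // big_nil.
rewrite (_ : csize 2 [::] 1 = 1%N) /=; last by rewrite /csize !big_nat_recl // big_nil.
case: ifP => d0; first by rewrite mul1r (csize_conn _ d0).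
by rewrite mulrA [Psi _ _ * _]mulrC.
Qed.

Lemma path_term_keep u Psi q n M :
  path_term u Psi q n.+1 ([:: (0, 1)%N] ++ eshift 1 M) =
  path_term (fun x => u x.+1) (fun x y => Psi x.+1 y) q n M.
Proof.
have M1d : {in [:: (0, 1)%N], forall e, (e.1 <= 1)%N && (e.2 <= 1)%N}.
  by move=> e; rewrite inE => /eqP->.
rewrite /path_term conn_gsum // path_mid // -[n.+2]add1n csize_gsum1 //.
rewrite (_ : csize 2 [:: (0, 1)%N] 0 = 2) /=; last by rewrite /csize !big_nat_recl // big_nil.
rewrite sub0n subn1 /= !mul1r; case: (boolP (conn M 0 n)) => // d0.
congr (_ * _); congr (Psi _ _); exact: (csize_gsum2 M1d n.+1 d0).
Qed.

(** End components of sizes x and y leave n + 1 - x - y vertices, which the middle components cut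
    into a composition; [geom q] sums over these. *)
Lemma path_sum u Psi q n :
  \sum_(t <- allbits (size (path_edges n.+1)))
     path_term u Psi q n (mask t (path_edges n.+1)) =
  u n.+1 + tri_sum n.+1 (fun x y => Psi x y * geom q (n.+1 - x - y)%N).
Proof.
elim: n u Psi => [|n IH] u Psi.
  rewrite big_seq1 /path_term conn_refl /csize big_nat1 /mid big_geq // mulr1.
  by rewrite /tri_sum big_geq // addr0.
have szE : size (path_edges n.+2) = (1 + size (path_edges n.+1))%N.
  by rewrite !size_map !size_iota.
rewrite szE big_allbitsD /= !big_cons big_nil addr0 path_edgesS.
under eq_bigr do rewrite [mask _ _]/= -map_mask -/(eshift 1 _) path_term_skip.
rewrite IH addrC.
under eq_bigr do rewrite [mask _ _]/= -map_mask -/(eshift 1 _) path_term_keep.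
rewrite IH [in RHS]tri_sum_recl // -addrA; congr (_ + _).
rewrite addrC; congr (_ + _).
rewrite big_nat_recr //= subSS subn0 subnn mulr1 addrC; congr (_ + _).
rewrite tri_sumC /tri_sum big_nat [LHS]big_nat; apply: eq_bigr => y /andP[y0 yn].
(* The component next to the isolated first vertex is the first part of the middle composition. *)
rewrite geomS; last lia.
rewrite big_distrr [LHS](@big_cat_nat _ _ _ (n.+1 - y).+1) /=; [|lia|lia].
rewrite [X in _ + X = _]big_nat_cond [X in _ + X = _]big_pred0 ?addr0; last by move=> x; lia.
rewrite [LHS]big_nat_cond [RHS]big_nat_cond; apply: eq_big => x; first by lia.
by move=> _; rewrite -subnDA addnC subnDA mulrA [q x * _]mulrC.
Qed.

(* Here [x] and [y] are the sizes of the components of the two ends of the path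
   left when the closing edge [(a - 1, 0)] is deleted; the edge is unselected in
   the first summand and joins the two components in the second one. *)
Theorem cycle_sum u p v q a : (2 <= a)%N ->
  nbc_sum_last u p v q a.-1 (edges (cycle_graph a)) =
  tri_sum a (fun x y => (p x * v y + u (x + y)%N) * geom q (a - x - y)%N).
Proof.
pose Psi x y := p x * v y + u (x + y)%N.
case: a => // -[|[|a]] // _; rewrite /nbc_sum_last.
  (* For two vertices there is no closing edge: the single edge, unselected or selected, gives the
     two summands directly. *)
  have csize1 x : (x < 2)%N -> csize 2 [::] x = 1%N.
    by rewrite /csize !big_nat_recl // big_nil; case: x => [|[]].
  rewrite [RHS]/tri_sum big_nat1 [RHS]big_mkcond big_nat1 /= mulr1.
  have nb t : size t = 1%N -> nbcb [:: (0, 1)%N] t by exact: (@path_nbcb 2).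
  rewrite big_mkcond /= !big_cons big_nil !nb // addr0 /=.
  rewrite (_ : mid q 2 1 [::] = 1); last by rewrite /mid big_mkcond big_nat1.
  rewrite (_ : mid q 2 1 [:: (0, 1)%N] = 1); last by rewrite /mid big_mkcond big_nat1.
  rewrite !csize1 // (_ : csize 2 [:: (0, 1)%N] 0 = 2) /=; first by rewrite !mulr1.
  by rewrite /csize !big_nat_recl // big_nil.
set d := a.+2; rewrite -/d.
have edgesE : edges (cycle_graph d.+1) = rcons (path_edges d.+1) (d, 0%N) by rewrite -cats1.
transitivity (\sum_(t <- allbits (size (path_edges d.+1)))
   path_term (fun=> 0) Psi q d (mask t (path_edges d.+1))); last first.
  by rewrite path_sum add0r.
rewrite edgesE size_rcons big_mkcond big_allbitsS big_seq [RHS]big_seq.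
apply: eq_bigr => t; rewrite mem_allbits => /eqP tP.
rewrite !nbcb_rcons // path_nbcb // !mask_rcons // [nseq _ _]/= [nseq true _]/=.
set M := mask t _; rewrite cats0 conn_sym /path_term.
(* If the path edges already join the two ends, they contain a broken circuit and neither choice for
   the closing edge is admissible; hence the zero function in [path_term]. *)
case: (boolP (conn M 0 d)) => [_|d0] /=; first by rewrite addr0 mul0r.
rewrite cats1; set M' := rcons M _.
have connM' x y : conn M' x y =
    [|| conn M x y, conn M x d && conn M 0 y | conn M x 0 && conn M d y].
  exact: conn_rcons.
have same x : ~~ conn M x 0 -> ~~ conn M x d -> conn M' x =1 conn M x.
  by move=> /negPf x0 /negPf xd y; rewrite connM' x0 xd orbF.
rewrite connM' !conn_refl !orbT (_ : csize d.+1 M' 0 = csize d.+1 M 0 + csize d.+1 M d)%N.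
  rewrite (_ : mid q d.+1 d M' = mid q d.+1 d M); first by rewrite -mulrDl.
  rewrite /mid big_nat_cond [RHS]big_nat_cond.
  apply: eq_big => [x|x /andP[/andP[x0 _] /andP[xM' xd]]].
    case: (boolP (1 <= x < d.+1)%N) => //= /andP[x0 _].
    apply/andP/andP => -[xM xd]; split.
    - apply/isrootP => y yx; have /isrootP/(_ _ yx) := xM.
      by apply: contra => xy; rewrite connM' xy.
    - by apply: contra xd => xd; rewrite connM' xd.
    - have xM0 := elimT (isrootP _ _) xM.
      by apply/isrootP => y yx; rewrite same //; exact: xM0.
    - by rewrite same //; exact: (elimT (isrootP _ _) xM).
  congr (q _); apply: eq_bigr => y _; rewrite same //.
    by apply: contra (elimT (isrootP _ _) xM' _ x0) => x0'; rewrite connM' x0'.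
  by apply: contra xd => xd; rewrite connM' xd.
rewrite /csize -big_split; apply: eq_bigr => y _.
rewrite connM' (negPf d0) conn_refl /=; case: (boolP (conn M 0 y)) => //= y0.
by rewrite -(conn_eqr _ y0) conn_sym (negPf d0).
Qed.

End Paths.

(** * The cycle sums as power series in z *)

Section CycleSeries.

Variable R : comNzRingType.
Implicit Types (f g h u a b c : fps R).

Lemma tri_sumM N f g h : f 0%N = 0 -> g 0%N = 0 ->
  tri_sum N (fun x y => f x * g y * h (N - x - y)%N) = (f * g * h) N.
Proof.
move=> f0 g0; rewrite -mulrA coef_fpsM1 // /tri_sum.
case: N => [|N]; first by rewrite !big_geq.
rewrite [RHS]big_nat_recr //= subnn coef_fpsM0 g0 mul0r mulr0 addr0.
rewrite big_nat [RHS]big_nat; apply: eq_bigr => x /andP[x0 xN].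
rewrite coef_fpsM1 // big_distrr [LHS](@big_cat_nat _ _ _ (N.+1 - x).+1) /=; [|lia|lia].
rewrite [X in _ + X = _]big_nat_cond [X in _ + X = _]big_pred0 ?addr0; last by move=> y; lia.
rewrite [LHS]big_nat_cond [RHS]big_nat_cond; apply: eq_big => y; first by lia.
by rewrite mulrA.
Qed.

Lemma tri_sum_diag N (F : nat -> R) :
  tri_sum N (fun x y => F (x + y)%N) = \sum_(1 <= n < N.+1) F n *+ n.-1.
Proof.
transitivity (\sum_(1 <= x < N) \sum_(1 <= n < N.+1 | (x < n)%N) F n).
  rewrite /tri_sum big_nat [RHS]big_nat; apply: eq_bigr => x /andP[x0 xN].
  rewrite [RHS](@big_cat_nat _ _ _ x.+1) /=; [|lia|lia].
  rewrite [X in _ = X + _]big_nat_cond [X in _ = X + _]big_pred0 ?add0r; last by move=> y; lia.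
  rewrite -(add1n x) big_addn [LHS](@big_cat_nat _ _ _ (N.+1 - x)) /=; [|lia|lia].
  rewrite [X in _ + X = _]big_nat_cond [X in _ + X = _]big_pred0 ?addr0; last by move=> y; lia.
  rewrite [LHS]big_nat_cond [RHS]big_nat_cond; apply: eq_big => y; first by lia.
  by rewrite addnC.
rewrite (exchange_big_dep xpredT) //= big_nat [RHS]big_nat; apply: eq_bigr => n /andP[n0 nN].
rewrite (@big_cat_nat _ _ _ n) /=; [|lia|lia].
rewrite [X in _ + X]big_nat_cond [X in _ + X]big_pred0 ?addr0; last by move=> y; lia.
rewrite big_nat_cond (eq_bigl (fun x => (1 <= x < n)%N)) => [|x]; last by lia.
by rewrite -big_nat sumr_const_nat subn1.
Qed.

Lemma tri_sumD N (F F' : nat -> nat -> R) :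
  tri_sum N (fun x y => F x y + F' x y) = tri_sum N F + tri_sum N F'.
Proof. by rewrite /tri_sum -big_split; apply: eq_bigr => x _; rewrite -big_split. Qed.

Lemma tri_sum_fps N f g u h : f 0%N = 0 -> g 0%N = 0 -> u 0%N = 0 ->
  tri_sum N (fun x y => (f x * g y + u (x + y)%N) * h (N - x - y)%N) =
  ((f * g + zderiv u - u) * h) N.
Proof.
move=> f0 g0 u0.
rewrite -addrA mulrDl coef_fpsD -tri_sumM //.
rewrite (@eq_tri_sum _ N _ (fun x y => f x * g y * h (N - x - y)%N
   + (fun n => u n * h (N - n)%N) (x + y)%N)) => [|x y _ _ _]; last first.
  by rewrite mulrDl subnDA.
rewrite tri_sumD (tri_sum_diag _ (fun n => u n * h (N - n)%N)); congr (_ + _).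
rewrite coef_fpsM1 => [|]; last by rewrite /zderiv !fpsE u0 mul0rn subr0.
rewrite big_nat [RHS]big_nat; apply: eq_bigr => -[|n] // _.
by rewrite /zderiv !fpsE mulrS addrAC subrr add0r mulrnAl.
Qed.

(** The difference [zderiv u - u] multiplies the coefficient of z^n by n - 1, the number of pairs of
    positive sizes with sum n. *)
Definition cycle_series a b c k : fps R :=
  (pser a c * qser b c k + zderiv (qser a c k) - qser a c k) * geom (pser b c).

Theorem cycle_sum_fps a b c k N : (2 <= N)%N -> a 0%N = 0 -> b 0%N = 0 ->
  nbc_sum_last (qser a c k) (pser a c) (qser b c k) (pser b c) N.-1
     (edges (cycle_graph N)) = cycle_series a b c k N.
Proof.
move=> N2 a0 b0; rewrite cycle_sum //.
by rewrite tri_sum_fps ?pser0 ?qser0.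
Qed.

Lemma zderiv_zpow m : zderiv (zpow R m) = zpow R m *+ m.
Proof.
apply/funext => n; rewrite /zderiv /zpow !fpsE.
by case: eqP => [->|_] //; rewrite !mul0rn.
Qed.

(** The product rule for the division by z^(k-1). *)
Lemma shift_zderiv k f : (0 < k)%N -> shift k (zderiv f) = zderiv (shift k f) + shift k f *+ k.-1.
Proof.
case: k => // k _; apply/funext => -[|n].
  by rewrite coef_fpsD coef_fpsMn /zderiv mulr0n mul0rn add0r.
by rewrite coef_fpsD coef_fpsMn /zderiv /= -mulrnDr addnS addSn.
Qed.

Lemma shift_zpow k i : (0 < i)%N ->
  shift k (zpow R i) = if (k <= i)%N then zpow R (i - k).+1 else 0.
Proof.
move=> i0; apply/funext => -[|n]; first by case: ifP.
rewrite /= /zpow; case: leqP => ki; first by congr (_%:R); lia.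
by rewrite (_ : (_ == _) = false) //; lia.
Qed.

Lemma geom_eq f g : f 0%N = 0 -> (1 - f) * g = 1 -> g = geom f.
Proof.
by move=> f0 fg; rewrite -[g]mul1r -(geomE f0) mulrAC fg mul1r.
Qed.

Section ElementaryWeights.

Variable h : fps R.
Hypothesis h0 : h 0%N = 0.

(** Write E = 1 + h. Then [S] is 1 / E and [pser b (- h)] is z E' / E. Since 1 - z E' / E = (E - z
    E') / E and E - z E' = 1 - (b - h), its geometric series is E times [V]. *)
Let b := zderiv h.
Let b0 : b 0%N = 0. Proof. by []. Qed.
Let S := geom (- h).
Let V := geom (b - h).
Let U := geom b.

Let S_E : (1 + h) * S = 1.
Proof. by rewrite -{1}[h]opprK; apply: geomE; rewrite fpsE h0 oppr0. Qed.
Let D0 : (b - h) 0%N = 0. Proof. by rewrite !fpsE h0 b0 subr0. Qed.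
Let V_E : (1 - (b - h)) * V = 1. Proof. exact: geomE. Qed.
Let U_E : (1 - b) * U = 1. Proof. exact: geomE. Qed.

Let zderivS : zderiv S = - (b * S * S).
Proof.
have : zderiv ((1 + h) * S) = 0 by rewrite S_E zderiv1.
rewrite zderivM zderivD zderiv1 add0r -/b => /(congr1 ( *%R S)).
rewrite mulrDr mulr0 [S * ((1 + h) * _)]mulrA [S * (1 + h)]mulrC S_E mul1r.
by move/eqP; rewrite addrC addr_eq0 => /eqP->; congr (- _); ring.
Qed.

Lemma geom_pserS : geom (pser b (- h)) * S = V.
Proof.
set H := geom _; have H_E : (1 - b * S) * H = 1.
  by apply: geomE; rewrite coef_fpsM0 b0 mul0r.
apply: geom_eq D0 _.
have HS : 1 - b * S = S * (1 - (b - h)).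
  by rewrite -{1}S_E; ring.
by rewrite -[RHS]H_E HS; ring.
Qed.

Lemma geom_pser : geom (pser b (- h)) = (1 + h) * V.
Proof. by rewrite -geom_pserS mulrCA S_E mulr1. Qed.

Variable k : nat.
Hypothesis k_gt0 : (0 < k)%N.
Let K := shift k h.

Let shiftN : shift k (- h) = - K.
Proof. by apply/funext => -[|n]; rewrite /K /shift !fpsE ?oppr0. Qed.

(** The terms in [zderiv K] and in b S^2 K coming from the product and from the derivative cancel;
    what is left is (k - i) z^i K S and the contribution of the one-part compositions. The factor
    [geom (pser b (- h))] then turns S into V. *)
Lemma cycle_series_zpow i : (0 < i)%N ->
  cycle_series (zpow R i) b (- h) k =
  (zderiv (shift k (zpow R i)) - shift k (zpow R i)) * ((1 + h) * V)
  + zpow R i * K * V *+ k - zpow R i * K * V *+ i.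
Proof.
move=> i0; rewrite /cycle_series -geom_pser -geom_pserS.
rewrite /qser shiftN shift_zderiv // -/K /pser.
rewrite zderivD !zderivM zderivN zderivS zderiv_zpow -/S.
move: (geom _) (zderiv (shift _ _)) (shift k (zpow R i)) => H Z' Z.
rewrite -[in X in _ = _ + X - _](prednK k_gt0).
(* Natural multiples are replaced by products with opaque constants, so that [ring] can treat them
   as atoms. *)
have [nat natE] : exists nat : nat -> fps R, forall x n, x *+ n = x * nat n.
  by exists (fun n => n%:R) => x n; rewrite mulr_natr.
rewrite mulrSr !natE; move: (zpow R i) (nat _) (nat _) => z k' i'.
ring.
Qed.

Lemma cycle_series_unit i : (0 < i)%N ->
  cycle_series (zpow R i) b 0 k =
  (zpow R i * (zderiv K + K *+ k.-1)
   + zderiv (shift k (zpow R i)) - shift k (zpow R i)) * U.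
Proof.
move=> i0; have g0 : geom (0 : fps R) = 1 by apply/esym/geom_eq; rewrite ?subr0 ?mulr1.
have s0 : shift k (0 : fps R) = 0 by apply/funext => -[].
by rewrite /cycle_series /qser /pser g0 s0 !mulr1 !mulr0 !addr0 shift_zderiv.
Qed.

End ElementaryWeights.

End CycleSeries.

(** * Nonnegativity of the cycle series, for any cone closed under sums and products *)

Section PositiveCone.

Variables (R : comNzRingType) (nn : R -> Prop).
Hypotheses (nn0 : nn 0) (nn1 : nn 1).
Hypothesis nnD : forall x y, nn x -> nn y -> nn (x + y).
Hypothesis nnM : forall x y, nn x -> nn y -> nn (x * y).

Lemma nn_sum (I : Type) (r : seq I) (P : pred I) (F : I -> R) :
  (forall i, P i -> nn (F i)) -> nn (\sum_(i <- r | P i) F i).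
Proof. exact: big_ind. Qed.

Lemma nn_muln x n : nn x -> nn (x *+ n).
Proof. by move=> nnx; elim: n => [|n IH]; rewrite ?mulr0n ?mulrS //; exact: nnD. Qed.

Implicit Types f g h : fps R.

Definition fps_nn f := forall n, nn (f n).

Lemma fps_nnD f g : fps_nn f -> fps_nn g -> fps_nn (f + g).
Proof. by move=> nf ng n; apply: nnD. Qed.

Lemma fps_nnM f g : fps_nn f -> fps_nn g -> fps_nn (f * g).
Proof. by move=> nf ng n; rewrite coef_fpsM; apply: nn_sum => i _; apply: nnM. Qed.

Lemma fps_nn_muln f m : fps_nn f -> fps_nn (f *+ m).
Proof. by move=> nf n; rewrite coef_fpsMn; exact: nn_muln. Qed.

Lemma fps_nn_zpow m : fps_nn (zpow R m).
Proof. by move=> n; rewrite /zpow; case: eqP. Qed.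

Lemma fps_nn_zderiv f : fps_nn f -> fps_nn (zderiv f).
Proof. by move=> nf n; apply: nn_muln. Qed.

Lemma fps_nn_shift k f : fps_nn f -> fps_nn (shift k f).
Proof. by move=> nf [|n]; [exact: nn0|exact: nf]. Qed.

Lemma fps_nn_geom f : fps_nn f -> fps_nn (geom f).
Proof.
move=> nf; elim/ltn_ind => -[|n] IH; first exact: nn1.
rewrite geomS // big_nat; apply: nn_sum => i i1; apply: nnM; first exact: nf.
by apply: IH; lia.
Qed.

Variable h : fps R.
Hypotheses (h0 : h 0%N = 0) (h_nn : fps_nn h).
Let b := zderiv h.
Let V := geom (b - h).
Let U := geom b.
Variables k i : nat.
Hypotheses (k_gt0 : (0 < k)%N) (i_gt0 : (0 < i)%N).
Let K := shift k h.
(** This is 1 + sum_{j < k} h_j z^j: the subtracted product is the tail of [h] from degree [k]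
    on. *)
Let low := 1 + h - zpow R k.-1 * K.

Let b0 : b 0%N = 0. Proof. by []. Qed.
Let D0 : (b - h) 0%N = 0. Proof. by rewrite !fpsE h0 b0 subr0. Qed.
Let V_E : (1 - (b - h)) * V = 1. Proof. exact: geomE. Qed.
Let U_E : (1 - b) * U = 1. Proof. exact: geomE. Qed.

Let nn_b : fps_nn b. Proof. exact: fps_nn_zderiv. Qed.
Let nn_D : fps_nn (b - h).
Proof.
move=> [|n]; first by rewrite D0.
by rewrite !fpsE /b /zderiv mulrSr addrK; exact: nn_muln.
Qed.
Let nn_V : fps_nn V. Proof. exact: fps_nn_geom. Qed.
Let nn_U : fps_nn U. Proof. exact: fps_nn_geom. Qed.
Let nn_K : fps_nn K. Proof. exact: fps_nn_shift. Qed.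
Let nn_dK : fps_nn (zderiv K). Proof. exact: fps_nn_zderiv. Qed.

Let nn_low : fps_nn low.
Proof.
move=> n; rewrite /low !fpsE coef_zpowM; case: leqP => kn; last first.
  by rewrite subr0; apply: nnD => //; case: eqP.
rewrite /K /shift; case nk: (n - k.-1)%N => [|m].
  by rewrite subr0; apply: nnD => //; case: eqP.
rewrite (_ : (m + k)%N = n); last lia.
by rewrite addrK; case: eqP.
Qed.

(** This is 1 / V - 1 / U = h, multiplied by U V. *)
Let UV : U - V = U * h * V.
Proof.
transitivity (U * ((1 - (b - h)) * V) - (1 - b) * U * V).
  by rewrite V_E U_E mulr1 mul1r.
ring.
Qed.

(** From 1 / V = 1 + h - b and 1 / U = 1 - b one gets 1 / V - (1 + h) / U = h b; the second summand
    restores the tail missing from [low]. *)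
Let UlowV : U - low * V = U * h * b * V + zpow R k.-1 * K * V.
Proof.
transitivity (U * ((1 - (b - h)) * V) - (1 + h) * V * ((1 - b) * U) + zpow R k.-1 * K * V).
  by rewrite V_E U_E !mulr1 /low; ring.
by congr (_ + _); ring.
Qed.

Lemma cycle_series_signed :
  cycle_series (zpow R i) b (- h) k =
  if (k <= i)%N then zpow R (i - k).+1 * low * V *+ (i - k)
  else zpow R i * K * V *+ (k - i).
Proof.
rewrite cycle_series_zpow // -/b -/V -/K shift_zpow //; case: leqP => ki; last first.
  have z0 : zderiv (0 : fps R) = 0 by apply/funext => n; rewrite /zderiv mul0rn.
  by rewrite z0 subr0 mul0r add0r mulrnBr // ltnW.
have zE : zpow R i = zpow R (i - k).+1 * zpow R k.-1 by rewrite -zpowD; congr zpow; lia.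
rewrite zderiv_zpow mulrSr addrK zE -addrA -opprB -mulrnBr //.
by rewrite mulrnAl -mulrnBl; congr (_ *+ _); rewrite /low; ring.
Qed.

Theorem cycle_series_nn : fps_nn (cycle_series (zpow R i) b (- h) k).
Proof.
rewrite cycle_series_signed; case: leqP => _; apply: fps_nn_muln;
  by do !apply: fps_nnM => //; exact: fps_nn_zpow.
Qed.

Theorem cycle_series_unit_nn :
  fps_nn (cycle_series (zpow R i) b 0 k - cycle_series (zpow R i) b (- h) k).
Proof.
rewrite cycle_series_signed cycle_series_unit // -/K -/U shift_zpow //.
case: leqP => ki.
  rewrite zderiv_zpow mulrSr [X in (X - _) * U]addrA addrK.
  rewrite mulrDl -addrA mulrnAl -mulrnBl -mulrA -mulrBr UlowV.
  by apply: fps_nnD; [|apply: fps_nn_muln]; repeat first [apply: fps_nnM | apply: fps_nnD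
   | apply: fps_nn_muln | exact: fps_nn_zpow | done].
rewrite (_ : zderiv 0 = 0) ?subr0 ?addr0; last by apply/funext => n; rewrite /zderiv mul0rn.
(* The multiple k - 1 is split as (i - 1) + (k - i), so that the subtracted signed series only meets
   [U] in the nonnegative difference [U - V]. *)
rewrite (_ : _ - _ = zpow R i * ((zderiv K + K *+ i.-1) * U + (K *+ (k - i)) * (U - V))).
  by rewrite UV; repeat first [apply: fps_nnM | apply: fps_nnD
   | apply: fps_nn_muln | exact: fps_nn_zpow | done].
rewrite (_ : k.-1 = i.-1 + (k - i))%N; last lia.
rewrite mulrnDr -mulrnAr -[X in _ - X]mulrA mulrnAl; ring.
Qed.

End PositiveCone.

(** * Counting criterion for sign-reversing involutions *)

Section InvolutionCount.

Variables (X : finType) (K : eqType) (S : {set X}) (s : X -> int) (u : pred X) (c : X -> K).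
Hypothesis s_pm1 : {in S, forall x, s x = 1 \/ s x = -1}.
Hypothesis s_unit : {in S, forall x, u x -> s x = 1}.

(** Elements that are not fixed cancel in pairs within their class; the fixed ones are units, of
    sign 1. *)
Lemma sum_sign_involution phi :
  {in S, forall x, [/\ phi x \in S, phi (phi x) = x, c (phi x) = c x,
    phi x <> x -> s (phi x) <> s x & phi x = x -> u x]} ->
  forall k, 0 <= \sum_(x in S | c x == k) s x <= \sum_(x in S | c x == k) (u x : int).
Proof.
move=> phiP k; rewrite (bigID (fun x => phi x == x)) /=.
set N := \sum_(x | _ && (phi x != x)) s x.
have N0 : N = 0.
  suff : N = - N by lia.
  rewrite /N {1}(reindex_onto phi phi) /=; last first.
    by move=> x /andP[/andP[xS _] _]; have [] := phiP x xS.
  rewrite -sumrN; apply: eq_big => x.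
    apply/idP/idP => [/andP[/andP[/andP[pS /eqP ck] pp] /eqP ppx]|/andP[/andP[xS /eqP ck] px]].
      have [xS _ cp _ _] := phiP _ pS; rewrite ppx in xS cp pp.
      by rewrite xS cp ck eqxx /= eq_sym.
    by have [pS ppx cp _ _] := phiP x xS; rewrite ppx pS cp ck !eqxx /= eq_sym px.
  move=> /andP[/andP[/andP[pS _] pp] /eqP ppx].
  have [xS _ _ spp _] := phiP _ pS; rewrite ppx in xS pp spp.
  have xp : x <> phi x by apply/eqP.
  have := s_pm1 xS; have := s_pm1 pS; have := spp xp; lia.
rewrite N0 addr0.
have fixE : \sum_(x in S | (c x == k) && (phi x == x)) s x =
            \sum_(x in S | (c x == k) && (phi x == x)) (u x : int).
  apply: eq_bigr => x /andP[xS /andP[_ /eqP px]].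
  by have [_ _ _ _ /(_ px) ux] := phiP x xS; rewrite s_unit // ux.
rewrite (eq_bigl (fun x => (x \in S) && ((c x == k) && (phi x == x)))) => [|x]; last first.
  by rewrite andbA.
rewrite fixE; apply/andP; split; first by apply: sumr_ge0 => x _; case: (u x).
rewrite [leRHS](bigID (fun x => phi x == x)) /=.
rewrite (eq_bigl (fun x => (x \in S) && (c x == k) && (phi x == x))) => [|x]; last first.
  by rewrite andbA.
by rewrite lerDl sumr_ge0 // => x _; case: (u x).
Qed.

Let neg k := [seq x <- enum S | (c x == k) && (s x == -1)].
Let nonunit k := [seq x <- enum S | [&& c x == k, s x == 1 & ~~ u x]].
Let unit k := [seq x <- enum S | [&& c x == k, s x == 1 & u x]].
(** The order matters: matching the i-th negative element with the i-th positive one uses up the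
    nonunit elements first, so that only units are left fixed. *)
Let pos k := nonunit k ++ unit k.

Let mem_neg k x : (x \in neg k) = [&& x \in S, c x == k & s x == -1].
Proof. by rewrite mem_filter mem_enum andbC. Qed.
Let mem_nonunit k x : (x \in nonunit k) = [&& c x == k, s x == 1, ~~ u x & x \in S].
Proof. by rewrite mem_filter mem_enum -!andbA. Qed.
Let mem_unit k x : (x \in unit k) = [&& c x == k, s x == 1, u x & x \in S].
Proof. by rewrite mem_filter mem_enum -!andbA. Qed.
Let mem_pos k x : (x \in pos k) = [&& x \in S, c x == k & s x == 1].
Proof.
rewrite mem_cat mem_nonunit mem_unit.
by case: (x \in S); case: (c x == k); case: (s x == 1); case: (u x).
Qed.
Let uniq_neg k : uniq (neg k). Proof. by rewrite filter_uniq ?enum_uniq. Qed.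
Let uniq_unit k : uniq (unit k). Proof. by rewrite filter_uniq ?enum_uniq. Qed.
Let uniq_pos k : uniq (pos k).
Proof.
rewrite cat_uniq; apply/and3P; split; [by rewrite filter_uniq ?enum_uniq| |
  by rewrite filter_uniq ?enum_uniq].
apply/hasPn => x; rewrite mem_unit => /and4P[_ _ ux _].
by rewrite /= mem_nonunit ux !andbF.
Qed.

(** The default value [x] of [nth] makes unmatched elements fixed points. *)
Definition count_involution x :=
  if s x == -1 then nth x (pos (c x)) (index x (neg (c x)))
  else nth x (neg (c x)) (index x (pos (c x))).

Hypothesis count_le : forall k,
  0 <= \sum_(x in S | c x == k) s x <= \sum_(x in S | c x == k) (u x : int).

Let sum_s k : \sum_(x in S | c x == k) s x = (size (pos k))%:Z - (size (neg k))%:Z.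
Proof.
rewrite (bigID (fun x => s x == -1)) /= addrC; congr (_ + _).
  rewrite (eq_bigl (mem (pos k))) => [|x]; last first.
    rewrite /= mem_pos -andbA; case: (boolP (x \in S)) => //= xS.
    by case: (c x == k) => //=; case: (s_pm1 xS) => ->.
  rewrite -big_uniq // (eq_big_seq (fun=> 1)) => [|x]; last first.
    by rewrite mem_pos => /and3P[_ _ /eqP].
  by rewrite big_const_seq count_predT iter_addr_0 natz.
rewrite (eq_bigl (mem (neg k))) => [|x]; last by rewrite /= mem_neg andbA.
rewrite -big_uniq // (eq_big_seq (fun=> -1)) => [|x]; last first.
  by rewrite mem_neg => /and3P[_ _ /eqP].
by rewrite sumrN big_const_seq count_predT iter_addr_0 natz.
Qed.

Let sum_u k : \sum_(x in S | c x == k) (u x : int) = (size (unit k))%:Z.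
Proof.
rewrite (bigID u) /= [X in _ + X]big1 ?addr0 => [|x /andP[_ /negPf->]] //.
rewrite (eq_bigl (mem (unit k))) => [|x]; last first.
  rewrite /= mem_unit; case: (boolP (x \in S)) => //= xS; rewrite ?andbF //.
  case: (c x == k) => //=; rewrite andbT; case: (boolP (u x)) => ux; rewrite ?andbF //.
  by rewrite (s_unit xS ux) eqxx.
rewrite -big_uniq // (eq_big_seq (fun=> 1)) => [|x]; last first.
  by rewrite mem_unit => /and4P[_ _ ->].
by rewrite big_const_seq count_predT iter_addr_0 natz.
Qed.

(** The two bounds of [count_le] become this inequality, which matches every negative element, and
    the next one, which matches every positive nonunit element. *)
Let size_neg_pos k : (size (neg k) <= size (pos k))%N.
Proof. by have := count_le k; rewrite sum_s; lia. Qed.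
Let size_nonunit_neg k : (size (nonunit k) <= size (neg k))%N.
Proof. by have := count_le k; rewrite sum_s sum_u /pos size_cat; lia. Qed.

Lemma count_involutionP : {in S, forall x,
  [/\ count_involution x \in S, count_involution (count_involution x) = x,
      c (count_involution x) = c x,
      count_involution x <> x -> s (count_involution x) <> s x &
      count_involution x = x -> u x]}.
Proof.
move=> x xS; set k := c x.
case: (boolP (s x == -1)) => sx.
  have xneg : x \in neg k by rewrite mem_neg xS eqxx.
  have iN : (index x (neg k) < size (pos k))%N.
    by apply: leq_trans (size_neg_pos k); rewrite index_mem.
  have yE : count_involution x = nth x (pos k) (index x (neg k)).
    by rewrite /count_involution sx.
  have : nth x (pos k) (index x (neg k)) \in pos k by rewrite mem_nth.
  rewrite -yE mem_pos; move: (count_involution x) yE => y yE /and3P[yS /eqP cy /eqP sy].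
  have yx : y <> x by move=> yx; move: sx; rewrite -yx sy.
  split=> //; last by rewrite sy => _ /esym/eqP; rewrite (eqP sx).
  have iy : index y (pos k) = index x (neg k) by rewrite yE index_uniq.
  rewrite /count_involution sy (_ : (1 == -1 :> int) = false) // cy iy.
  by rewrite (set_nth_default x) ?nth_index // index_mem.
have sx1 : s x = 1 by case: (s_pm1 xS) sx => ->.
have xpos : x \in pos k by rewrite mem_pos xS eqxx sx1.
have yE : count_involution x = nth x (neg k) (index x (pos k)).
  by rewrite /count_involution (negPf sx).
case: (ltnP (index x (pos k)) (size (neg k))) => iN; last first.
  have yx : count_involution x = x by rewrite yE nth_default.
  rewrite !yx; split=> // _.
  have : x \notin nonunit k.
    apply: contraL iN => xn; rewrite -ltnNge /pos index_cat xn.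
    by apply: leq_trans (size_nonunit_neg k); rewrite index_mem.
  by rewrite mem_nonunit xS eqxx sx1 andbT /= negbK.
have : nth x (neg k) (index x (pos k)) \in neg k by rewrite mem_nth.
rewrite -yE mem_neg; move: (count_involution x) yE => y yE /and3P[yS /eqP cy /eqP sy].
have yx : y <> x by move=> yx; move: sy; rewrite yx sx1.
split=> //; last by rewrite sy sx1.
have iy : index y (neg k) = index x (pos k) by rewrite yE index_uniq.
rewrite /count_involution sy eqxx cy iy.
by rewrite (set_nth_default x) ?nth_index // index_mem.
Qed.

End InvolutionCount.

(** * Reading type, sign and unitality off the weights *)

Section WeightOfType.

Variables (G : graph) (R : comNzRingType) (A : nat -> nat -> R) (h : fps R).
Implicit Types (Fs : {set triple G}) (t : triple G).

Let B (j _ : nat) := h j.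

Lemma FT_wf Fs : Fs \in FT G -> {in Fs, forall t, wf_triple t}.
Proof.
by rewrite inE => /existsP[F /and4P[_ _ _ /forallP wf]] t; exact/implyP.
Qed.

Lemma wf_tcomp t : wf_triple t ->
  tcomp t = head 0%N (tcomp t) :: behead (tcomp t) /\ 0%N \notin tcomp t.
Proof.
move=> /andP[/andP[t0 _] /andP[r1 rh]]; split=> //.
by case: (tcomp t) rh => //= /(leq_trans r1).
Qed.

Lemma ft_type_perm Fs : perm_eq (ft_type Fs) (flatten [seq tcomp t | t <- enum Fs]).
Proof. exact/permEl/perm_sort. Qed.

Lemma ft_type_pos Fs : Fs \in FT G -> 0%N \notin ft_type Fs.
Proof.
move=> FsG; rewrite (perm_mem (ft_type_perm Fs)); apply/flattenP => -[_ /mapP[t + ->]].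
by rewrite mem_enum => /(FT_wf FsG)/wf_tcomp[_ /negPf->].
Qed.

Lemma ft_type'_perm Fs t : Fs \in FT G -> t \in Fs -> triple_at 0 Fs = Some t ->
  perm_eq (ft_type' Fs)
    (behead (tcomp t) ++ flatten [seq tcomp t' | t' <- rem t (enum Fs)]).
Proof.
move=> FsG tF tE; have [tc _] := wf_tcomp (FT_wf FsG tF).
have tyE : perm_eq (ft_type Fs) (head 0%N (tcomp t) ::
    (behead (tcomp t) ++ flatten [seq tcomp t' | t' <- rem t (enum Fs)])).
  rewrite -cat_cons -tc; apply: perm_trans (ft_type_perm Fs) _.
  have tF' : t \in enum Fs by rewrite mem_enum.
  by have /(perm_map (@tcomp G))/perm_flatten := perm_to_rem tF'.
rewrite /ft_type' /alpha_min1 tE -(perm_cons (head 0%N (tcomp t))).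
apply: (perm_trans _ tyE); rewrite perm_sym; apply: perm_to_rem.
by rewrite (perm_mem tyE) mem_head.
Qed.

Lemma perm_ft_type Fs : wf_graph G -> Fs \in FT G ->
  perm_eq (ft_type Fs) (alpha_min1 Fs :: ft_type' Fs).
Proof.
move=> /andP[G0 _] FsG; have [t [tE tF _ _]] := triple_atP FsG G0.
apply: perm_to_rem; rewrite /alpha_min1 tE (perm_mem (ft_type_perm Fs)).
apply/flattenP; exists (tcomp t); first by rewrite map_f ?mem_enum.
by have [-> _] := wf_tcomp (FT_wf FsG tF); exact: mem_head.
Qed.

Lemma ft_weight_type' Fs : wf_graph G -> Fs \in FT G ->
  ft_weight A B h Fs = A (alpha_min1 Fs) (r_min Fs) * \prod_(j <- ft_type' Fs) h j.
Proof.
move=> /andP[G0 _] FsG; have [t [tE tF t0 t_uniq]] := triple_atP FsG G0.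
have tF' : t \in enum Fs by rewrite mem_enum.
rewrite (perm_big _ (ft_type'_perm FsG tF tE)) big_cat big_flatten big_map /=.
rewrite /ft_weight -big_enum (perm_big _ (perm_to_rem tF')) big_cons.
rewrite {1}/triple_weight t0 /alpha_min1 /r_min tE mulrA; congr (_ * _).
apply: eq_big_seq => t'; rewrite mem_rem_uniq ?enum_uniq // !inE => /andP[t't].
rewrite mem_enum => t'F; rewrite /triple_weight ifF; last first.
  by apply: contraNF t't => /(t_uniq _ t'F)->.
by have [tc _] := wf_tcomp (FT_wf FsG t'F); rewrite [in RHS]tc big_cons.
Qed.

(** Each composition has one part fewer than its length weighted by [- h], which matches its
    exponent in [ft_sign]. *)
Lemma ft_weightN (B' : nat -> nat -> R) Fs :
  ft_weight A B' (- h) Fs = (ft_sign Fs)%:~R * ft_weight A B' h Fs.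
Proof.
rewrite /ft_sign rmorphXn rmorphN1 expr_sum -big_split; apply: eq_bigr => t _ /=.
rewrite /triple_weight mulrCA -size_behead; congr (_ * _).
elim: (behead _) => [|j s IH]; first by rewrite !big_nil mulr1.
by rewrite !big_cons IH exprS !fpsE; ring.
Qed.

(** Weight zero on later parts kills every composition with more than one part. *)
Lemma ft_weight0 (B' : nat -> nat -> R) Fs : Fs \in FT G ->
  ft_weight A B' 0 Fs = (ft_unit Fs)%:R * ft_weight A B' h Fs.
Proof.
move=> FsG.
transitivity (\prod_(t in Fs) ((size (tcomp t) == 1%N)%:R * triple_weight A B' h t)).
  apply: eq_bigr => t tF; rewrite /triple_weight mulrCA; congr (_ * _).
  have [tc _] := wf_tcomp (FT_wf FsG tF); rewrite [X in size X]tc.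
  by case: (behead _) => [|j s]; rewrite !(big_nil, big_cons) ?mulr1 // !mul0r.
rewrite big_split /=; congr (_ * _).
case: (boolP (ft_unit Fs)) => [/forallP uF|].
  by apply: big1 => t tF; rewrite (implyP (uF t) tF).
rewrite negb_forall => /existsP[t]; rewrite negb_imply => /andP[tF /negPf tu].
by rewrite (bigD1 t) //= tu mul0r.
Qed.

End WeightOfType.

Section PowerSeriesCone.

Implicit Types (f g : pseries) (m : {mset nat}%mset).

Definition ps_nn f := forall m, 0 <= f m.

Lemma ps_nn0 : ps_nn 0. Proof. by []. Qed.
Lemma ps_nn1 : ps_nn 1. Proof. by move=> m; exact: ler0n. Qed.
Lemma ps_nnD f g : ps_nn f -> ps_nn g -> ps_nn (f + g).
Proof. by move=> nf ng m; exact: addr_ge0. Qed.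

Lemma coef_psM f g m : (f * g) m = \sum_(d <- divs m) f d * g (m `\` d)%mset.
Proof. exact: ps_mulE. Qed.

Lemma ps_nnM f g : ps_nn f -> ps_nn g -> ps_nn (f * g).
Proof.
by move=> nf ng m; rewrite coef_psM; apply: sumr_ge0 => d _; exact: mulr_ge0.
Qed.

Lemma coef_psD f g m : (f + g) m = f m + g m. Proof. by []. Qed.
Lemma coef_psN f m : (- f) m = - f m. Proof. by []. Qed.
Lemma coef_ps_sum (I : Type) (r : seq I) (P : pred I) (F : I -> pseries) m :
  (\sum_(i <- r | P i) F i) m = \sum_(i <- r | P i) F i m.
Proof. exact: (big_morph (fun f : pseries => f m)). Qed.
Lemma coef_psMz f (n : int) m : (n%:~R * f) m = n * f m.
Proof.
have nat_case (k : nat) : (k%:Z%:~R * f) m = k%:Z * f m.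
  elim: k => [|k IH]; first by rewrite !mul0r.
  by rewrite -[k.+1]add1n PoszD rmorphD !mulrDl coef_psD IH !mul1r.
by case: n => n //; rewrite NegzE rmorphN !mulNr coef_psN nat_case.
Qed.

Definition mono m : pseries := fun m' => (m' == m)%:R.

Lemma mono0 : mono mset0%mset = 1. Proof. by []. Qed.

Lemma monoM m n : mono (m `+` n)%mset = mono m * mono n.
Proof.
apply/funext => m'; rewrite coef_psM /mono.
case: (boolP (m \in divs m')) => md.
  rewrite (bigD1_seq m) ?uniq_divs //= big1 => [|d /negPf->]; last by rewrite mul0r.
  rewrite eqxx mul1r addr0; congr (_%:R); congr nat_of_bool.
  move: md; rewrite mem_divs => /msetDBK m'E; rewrite -{1}m'E.
  by apply/eqP/eqP => [/(congr1 (msetB^~ m))|->]; rewrite ?msetDKB.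
rewrite big1_seq => [|d /andP[_ dm]]; last first.
  by case: eqP md => [<-|_ _]; rewrite ?dm // mul0r.
case: eqP => // m'E; case/negP: md; rewrite mem_divs m'E.
by apply/msubsetP => x; rewrite msetE2 leq_addr.
Qed.

End PowerSeriesCone.

Section GluingFormula.

Variable R : comNzRingType.
Implicit Types (A B : nat -> nat -> R) (c : fps R).

Definition head_delta i r : nat -> nat -> R := fun j r' => ((j == i) && (r' == r))%:R.

Lemma head_series_delta i r :
  head_series (head_delta i r) = if (1 <= r <= i)%N then zpow R i else 0.
Proof.
apply/funext => j; rewrite /head_series /head_delta.
transitivity (if (1 <= r <= i)%N then (j == i)%:R else 0 : R); last by case: ifP.
case: (eqVneq j i) => [->|ji]; last first.
  by rewrite big1 //; case: ifP.
case: ifP => ri.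
  rewrite (bigD1_seq r) ?iota_uniq ?mem_index_iota //= eqxx.
  by rewrite big1 ?addr0 // => r' /negPf->.
rewrite big_nat big1 // => r' r'i; case: eqP => // r'r.
by rewrite -r'r -[in X in _ && X]ltnS r'i in ri.
Qed.

(** The cut part [k] has no root of its own; prescribing root 1 gives exactly the head series
    z^k. *)
Theorem sum_ft_weight_cycle A B c a (G' : graph) :
  (2 <= a)%N -> wf_graph G' -> c 0%N = 0 ->
  \sum_(Fs in FT (gsum (cycle_graph a) G')) ft_weight A B c Fs =
  \sum_(1 <= k < (nv G').+1)
    (\sum_(Fs in FT G') ft_weight (head_delta k 1) B c Fs)
    * nbc_sum_last (qser (head_series A) c k) (pser (head_series A) c)
                   (qser (head_series B) c k) (pser (head_series B) c)
                   a.-1 (edges (cycle_graph a)).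
Proof.
move=> a2 wfG' c0; rewrite sum_ft_weight; last by apply: wf_gsum => //; exact: wf_cycle.
have G'0 : (0 < nv G')%N by have /andP[] := wfG'.
rewrite (_ : nv (gsum _ _) = a.-1 + (nv G').-1.+1)%N; last by rewrite prednK //=; lia.
rewrite (_ : edges (gsum _ _) = edges (cycle_graph a) ++ eshift a.-1 (edges G')) //.
rewrite nbc_sum_gsum ?head_series0 //; last exact: cycle_edges_le.
rewrite prednK // big_nat [RHS]big_nat; apply: eq_bigr => k /andP[k0 _].
by rewrite sum_ft_weight // head_series_delta k0.
Qed.

End GluingFormula.

Section Pieces.

(** The constant term is 0 and not e_0 = 1: parts of compositions are positive, and the geometric
    series need it to vanish. *)
Definition elem_fps : fps pseries := fun j => if j is 0%N then 0 else elem_sym j.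

Lemma prod_elem_fps s : 0%N \notin s -> \prod_(j <- s) elem_fps j = elem_sym_seq s.
Proof. by move=> s0; apply: eq_big_seq => -[|j] // js; rewrite js in s0. Qed.

Variable G : graph.
Hypothesis wfG : wf_graph G.
Implicit Type Fs : {set triple G}.

Let B (j _ : nat) := elem_fps j.

Lemma ft_weight_piece Fs i : Fs \in FT G ->
  ft_weight (head_delta pseries i 1) B (- elem_fps) Fs =
  if (alpha_min1 Fs == i) && (r_min Fs == 1%N)
  then (ft_sign Fs)%:~R * elem_sym_seq (ft_type' Fs) else 0.
Proof.
move=> FsG; rewrite ft_weightN ft_weight_type' // /head_delta.
case: ifP => _; last by rewrite mul0r mulr0.
rewrite mul1r prod_elem_fps //; apply: contra (ft_type_pos FsG).
by rewrite (perm_mem (perm_ft_type wfG FsG)) inE orbC => ->.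
Qed.

Lemma ft_weight_total Fs : Fs \in FT G ->
  ft_weight B B (- elem_fps) Fs = (ft_sign Fs)%:~R * elem_sym_seq (ft_type Fs).
Proof.
move=> FsG; rewrite ft_weightN ft_weight_type' // -prod_elem_fps ?ft_type_pos //.
by rewrite (perm_big _ (perm_ft_type wfG FsG)) big_cons.
Qed.

Lemma chromatic_pieceE i :
  chromatic_piece G i = \sum_(Fs in FT G) ft_weight (head_delta _ i 1) B (- elem_fps) Fs.
Proof.
rewrite /chromatic_piece big_mkcondr; apply: eq_bigr => Fs FsG.
by rewrite ft_weight_piece.
Qed.

End Pieces.

Section CyclePieces.

Variables (a : nat) (U : graph).
Hypotheses (a_ge2 : (2 <= a)%N) (wfU : wf_graph U).

Let wfG : wf_graph (gsum (cycle_graph a) U).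
Proof. by apply: wf_gsum; first exact: wf_cycle. Qed.

Let B (j _ : nat) := elem_fps j.

Lemma BpieceE i :
  Bpiece a U i = \sum_(Fs in FT' a U) ft_weight (head_delta _ i 1) B (- elem_fps) Fs.
Proof.
rewrite /Bpiece big_mkcondr; apply: eq_bigr => Fs; rewrite inE => /andP[FsG _].
by rewrite ft_weight_piece.
Qed.

Lemma BfunE : Bfun a U = \sum_(Fs in FT' a U) ft_weight B B (- elem_fps) Fs.
Proof.
by apply: eq_bigr => Fs; rewrite inE => /andP[FsG _]; rewrite ft_weight_total.
Qed.

End CyclePieces.

(** * First-preserving involutions *)

(* The part [j] is recorded by the variable [x_j], so that coefficients of
   sums over forest triples count the forest triples of a given type. *)
Definition part_var : fps pseries :=
  fun j => if j is 0%N then 0 else mono [mset j]%mset.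

Lemma prod_part_var s : 0%N \notin s -> \prod_(j <- s) part_var j = mono (seq_mset s).
Proof.
elim: s => [|[|j] s IH]; last 1 first.
- by rewrite inE => s0; rewrite big_cons IH // mset_cons monoM.
- rewrite big_nil -mono0 (_ : seq_mset [::] = mset0%mset) //.
  by apply/msetP => x; rewrite mset_seqE mset0E.
- by rewrite inE.
Qed.

Lemma part_var_nn : fps_nn ps_nn part_var.
Proof. by move=> [|j] m //; exact: ler0n. Qed.

Section Involutions.

Variable G : graph.
Hypothesis wfG : wf_graph G.
Implicit Types (Fs : {set triple G}) (m : {mset nat}%mset).

Local Notation B := (fun j _ : nat => part_var j).

Definition ft_class Fs := (ft_type Fs, alpha_min1 Fs, r_min Fs).

(** Once alpha_1 = i is known, the type amounts to the multiset [m] of the remaining parts, that is,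
    to a monomial of a power series. *)
Lemma ft_classE Fs i r m : Fs \in FT G ->
  (ft_class Fs == (sort geq (i :: m), i, r)) =
  [&& alpha_min1 Fs == i, r_min Fs == r & seq_mset (ft_type' Fs) == m].
Proof.
move=> FsG; rewrite /ft_class !xpair_eqE andbAC andbC andbA; case: eqP => //= <-.
rewrite andbC; congr (_ && _).
have geqP : [/\ total geq, transitive geq & antisymmetric geq].
  split; first by move=> x y; exact: leq_total.
    by move=> y x z /= yx zy; exact: leq_trans zy yx.
  by move=> x y; rewrite /= andbC => /anti_leq.
have [t1 t2 t3] := geqP.
transitivity (perm_eq (ft_type Fs) (alpha_min1 Fs :: m)).
  apply/eqP/idP => [->|]; first by rewrite perm_sort.
  by rewrite /ft_type perm_sort => /(perm_sortP t1 t2 t3).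
rewrite (permPl (perm_ft_type wfG FsG)) perm_cons -[m in RHS]seq_mset_id.
by apply/idP/eqP => /eq_seq_msetP.
Qed.

Lemma ft_weight_coef Fs i r m : Fs \in FT G ->
  (ft_weight (head_delta _ i r) B part_var Fs) m =
  (ft_class Fs == (sort geq (i :: m), i, r))%:R.
Proof.
move=> FsG; rewrite ft_weight_type' // ft_classE // /head_delta.
rewrite prod_part_var; last first.
  apply: contra (ft_type_pos FsG).
  by rewrite (perm_mem (perm_ft_type wfG FsG)) inE orbC => ->.
rewrite andbA; case: (_ && _) => /=; last by rewrite mul0r.
by rewrite mul1r /mono eq_sym.
Qed.

Lemma signed_coef i r m :
  (\sum_(Fs in FT G) ft_weight (head_delta _ i r) B (- part_var) Fs) m =
  \sum_(Fs in FT G | ft_class Fs == (sort geq (i :: m), i, r)) ft_sign Fs.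
Proof.
rewrite coef_ps_sum big_mkcondr; apply: eq_bigr => Fs FsG.
by rewrite ft_weightN coef_psMz ft_weight_coef //; case: eqP; rewrite ?mulr1 ?mulr0.
Qed.

Lemma unit_coef i r m :
  (\sum_(Fs in FT G) ft_weight (head_delta _ i r) B 0 Fs) m =
  \sum_(Fs in FT G | ft_class Fs == (sort geq (i :: m), i, r)) (ft_unit Fs : int).
Proof.
rewrite coef_ps_sum big_mkcondr; apply: eq_bigr => Fs FsG.
rewrite (ft_weight0 _ part_var) // -[_%:R]/((ft_unit Fs : int)%:~R) coef_psMz ft_weight_coef //.
by case: eqP; rewrite ?mulr1 ?mulr0.
Qed.

Lemma ft_sign_pm1 Fs : ft_sign Fs = 1 \/ ft_sign Fs = -1.
Proof. by rewrite /ft_sign -signr_odd; case: odd; [right|left]. Qed.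

Lemma ft_unit_sign Fs : ft_unit Fs -> ft_sign Fs = 1.
Proof.
move=> /forallP uF; rewrite /ft_sign big1 // => t tF.
by rewrite (eqP (implyP (uF t) tF)).
Qed.

Definition counts_ok := forall i r,
  ps_nn (\sum_(Fs in FT G) ft_weight (head_delta _ i r) B (- part_var) Fs) /\
  ps_nn (\sum_(Fs in FT G) ft_weight (head_delta _ i r) B 0 Fs
         - \sum_(Fs in FT G) ft_weight (head_delta _ i r) B (- part_var) Fs).

Theorem involution_counts : has_first_preserving_involution (FT G) <-> counts_ok.
Proof.
split=> [[phi phiP] i r | ok].
  have inv : {in FT G, forall Fs, [/\ phi Fs \in FT G, phi (phi Fs) = Fs,
      ft_class (phi Fs) = ft_class Fs, phi Fs <> Fs -> ft_sign (phi Fs) <> ft_sign Fs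
      & phi Fs = Fs -> ft_unit Fs]}.
    move=> Fs /phiP[h1 [h2 [h3 [h4 [h5 [h6 h7]]]]]].
    by split=> //; rewrite /ft_class h3 h6 h7.
  have cnt := sum_sign_involution (fun Fs _ => ft_sign_pm1 Fs)
    (fun Fs _ => @ft_unit_sign Fs) inv.
  split=> m; first by rewrite signed_coef; have /andP[] := cnt (sort geq (i :: m), i, r).
  rewrite coef_psD coef_psN signed_coef unit_coef subr_ge0.
  by have /andP[] := cnt (sort geq (i :: m), i, r).
have cnt k : 0 <= \sum_(Fs in FT G | ft_class Fs == k) ft_sign Fs
               <= \sum_(Fs in FT G | ft_class Fs == k) (ft_unit Fs : int).
  (* A class that is not attained gives empty sums; an attained one has the shape of [ft_classE] for
     any of its members. *)
  case: (pickP (fun Fs => (Fs \in FT G) && (ft_class Fs == k))) => [Fs|none]; last first.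
    by rewrite !big_pred0.
  move=> /andP[FsG /eqP <-].
  have -> : ft_class Fs = (sort geq (alpha_min1 Fs :: seq_mset (ft_type' Fs)),
                           alpha_min1 Fs, r_min Fs).
    by apply/eqP; rewrite ft_classE // !eqxx.
  have [Snn USnn] := ok (alpha_min1 Fs) (r_min Fs).
  apply/andP; split; first by rewrite -signed_coef; exact: Snn.
  by rewrite -signed_coef -unit_coef -subr_ge0 -coef_psN -coef_psD; exact: USnn.
have inv := count_involutionP (fun Fs _ => ft_sign_pm1 Fs)
    (fun Fs _ => @ft_unit_sign Fs) cnt.
exists (count_involution (FT G) (@ft_sign G) (@ft_unit G) ft_class) => Fs FsG.
have [h1 h2 [h3 h4 h5] h6 h7] := inv Fs FsG.
by do 6!split=> //.
Qed.

End Involutions.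

Theorem gsum_involution a (G' : graph) : (2 <= a)%N -> wf_graph G' ->
  has_first_preserving_involution (FT G') ->
  has_first_preserving_involution (FT (gsum (cycle_graph a) G')).
Proof.
move=> a2 wfG' /(involution_counts wfG') ok.
have wfG : wf_graph (gsum (cycle_graph a) G') by apply: wf_gsum => //; exact: wf_cycle.
apply/(involution_counts wfG) => i r.
have pv0 : (- part_var) 0%N = 0 by rewrite coef_fpsN oppr0.
rewrite !sum_ft_weight_cycle // -sumrB.
have hB : head_series (fun j _ => part_var j) = zderiv part_var.
  by apply/funext => j; rewrite /head_series sumr_const_nat subn1.
pose Y c k : pseries := nbc_sum_last (qser (head_series (head_delta pseries i r)) c k)
    (pser (head_series (head_delta pseries i r)) c)
    (qser (head_series (fun j _ => part_var j)) c k)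
    (pser (head_series (fun j _ => part_var j)) c) a.-1 (edges (cycle_graph a)).
have Ynn k : (0 < k)%N -> ps_nn (Y (- part_var) k) /\ ps_nn (Y 0 k - Y (- part_var) k).
  move=> k0; rewrite /Y !cycle_sum_fps ?head_series0 // hB head_series_delta.
  case: ifP => [/andP[r1 ri]|_].
    have i0 : (0 < i)%N by apply: leq_trans ri.
    split.
      exact: (cycle_series_nn ps_nn0 ps_nn1 ps_nnD ps_nnM _ part_var_nn).
    exact: (cycle_series_unit_nn ps_nn0 ps_nn1 ps_nnD ps_nnM _ part_var_nn k0 i0 a).
  (* A prescribed root outside 1, ..., i is never attained, and the head series is zero. *)
  have Y0 c : cycle_series 0 (zderiv part_var) c k = 0.
    rewrite /cycle_series /qser /pser.
    have s0 : shift k (0 : fps pseries) = 0 by apply/funext => -[].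
    have z0 : zderiv (0 : fps pseries) = 0 by apply/funext => n; rewrite /zderiv mul0rn.
    by rewrite s0 !mul0r add0r z0 subrr mul0r.
  by rewrite !Y0 subrr.
pose X c k : pseries := \sum_(Fs in FT G')
  ft_weight (head_delta pseries k 1) (fun j _ => part_var j) c Fs.
split.
  rewrite big_nat; apply: (nn_sum ps_nn0 ps_nnD) => k /andP[k0 _].
  by have [Xs _] := ok k 1%N; have [Ys _] := Ynn k k0; exact: ps_nnM.
rewrite big_nat; apply: (nn_sum ps_nn0 ps_nnD) => k /andP[k0 _].
have [Xs Xu] := ok k 1%N; have [Ys Yu] := Ynn k k0.
rewrite -/(X 0 k) -/(X (- part_var) k) -/(Y 0 k) -/(Y (- part_var) k).
(* The difference of the unit and signed products is rewritten so that every factor is known to be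
   nonnegative. *)
rewrite (_ : _ - _ = (X 0 k - X (- part_var) k) * (Y 0 k - Y (- part_var) k)
  + (X 0 k - X (- part_var) k) * Y (- part_var) k
  + X (- part_var) k * (Y 0 k - Y (- part_var) k)); last by ring.
by apply: ps_nnD; [apply: ps_nnD|]; exact: ps_nnM.
Qed.

(** * Whitney's theorem *)

Section Whitney.

Implicit Types (L M : seq (nat * nat)) (t : bitseq).

(** Induction on the largest edge [e]. If smaller selected edges do not join its ends, both choices
    for [e] are admissible and contribute the factor 1 - [e monochromatic]. If they do, both choices
    are lost, but then a coloring constant along the selected edges makes [e] monochromatic, and the
    right-hand side loses the same term. *)
Lemma whitney (T : eqType) (col : nat -> T) (R : pzRingType) L :
  \sum_(t <- allbits (size L) | nbcb L t)
     (-1) ^+ size (mask t L) * (all (fun e => col e.1 == col e.2) (mask t L))%:R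
  = (all (fun e => col e.1 != col e.2) L)%:R :> R.
Proof.
elim/last_ind: L => [|L e IH]; first by rewrite big_mkcond big_seq1 /= mulr1.
rewrite size_rcons big_mkcond big_allbitsS all_rcons -mulnb natrM -IH.
rewrite big_distrr /= [RHS]big_mkcond big_seq [RHS]big_seq; apply: eq_bigr => t.
rewrite mem_allbits => /eqP tL; rewrite !nbcb_rcons // !mask_rcons // cats0 cats1.
rewrite size_rcons all_rcons exprS mulN1r.
case: ifP => [/andP[-> _]|nc].
  by case: eqP => _; rewrite /= ?mul1r ?mul0r ?mulNr ?mulr0 ?subr0 ?subrr ?oppr0 ?addr0.
case: ifP => nb; rewrite addr0 //; move: nc; rewrite nb => /negbFE ce.
case: (boolP (all _ (mask t L))) => [/allP Mcol|_]; last by rewrite !mulr0.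
rewrite (conn_fun _ ce) ?eqxx ?mul0r // => e' /Mcol /eqP.
exact.
Qed.

(** The new edge merges two components; of their roots r1 < r2 only r2 stops being one. *)
Lemma count_roots n M e : (e.1 < n)%N -> (e.2 < n)%N -> ~~ conn M e.1 e.2 ->
  count (isroot M) (iota 0 n) = (count (isroot (rcons M e)) (iota 0 n)).+1.
Proof.
wlog suff hw : M e / forall r1 r2, (e.1 < n)%N -> (e.2 < n)%N -> (r1 < r2)%N ->
    isroot M r1 -> isroot M r2 -> (r2 < n)%N ->
    (conn M e.1 r1 && conn M e.2 r2) || (conn M e.1 r2 && conn M e.2 r1) ->
    count (isroot M) (iota 0 n) = (count (isroot (rcons M e)) (iota 0 n)).+1.
  move=> e1 e2 ne.
  have [r1 [r1e r1M er1]] := root_exists M e.1.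
  have [r2 [r2e r2M er2]] := root_exists M e.2.
  case: (ltngtP r1 r2) => r12.
  - by apply: (hw M e r1 r2) => //; rewrite ?er1 ?er2 ?(leq_ltn_trans r2e).
  - by apply: (hw M e r2 r1) => //; rewrite ?er1 ?er2 ?orbT ?(leq_ltn_trans r1e).
  - by case/negP: ne; apply: conn_trans er1 _; rewrite r12 conn_sym.
move=> r1 r2 e1 e2 r12 r1M r2M r2n er.
have e12 : conn (rcons M e) e.1 e.2 by apply: conn_mem; rewrite mem_rcons mem_head.
have sub x y : conn M x y -> conn (rcons M e) x y by rewrite conn_rcons => ->.
have r2r1 : conn (rcons M e) r2 r1.
  case/orP: er => /andP[/sub c1 /sub c2].
    by rewrite -(conn_eqr _ c1) conn_sym (conn_eqr _ (y := e.2)) // conn_sym.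
  by rewrite -(conn_eqr _ c2) conn_sym (conn_eqr _ (y := e.1)) // conn_sym.
have rootE x : isroot (rcons M e) x = isroot M x && (x != r2).
  apply/idP/andP => [/isrootP xM|[/[dup] xM /isrootP xM' xr]].
    split; last by apply/eqP => xr; have := xM r1; rewrite xr r12 r2r1 => /(_ isT).
    by apply/isrootP => u ux; apply: contra (xM u ux); exact: sub.
  apply/isrootP => u ux; rewrite conn_rcons negb_or xM' //=.
  have xr2 y : conn M y r2 -> conn M x y = false.
    move=> yr; apply/negP => xy; case/eqP: xr; apply: root_uniq xM r2M _.
    exact: conn_trans xy yr.
  have xr1 y z : conn M y r1 -> conn M z r2 -> conn M x y && conn M z u = false.
    move=> yr zr; apply/negP => /andP[xy zu].
    have x1 : x = r1 by apply: root_uniq xM r1M _; exact: conn_trans xy yr.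
    have /isrootP/(_ u) := r2M; rewrite (ltn_trans ux) ?x1 // => /(_ isT)/negP; apply.
    by rewrite conn_sym; apply: conn_trans zr; rewrite conn_sym.
  case/orP: er => /andP[c1 c2]; first by rewrite (xr1 _ _ c1 c2) (xr2 _ c2).
  by rewrite (xr1 _ _ c2 c1) (xr2 _ c1).
rewrite -!sum1_count big_mkcond [in RHS]big_mkcond /=.
rewrite (bigD1_seq r2) ?iota_uniq ?mem_iota //= r2M.
rewrite [in RHS](bigD1_seq r2) ?iota_uniq ?mem_iota //= rootE eqxx andbF add0n add1n.
by congr _.+1; apply: eq_bigr => x xr; rewrite rootE xr andbT.
Qed.

Lemma count_roots_nbc n L t : {in L, forall e, (e.1 < n)%N && (e.2 < n)%N} ->
  size t = size L -> nbcb L t ->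
  (count (isroot (mask t L)) (iota 0 n) + size (mask t L) = n)%N.
Proof.
elim/last_ind: L t => [|L e IH] t Ln.
  move=> /size0nil-> _ /=; rewrite addn0 (eq_in_count (a2 := predT)) ?count_predT ?size_iota //.
  move=> x _; apply/isrootP => u ux; rewrite conn_nil.
  by apply: contraTneq ux => ->; rewrite ltnn.
case/lastP: t => [|t b]; rewrite !size_rcons // => -[tL]; rewrite nbcb_rcons // => /andP[nb ne].
have {}IH : (count (isroot (mask t L)) (iota 0 n) + size (mask t L) = n)%N.
  by apply: IH => // e' e'L; apply: Ln; rewrite mem_rcons inE e'L orbT.
rewrite mask_rcons //; case: b; rewrite ?cats0 // cats1 size_rcons.
have /andP[e1 e2] : (e.1 < n)%N && (e.2 < n)%N by apply: Ln; rewrite mem_rcons mem_head.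
by rewrite addnS -addSn -count_roots.
Qed.

Lemma sum_csize_roots n M : (\sum_(0 <= x < n | isroot M x) csize n M x = n)%N.
Proof.
rewrite /csize (exchange_big_dep xpredT) //= -[RHS]subn0 -[RHS]muln1 -sum_nat_const_nat.
rewrite big_nat [RHS]big_nat; apply: eq_bigr => y /andP[_ yn].
have [r [ry rM yr]] := root_exists M y.
rewrite big_mkcond (bigD1_seq r) ?iota_uniq ?mem_index_iota ?(leq_ltn_trans ry) //=.
rewrite rM conn_sym yr big1 // => x xr; rewrite andbT; case: ifP => // xM.
case: (boolP (conn M x y)) => // xy; case/eqP: xr.
apply: root_uniq xM rM _.
exact: conn_trans xy yr.
Qed.

(** A non-broken circuit is a forest, so its number of edges is the sum of size minus 1 over its
    trees. *)
Lemma nbc_sign (R : comPzRingType) n L t : {in L, forall e, (e.1 < n)%N && (e.2 < n)%N} ->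
  size t = size L -> nbcb L t ->
  (-1) ^+ size (mask t L) =
  \prod_(0 <= x < n | isroot (mask t L) x) (-1) ^+ (csize n (mask t L) x).-1 :> R.
Proof.
move=> Ln tL nt; rewrite -expr_sum; congr (_ ^+ _).
have := count_roots_nbc Ln tL nt; have := sum_csize_roots n (mask t L).
set M := mask t L; rewrite -sum1_count.
have -> : (\sum_(0 <= x < n | isroot M x) csize n M x =
          \sum_(0 <= x < n | isroot M x) (csize n M x).-1
          + \sum_(i <- iota 0 n | isroot M i) 1)%N.
  rewrite /index_iota subn0 -big_split big_seq_cond [RHS]big_seq_cond.
  apply: eq_bigr => x /andP[]; rewrite mem_iota => xn _.
  by rewrite /= addn1 prednK // csize_gt0.
lia.
Qed.

End Whitney.

Section Colorings.

Variables (R : comNzRingType) (X : nat -> R) (n N : nat) (M : seq (nat * nat)).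
Hypothesis M_lt : {in M, forall e, (e.1 < n)%N && (e.2 < n)%N}.

Definition color (k : {ffun 'I_n -> 'I_N.+1}) (x : nat) := omap k (insub x : option 'I_n).

Let rt (v : 'I_n) : 'I_n := odflt v [pick r : 'I_n | isroot M r && conn M v r].

Let rtP v : isroot M (rt v) /\ conn M v (rt v).
Proof.
rewrite /rt; case: pickP => [r /andP[] //|none].
have [r [rv rM vr]] := root_exists M v.
by have := none (Ordinal (leq_ltn_trans rv (ltn_ord v))); rewrite /= rM vr.
Qed.

Let rt_eq v (r : 'I_n) : isroot M r -> (rt v == r) = conn M r v.
Proof.
move=> rM; have [vM vr] := rtP v; apply/eqP/idP => [<-|rv].
  by rewrite conn_sym.
by apply: val_inj; apply: root_uniq vM rM _; rewrite conn_sym; exact: conn_trans rv vr.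
Qed.

(** A coloring constant on components is a free choice of one color per root, so the sum is a
    product of power sums. *)
Lemma sum_colorings :
  \sum_(k : {ffun 'I_n -> 'I_N.+1})
     (all (fun e => color k e.1 == color k e.2) M)%:R * \prod_v X (k v)
  = \prod_(0 <= x < n | isroot M x) \sum_(c < N.+1) X c ^+ csize n M x.
Proof.
rewrite big_mkord (big_distr_big ord0) /=.
transitivity (\sum_(k : {ffun 'I_n -> 'I_N.+1} | all (fun e => color k e.1 == color k e.2) M)
   \prod_v X (k v)).
  by rewrite [RHS]big_mkcond; apply: eq_bigr => k _; case: all; rewrite ?mul1r ?mul0r.
pose h (f : {ffun 'I_n -> 'I_N.+1}) := [ffun v => f (rt v)].
pose h' (k : {ffun 'I_n -> 'I_N.+1}) := [ffun x : 'I_n => if isroot M x then k x else ord0].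
rewrite (reindex_onto h h') => [|k /allP kM]; last first.
  apply/ffunP => v; rewrite !ffunE; have [-> vr] := rtP v.
  have := conn_fun (f := color k) (fun e eM => eqP (kM e eM)) vr.
  by rewrite /color !valK => -[].
apply: eq_big => [f|f _].
  have -> : all (fun e => color (h f) e.1 == color (h f) e.2) M.
    apply/allP => e eM; have /andP[e1 e2] := M_lt eM.
    rewrite /color !insubT /= !ffunE; apply/eqP; congr (Some (f _)); apply/eqP.
    rewrite rt_eq; last by have [] := rtP (Ordinal e2).
    rewrite conn_sym; apply: conn_trans (conn_mem eM) _.
    by have [] := rtP (Ordinal e2).
  apply/eqP/pffun_onP => [<-|[/supportP fS _]].
    by split=> //; apply/supportP => x /negPf xM; rewrite !ffunE unfold_in in xM *; rewrite xM.
  apply/ffunP => x; rewrite !ffunE; case: ifPn => xM; last by rewrite fS.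
  have xx : rt x = x.
    apply: val_inj; have [yM xy] := rtP x.
    by apply: root_uniq yM xM _; rewrite conn_sym.
  by rewrite xx.
rewrite (partition_big rt (fun x : 'I_n => isroot M x)) /=; last by move=> v _; have [] := rtP v.
apply: eq_bigr => x xM.
rewrite (eq_bigr (fun=> X (f x))) => [|v /eqP vx]; last by rewrite ffunE vx.
rewrite prodr_const; congr (_ ^+ _); rewrite /csize big_mkord -sum1_card big_mkcond /=.
by apply: eq_bigr => v _; rewrite -(rt_eq _ xM) -[_ \in _]/(rt v == x); case: eqP.
Qed.

End Colorings.

(** * Power sums *)

Section Truncation.

Variable N : nat.
Implicit Types (f g : pseries) (m d : {mset nat}%mset).

Definition bounded m : bool := all (fun x => (x < N)%N) m.

Lemma boundedD m d : bounded (m `+` d)%mset = bounded m && bounded d.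
Proof.
apply/allP/andP => [md|[/allP mN /allP dN] x /msetDP[/mN|/dN]] //.
by split; apply/allP => x xm; apply: md; apply/msetDP; [left|right].
Qed.

(* Setting the variables [x_N], [x_(N+1)], ... to zero. *)
Definition ps_trunc f : pseries := fun m => if bounded m then f m else 0.

Lemma ps_trunc_zmod_morphism : zmod_morphism ps_trunc.
Proof.
move=> f g; apply/funext => m; rewrite /ps_trunc !(coef_psD, coef_psN).
by case: ifP; rewrite ?subrr // coef_psN.
Qed.

Lemma ps_trunc_monoid_morphism : monoid_morphism ps_trunc.
Proof.
split.
  apply/funext => m; rewrite /ps_trunc -mono0 /mono; case: ifPn => // /negPf m0.
  case: eqP => // mE; move: m0; rewrite mE.
  by have -> : bounded mset0%mset by apply/allP => x; rewrite in_mset0.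
move=> f g; apply/funext => m; rewrite {1}/ps_trunc !coef_psM.
transitivity (\sum_(d <- divs m) if bounded m then f d * g (m `\` d)%mset else 0).
  by case: ifP => // _; rewrite big1.
rewrite big_seq [RHS]big_seq; apply: eq_bigr => d; rewrite mem_divs => /msetDBK mE.
rewrite /ps_trunc -{1}mE boundedD.
by case: (bounded d); case: (bounded _); rewrite ?mul0r ?mulr0.
Qed.

End Truncation.

HB.instance Definition _ N :=
  GRing.isZmodMorphism.Build pseries pseries (ps_trunc N) (@ps_trunc_zmod_morphism N).
HB.instance Definition _ N :=
  GRing.isMonoidMorphism.Build pseries pseries (ps_trunc N) (@ps_trunc_monoid_morphism N).

Lemma mulr_exprN (R : comPzRingType) (x : R) n : x * (- x) ^+ n = (-1) ^+ n * x ^+ n.+1.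
Proof. by rewrite [in LHS]exprNn exprS mulrCA. Qed.

Section PowerSums.

Definition var (x : nat) : pseries := mono [mset x]%mset.

Lemma coef_varM x f (m : {mset nat}%mset) :
  (var x * f) m = if x \in m then f (m `\ x)%mset else 0.
Proof.
rewrite coef_psM; case: ifPn => xm.
  rewrite (bigD1_seq [mset x]%mset) ?uniq_divs ?mem_divs ?msub1set //= big1 ?addr0.
    by rewrite /var /mono eqxx mul1r.
  by move=> d /negPf dx; rewrite /var /mono dx mul0r.
rewrite big_seq big1 // => d; rewrite mem_divs /var /mono.
by case: eqP => [->|]; rewrite ?mul0r // msub1set (negPf xm).
Qed.

Definition elem_trunc N : fps pseries := fun j => ps_trunc N (elem_fps j).

Lemma elem_trunc1E N j (m : {mset nat}%mset) : (1 + elem_trunc N) j m =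
  [&& bounded N m, size (m : seq nat) == j & uniq (m : seq nat)]%:R.
Proof.
rewrite coef_fpsD coef_fps1 coef_psD /elem_trunc /ps_trunc /elem_fps.
case: j => [|j] /=; last by rewrite add0r /elem_sym; case: bounded.
rewrite (_ : (if _ then _ else _) = 0) ?addr0; last by case: ifP.
rewrite -[true%:R]mono0 /mono size_mset_eq0; case: eqP => [->|_]; last by rewrite andbF.
have m0 : ((mset0%mset : {mset nat}%mset) : seq nat) = [::].
  by apply: size0nil; rewrite size_mset0.
by rewrite /bounded m0.
Qed.

Definition linear_fps (x : pseries) : fps pseries := fun j => if j == 1%N then x else 0.

Lemma coef_linearM x (f : fps pseries) j :
  (linear_fps x * f) j = if j is j'.+1 then x * f j' else 0.
Proof.
rewrite coef_fpsM1 //; case: j => [|j]; first by rewrite big_geq.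
rewrite big_ltn // big_add1 big_nat big1 => [|i /andP[i0 _]]; last first.
  by rewrite /linear_fps eqSS; case: eqP i0 => [->|]; rewrite ?mul0r.
by rewrite addr0 subSS subn0.
Qed.

(** A squarefree monomial in x_0, ..., x_N either avoids x_N or contains it exactly once. *)
Lemma elem_truncS N :
  1 + elem_trunc N.+1 = (1 + elem_trunc N) * (1 + linear_fps (var N)).
Proof.
set v := linear_fps _.
apply/funext => j; apply/funext => m.
rewrite elem_trunc1E.
have -> : (1 + elem_trunc N) * (1 + v) = (1 + elem_trunc N) + v * (1 + elem_trunc N).
  by ring.
rewrite coef_fpsD coef_psD elem_trunc1E coef_linearM.
have split_m : N \in m -> let m' := (m `\ N)%mset in
    [/\ size (m : seq nat) = (size (m' : seq nat)).+1,
        uniq (m : seq nat) = (N \notin m') && uniq (m' : seq nat) &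
        forall P : pred nat, all P m = P N && all P m'].
  move=> Nm m'; have mE : perm_eq (m : seq nat) (N :: m').
    by apply/eq_seq_msetP; rewrite mset_cons !seq_mset_id msetB1K.
  by split; rewrite ?(perm_size mE) ?(perm_uniq mE) // => P; rewrite (perm_all _ mE).
have bS (m' : {mset nat}%mset) : bounded N m' = bounded N.+1 m' && (N \notin m').
  apply/allP/andP => [mN|[/allP mN Nm] x xm].
    split; first by apply/allP => x /mN /leqW.
    by apply/negP => /mN; rewrite ltnn.
  have := mN x xm; rewrite ltnS leq_eqVlt => /predU1P[xN|//].
  by rewrite -xN xm in Nm.
rewrite bS; case: (boolP (N \in m)) => Nm; last first.
  rewrite andbT; case: j => [|j]; first by rewrite addr0.
  by rewrite coef_varM (negPf Nm) addr0.
rewrite andbF add0r; have [sz un al] := split_m Nm.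
rewrite {1}/bounded al ltnSn un sz.
case: j => [|j]; first by rewrite andbF.
rewrite coef_varM Nm elem_trunc1E bS eqSS /bounded /=.
by congr (nat_of_bool _)%:R; case: (N \in _); rewrite ?andbF ?andbT.
Qed.

(* The power sums in the first [N] variables are, up to sign, the coefficients
   of the logarithmic derivative of [\prod_(x < N) (1 + var x * z)]. *)
Theorem newton N n : (0 < n)%N ->
  pser (zderiv (elem_trunc N)) (- elem_trunc N) n =
  (-1) ^+ n.-1 * \sum_(x < N) var x ^+ n.
Proof.
have e0 M : elem_trunc M 0%N = 0 by exact: raddf0.
have inv M : (1 + elem_trunc M) * geom (- elem_trunc M) = 1.
  by rewrite -{1}[elem_trunc M]opprK; apply: geomE; rewrite coef_fpsN e0 oppr0.
have der M : zderiv (elem_trunc M) = zderiv (1 + elem_trunc M).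
  by rewrite zderivD zderiv1 add0r.
move=> n0; elim: N => [|N IH].
  have -> : elem_trunc 0 = 0.
    apply: (addrI 1); apply/funext => j; apply/funext => m.
    rewrite elem_trunc1E addr0 coef_fps1.
    case: (m =P mset0%mset) => [->|/eqP m0].
      rewrite size_mset0 /bounded.
      have -> : ((mset0%mset : {mset nat}%mset) : seq nat) = [::].
        by apply: size0nil; rewrite size_mset0.
      case: j => [|j] //=.
      by rewrite -[RHS]/((mset0%mset == mset0%mset :> {mset nat}%mset)%:R) eqxx.
    have -> : bounded 0 m = false.
      by apply: contraNF m0; rewrite -size_mset_eq0 /bounded; case: (enum_mset m).
    case: j => [|j] //=.
    by rewrite -[RHS]/((m == mset0%mset)%:R) (negPf m0).
  rewrite big_ord0 mulr0 /pser (_ : zderiv 0 = 0) ?mul0r //.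
  by apply/funext => j; rewrite /zderiv mul0rn.
set x := var N; set v := linear_fps x.
have T1 : (1 + v) * geom (- v) = 1.
  by rewrite -{1}[v]opprK; apply: geomE; rewrite coef_fpsN oppr0.
have ST : geom (- elem_trunc N.+1) = geom (- elem_trunc N) * geom (- v).
  transitivity ((1 + elem_trunc N) * geom (- elem_trunc N) * ((1 + v) * geom (- v))
                * geom (- elem_trunc N.+1)); first by rewrite inv T1 !mul1r.
  transitivity ((1 + elem_trunc N) * (1 + v) * geom (- elem_trunc N.+1)
     * (geom (- elem_trunc N) * geom (- v))); first by ring.
  by rewrite -elem_truncS inv mul1r.
have vE : zderiv v = v.
  by apply/funext => j; rewrite /zderiv /v /linear_fps; case: eqP => [->|_]; rewrite ?mul0rn.
have TE j : geom (- v) j = (- x) ^+ j.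
  elim: j => [|j IHj] //; rewrite geomS //.
  rewrite -(@coef_fpsM1 _ (- v) (geom (- v))); last by rewrite coef_fpsN oppr0.
  by rewrite mulNr coef_fpsN coef_linearM IHj exprS mulNr.
(* The logarithmic derivative turns the new factor [1 + v] into a new summand. *)
have -> : pser (zderiv (elem_trunc N.+1)) (- elem_trunc N.+1) =
    pser (zderiv (elem_trunc N)) (- elem_trunc N) + v * geom (- v).
  rewrite /pser ST der elem_truncS -/x -/v zderivM !zderivD !zderiv1 !add0r vE.
  move: (inv N) T1.
  move: (elem_trunc N) (geom (- elem_trunc N)) (geom (- v)) (zderiv _) => e S T d ES vT.
  transitivity (d * S * ((1 + v) * T) + (1 + e) * S * (v * T)); first by ring.
  by rewrite ES vT mulr1 mul1r.
rewrite coef_fpsD IH big_ord_recr mulrDr; congr (_ + _).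
case: n n0 {IH} => // n _; rewrite coef_linearM TE.
exact: mulr_exprN.
Qed.

End PowerSums.

Lemma rmorph_pser (R R' : comNzRingType) (phi : {rmorphism R -> R'}) (a c : fps R) n :
  a 0%N = 0 -> (0 < n)%N ->
  phi (pser a c n) = pser ((fun j => phi (a j)) : fps R') (fun j => phi (c j)) n.
Proof.
move=> a0 n0; rewrite -!comps_pser ?a0 ?rmorph0 // rmorph_sum; apply: eq_bigr => s _.
by rewrite rmorphM rmorph_prod.
Qed.

Section Chromatic.

Variable G : graph.
Hypothesis wfG : wf_graph G.

Let n := nv G.
Let G0 : (0 < n)%N. Proof. by have /andP[] := wfG. Qed.
Let L_lt : {in edges G, forall e, (e.1 < n)%N && (e.2 < n)%N}.
Proof. by have /andP[_ /allP wf] := wfG; move=> e /wf /and3P[-> ->]. Qed.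

(** Colorings contributing to [m] use only colors that occur in [m], so finitely many colors
    suffice. *)
Lemma chromatic_coef N (m : {mset nat}%mset) : bounded N.+1 m ->
  chromatic_sym G m =
  (\sum_(k : {ffun 'I_n -> 'I_N.+1})
     (all (fun e => color k e.1 != color k e.2) (edges G))%:R * \prod_v var (k v)) m.
Proof.
move=> mN; rewrite coef_ps_sum.
pose vk (k : {ffun 'I_n -> 'I_N.+1}) : {ffun vertex G -> nat} := [ffun v => val (k v)].
pose ok k := all (fun e => color k e.1 != color k e.2) (edges G) && (seq_mset (codom (vk k)) == m).
have prodE (k : {ffun 'I_n -> 'I_N.+1}) : \prod_v var (k v) = mono (seq_mset (codom (vk k))).
  rewrite /codom /image_mem -[LHS]big_enum /=.
  elim: (enum _) => [|v s IH]; last first.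
    by rewrite big_cons IH [seq_mset _]/= mset_cons monoM ffunE.
  rewrite big_nil -mono0 (_ : seq_mset _ = mset0%mset) //.
  by apply/msetP => x; rewrite mset_seqE mset0E.
transitivity (\sum_(k : {ffun 'I_n -> 'I_N.+1} | ok k) (1 : int)); last first.
  rewrite big_mkcond; apply: eq_bigr => k _; rewrite prodE /ok.
  case: all; last by rewrite mul0r.
  by rewrite mul1r /mono eq_sym; case: eqP.
have properE (k : {ffun 'I_n -> 'I_N.+1}) : reflect (proper_coloring (vk k))
    (all (fun e => color k e.1 != color k e.2) (edges G)).
  have colorE (v : vertex G) : color k v = Some (k v) by rewrite /color valK.
  apply: (iffP allP) => [kP e u v euv|kP e].
    rewrite !ffunE => /val_inj kuv.
    have := kP _ (mem_tnth e (in_tuple (edges G))).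
    by case/orP: euv => /eqP->; rewrite /= !colorE kuv eqxx.
  case/(nthP (0, 0)%N) => i iL <-; have [[u v] /= euv _] := edgeP wfG (Ordinal iL).
  rewrite (nth_edges (Ordinal iL)) euv /= !colorE; apply/eqP => -[kuv].
  by case: (kP (Ordinal iL) u v); rewrite ?ffunE ?kuv // /joins euv eqxx.
have vk_inj : injective vk.
  by move=> k k' /ffunP kk'; apply/ffunP => v; apply: val_inj; have := kk' v; rewrite !ffunE.
rewrite -big_filter -(big_map vk xpredT (fun=> 1)) fsbig_seq; last first.
  by rewrite map_inj_uniq ?filter_uniq ?index_enum_uniq.
rewrite /chromatic_sym; congr (\sum_(k \in _) 1); apply/seteqP; split=> [k [kP km]|f] /=.
  have kN v : (k v < N.+1)%N.
    move/allP: mN; apply; rewrite -km.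
    by rewrite (perm_mem (perm_eq_seq_mset _)) codom_f.
  apply/mapP; exists [ffun v => inord (k v)].
    rewrite mem_filter mem_index_enum andbT /ok.
    have vkE : vk [ffun v => inord (k v)] = k by apply/ffunP => v; rewrite !ffunE /= inordK.
    by rewrite vkE km eqxx andbT; apply/properE; rewrite vkE.
  by apply/ffunP => v; rewrite !ffunE /= inordK.
by case/mapP=> k; rewrite mem_filter => /andP[/andP[/properE kP /eqP km] _] ->.
Qed.

(** Coefficient by coefficient, only finitely many variables matter. After truncation [newton] turns
    each tree of size s into (-1)^(s-1) times a power sum; the signs multiply to that of [whitney],
    the power sums count colorings constant on the trees, and exchanging the two sums leaves the
    proper colorings. *)
Theorem chromatic_nbc_sum :
  chromatic_sym G = nbc_sum (pser (zderiv elem_fps) (- elem_fps))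
                            (pser (zderiv elem_fps) (- elem_fps)) n (edges G).
Proof.
apply/funext => m; pose N := \max_(x <- m) x.
have mN : bounded N.+1 m.
  by apply/allP => x xm; rewrite ltnS /N; exact: leq_bigmax_seq.
rewrite (chromatic_coef mN); set p := pser _ _.
transitivity (ps_trunc N.+1 (nbc_sum p p n (edges G)) m); last by rewrite /ps_trunc mN.
congr (_ m); rewrite /nbc_sum rmorph_sum /=.
have pE k : (0 < k)%N -> ps_trunc N.+1 (p k) = (-1) ^+ k.-1 * \sum_(x < N.+1) var x ^+ k.
  move=> k0; rewrite -newton // rmorph_pser //; congr (pser _ _ k).
    by apply/funext => j; rewrite /zderiv /elem_trunc raddfMn.
  by apply/funext => j; rewrite !coef_fpsN raddfN.
transitivity (\sum_(t <- allbits (size (edges G)) | nbcb (edges G) t)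
   (-1) ^+ size (mask t (edges G)) *
   \prod_(0 <= x < n | isroot (mask t (edges G)) x)
     \sum_(c < N.+1) var c ^+ csize n (mask t (edges G)) x); last first.
  rewrite big_seq_cond [RHS]big_seq_cond; apply: eq_bigr => t /andP[].
  rewrite mem_allbits => /eqP tL nt; rewrite (nbc_sign _ L_lt tL nt) -big_split.
  set M := mask t _; pose F x := (-1) ^+ (csize n M x).-1 * \sum_(c < N.+1) var c ^+ csize n M x.
  have restE : ps_trunc N.+1 (rest p n M) = \prod_(1 <= x < n | isroot M x) F x.
    rewrite rmorph_prod /= big_nat_cond [RHS]big_nat_cond.
    by apply: eq_bigr => x /andP[/andP[_ xn] _]; rewrite pE ?csize_gt0.
  rewrite rmorphM /= restE pE ?csize_gt0 //.
  by transitivity (\prod_(0 <= x < n | isroot M x) F x); rewrite // big_ltn_cond // isroot0.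
rewrite [RHS]big_seq_cond.
under [RHS]eq_bigr => t tL.
  rewrite -sum_colorings; last by move=> e /mem_mask/L_lt.
  rewrite big_distrr /=; over.
rewrite -big_seq_cond exchange_big /=; apply: eq_bigr => k _.
rewrite -(whitney (color k)) big_distrl /=; apply: eq_bigr => t _.
by rewrite mulrA.
Qed.

End Chromatic.

Theorem theorem6p5 (a : nat) (G' : graph) (a_ge2 : (2 <= a)%N)
    (wfG' : wf_graph G')
    (invG' : has_first_preserving_involution (FT G')) :
  let G := gsum (cycle_graph a) G' in
  has_first_preserving_involution (FT G) /\
  forall U : nat -> graph,
    (forall k, (1 <= k)%N -> is_tree (U k) /\ nv (U k) = k) ->
    chromatic_sym G
      = \sum_(1 <= k < (nv G').+1) chromatic_piece G' k * Bfun a (U k)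
    /\
    forall i : nat, (1 <= i)%N ->
      chromatic_piece G i
        = \sum_(1 <= k < (nv G').+1) chromatic_piece G' k * Bpiece a (U k) i.
Proof.
move=> G; split=> [|U treeU]; first exact: gsum_involution.
have wfG : wf_graph G by apply: wf_gsum => //; exact: wf_cycle.
have e0 : (- elem_fps) 0%N = 0 by rewrite coef_fpsN oppr0.
have wfU k : (1 <= k)%N -> wf_graph (U k) by move=> /treeU[/and3P[]].
split=> [|i i0].
  rewrite chromatic_nbc_sum //.
  have hB : head_series (fun j _ => elem_fps j) = zderiv elem_fps.
    by apply/funext => j; rewrite /head_series sumr_const_nat subn1.
  (* The factor j of Newton's identities is read as the j choices of a root, which makes the
     chromatic sum a sum over forest triples. *)
  rewrite -{1}hB -{1}hB -sum_ft_weight // sum_ft_weight_cycle //.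
  rewrite big_nat [RHS]big_nat; apply: eq_bigr => k /andP[k0 _].
  have [tk nk] := treeU k k0.
  by rewrite chromatic_pieceE // BfunE ?wfU // sum_FT'_weight // nk.
rewrite chromatic_pieceE // sum_ft_weight_cycle //.
rewrite big_nat [RHS]big_nat; apply: eq_bigr => k /andP[k0 _].
have [tk nk] := treeU k k0.
by rewrite chromatic_pieceE // BpieceE ?wfU // sum_FT'_weight // nk.
Qed.
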